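(* Let $\mathbb{M}$ be a smooth connected manifold of dimension $n+m$ equipped with a Riemannian foliation with bundle-like complete metric $g$ and totally geodesic $m$-dimensional leaves, and assume that the horizontal distribution is Yang-Mills ($\delta_{\mathcal H}T=0$). Assume that for every $\eta_1\in\Gamma^\infty(\mathcal H^* )$ and $\eta_2\in\Gamma^\infty(\mathcal V^* )$, $$\langle\mathfrak{Ric}_{\mathcal H}(\eta_1),\eta_1\rangle_{\mathcal H}\ge\rho_1\|\eta_1\|_{\mathcal H}^2,\quad-\langle\mathbf J^2\eta_1,\eta_1\rangle_{\mathcal H}\le\kappa\|\eta_1\|_{\mathcal H}^2,\quad-\tfrac14\mathbf{Tr}_{\mathcal H}(J_{\eta_2}^2)\ge\rho_2\|\eta_2\|_{\mathcal V}^2,$$ for some $\rho_1\in\mathbb R$ and $\kappa,\rho_2>0$. Then for every $f\in C^\infty(\mathbb{M})$ and $\varepsilon>0$, $$\Gamma_2(f,f)+\varepsilon\Gamma_2^{\mathcal V}(f,f)\ge\frac1n(\Delta_{\mathcal H}f)^2+\Big(\rho_1-\frac\kappa\varepsilon\Big)\Gamma(f,f)+\rho_2\Gamma^{\mathcal V}(f,f),$$ and $$\Gamma(f,\Gamma^{\mathcal V}(f))=\Gamma^{\mathcal V}(f,\Gamma(f)).$$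
   Context: A foliation is Riemannian with bundle-like metric $g$ if locally it is given by the fibers of Riemannian submersions. $\mathcal V$ is the sub-bundle tangent to the leaves, $\mathcal H=\mathcal V^\perp$ has rank $n$, $g=g_{\mathcal H}\oplus g_{\mathcal V}$, and $T^*\mathbb{M}=\mathcal H^*\oplus\mathcal V^*$ (horizontal forms vanish on $\mathcal V$, vertical forms on $\mathcal H$). $\nabla_{\mathcal H}f,\nabla_{\mathcal V}f$ are the projections of the gradient on $\mathcal H,\mathcal V$. The horizontal Laplacian $\Delta_{\mathcal H}$ satisfies $\int f\Delta_{\mathcal H}h\,d\mu=-\int\langle\nabla_{\mathcal H}f,\nabla_{\mathcal H}h\rangle d\mu$ for compactly supported smooth functions, $\mu$ being the Riemannian volume. Bott connection: with $D$ the Levi-Civita connection of $g$, $\nabla_XY=(D_XY)_{\mathcal H}$ for $X,Y$ horizontal, $[X,Y]_{\mathcal H}$ for $X$ vertical and $Y$ horizontal, $[X,Y]_{\mathcal V}$ for $X$ horizontal and $Y$ vertical, $(D_XY)_{\mathcal V}$ for $X,Y$ vertical. $T$ is its torsion; $T(X,Y)=-[X,Y]_{\mathcal V}$ for horizontal $X,Y$. For a vector $Z$, $J_Z:\mathcal H\to\mathcal H$ is the skew-symmetric map with $g_{\mathcal H}(J_ZX,Y)=g_{\mathcal V}(Z,T(X,Y))$, extended by $0$ on $\mathcal V$; for a one-form $\eta$, $J_\eta=J_Z$ with $Z$ the $g$-dual of $\eta$. $\mathbf J^2=\sum_{\ell=1}^mJ_{Z_\ell}J_{Z_\ell}$ for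 a local orthonormal vertical frame; $(1,1)$ tensors act on one-forms through $g$-duality. $\mathbf{Tr}_{\mathcal H}$ is the trace over $\mathcal H$. $\delta_{\mathcal H}T(X)=-\sum_{j=1}^n(\nabla_{X_j}T)(X_j,X)$ for a local orthonormal horizontal frame. $\mathfrak{Ric}_{\mathcal H}$ is the fiberwise symmetric linear map on one-forms with $\langle\mathfrak{Ric}_{\mathcal H}(df),dh\rangle=\mathbf{Ricci}(\nabla_{\mathcal H}f,\nabla_{\mathcal H}h)$, $\mathbf{Ricci}$ being the Ricci curvature of $\nabla$. For $f,h\in C^\infty(\mathbb{M})$: $\Gamma(f,h)=\langle\nabla_{\mathcal H}f,\nabla_{\mathcal H}h\rangle$, $\Gamma^{\mathcal V}(f,h)=\langle\nabla_{\mathcal V}f,\nabla_{\mathcal V}h\rangle$, $\Gamma(f)=\Gamma(f,f)$, $\Gamma^{\mathcal V}(f)=\Gamma^{\mathcal V}(f,f)$, $$\Gamma_2(f,h)=\tfrac12(\Delta_{\mathcal H}\Gamma(f,h)-\Gamma(h,\Delta_{\mathcal H}f)-\Gamma(f,\Delta_{\mathcal H}h)),$$ $$\Gamma_2^{\mathcal V}(f,h)=\tfrac12(\Delta_{\mathcal H}\Gamma^{\mathcal V}(f,h)-\Gamma^{\mathcal V}(h,\Delta_{\mathcal H}f)-\Gamma^{\mathcal V}(f,\Delta_{\mathcal H}h)).$$ *)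

(* Defs.v *)
From HB Require Import structures.
From mathcomp Require Import all_boot all_order all_algebra.
From mathcomp Require Import all_classical all_reals all_analysis.
Set Implicit Arguments.
Unset Strict Implicit.
Unset Printing Implicit Defensive.
Import Order.TTheory GRing.Theory Num.Theory.
Import numFieldNormedType.Exports.
Local Open Scope classical_set_scope.
Local Open Scope ring_scope.

Section Euclidean.
Context {R : realType} {d : nat}.

(* the iterated partial derivative of f along the coordinates listed in s *)
Definition ipartial (s : seq 'I_d) (f : 'rV[R]_d -> R) : 'rV[R]_d -> R :=
  foldr (fun (i : 'I_d) (h : 'rV[R]_d -> R) u => 'D_(delta_mx 0 i) h u) f s.

(* Meant for an open set Omega; f may take arbitrary values outside. *)
Definition smooth_on (Omega : set 'rV[R]_d) (f : 'rV[R]_d -> R) :=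
  forall (s : seq 'I_d) u, Omega u ->
    {for u, continuous (ipartial s f)} /\
    (forall i, derivable (ipartial s f) u (delta_mx 0 i)).

End Euclidean.

(* The integral over R^d as an iterated Lebesgue integral; it is only applied
   to continuous compactly supported functions. *)
Fixpoint iterated_integral {R : realType} (d : nat) :
    ('rV[R]_d -> R) -> R :=
  match d with
  | 0%N => fun F => F 0
  | d'.+1 => fun F => \int[lebesgue_measure]_(t in [set: R])
      iterated_integral (fun v : 'rV[R]_d' => F (row_mx (t%:M : 'M[R]_1) v))
  end.

(* chart_inv is only meaningful on the open set chart_map @` chart_dom. *)
Record chart (R : realType) (d : nat) (T : topologicalType) := Chart {
  chart_dom : set T;
  chart_map : T -> 'rV[R]_d;
  chart_inv : 'rV[R]_d -> T;
  chart_dom_open : open chart_dom;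
  chart_cod_open : open (chart_map @` chart_dom);
  chart_mapK : forall x, chart_dom x -> chart_inv (chart_map x) = x;
  chart_map_continuous : forall x, chart_dom x -> {for x, continuous chart_map};
  chart_inv_continuous : forall u, (chart_map @` chart_dom) u ->
    {for u, continuous chart_inv}
}.

(* Pointedness only says that a manifold is nonempty; the library asks for it
   in order to build the Borel sigma-algebra. *)
Record manifold (R : realType) (d : nat) := Manifold {
  points :> ptopologicalType;
  atlas : set (chart R d points);
  manifold_hausdorff : hausdorff_space points;
  manifold_second_countable : @second_countable points;
  atlas_cover : forall x : points, exists2 c, atlas c & chart_dom c x;
  atlas_compatible : forall c c', atlas c -> atlas c' -> forall j,
    smooth_on (chart_map c @` (chart_dom c `&` chart_dom c'))
              (fun u => chart_map c' (chart_inv c u) 0 j)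
}.

Section Calculus.
Context {R : realType} {d : nat} (M : manifold R d).

Definition smooth (f : M -> R) :=
  forall c, atlas c -> smooth_on (chart_map c @` chart_dom c) (f \o chart_inv c).

(* T_x M is the space of derivations at x of C^oo(M).  A tangent vector is a
   Rocq function on all functions M -> R, so it is normalized to vanish on
   nonsmooth ones: equal derivations of C^oo(M) are then equal vectors. *)
Definition tangent (x : M) : set ((M -> R) -> R) :=
  [set v | [/\ forall f, ~ smooth f -> v f = 0,
               forall a f h, smooth f -> smooth h ->
                 v (fun y => a * f y + h y) = a * v f + v h
             & forall f h, smooth f -> smooth h ->
                 v (fun y => f y * h y) = f x * v h + h x * v f]].

Definition vfield := M -> (M -> R) -> R.

Definition is_vfield (X : vfield) :=
  (forall x, tangent x (X x)) /\
  (forall f, smooth f -> smooth (fun x => X x f)).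

Definition vadd (X Y : vfield) : vfield := fun x f => X x f + Y x f.
Definition vopp (X : vfield) : vfield := fun x f => - X x f.
Definition vsub (X Y : vfield) : vfield := vadd X (vopp Y).
Definition vscale (h : M -> R) (X : vfield) : vfield := fun x f => h x * X x f.
Definition vsum (k : nat) (X : 'I_k -> vfield) : vfield :=
  fun x f => \sum_(i < k) X i x f.

Definition bracket (X Y : vfield) : vfield :=
  fun x f => X x (fun y => Y y f) - Y x (fun y => X y f).

(* One-forms are C^oo(M)-linear maps from vector fields to C^oo(M). *)
Definition one_form := vfield -> M -> R.

Definition is_one_form (eta : one_form) :=
  (forall X, is_vfield X -> smooth (eta X)) /\
  (forall h X Y, smooth h -> is_vfield X -> is_vfield Y ->
     forall x, eta (vadd (vscale h X) Y) x = h x * eta X x + eta Y x).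

Definition differential (f : M -> R) : one_form := fun X x => X x f.

Definition compact_support (f : M -> R) :=
  compact (closure [set x | f x != 0]).

End Calculus.

Section Riemannian.
Context {R : realType} {d : nat} (M : manifold R d).
Variable g : M -> ((M -> R) -> R) -> ((M -> R) -> R) -> R.

Definition ip (X Y : vfield M) : M -> R := fun x => g x (X x) (Y x).

Definition is_metric :=
  [/\ forall x a u v w, tangent x u -> tangent x v -> tangent x w ->
        g x (fun f => a * u f + v f) w = a * g x u w + g x v w,
      forall x u v, tangent x u -> tangent x v -> g x u v = g x v u,
      forall x v, tangent x v -> v != (fun=> 0) -> 0 < g x v v
    & forall X Y, is_vfield X -> is_vfield Y -> smooth (ip X Y)].

Definition is_levi_civita (D : vfield M -> vfield M -> vfield M) :=
  [/\ forall X Y, is_vfield X -> is_vfield Y -> is_vfield (D X Y),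
      forall h X X' Y, smooth h ->
        is_vfield X -> is_vfield X' -> is_vfield Y ->
        D (vadd (vscale h X) X') Y = vadd (vscale h (D X Y)) (D X' Y),
      forall h X Y Y', smooth h ->
        is_vfield X -> is_vfield Y -> is_vfield Y' ->
        D X (vadd (vscale h Y) Y') =
        vadd (vadd (vscale (fun x => X x h) Y) (vscale h (D X Y))) (D X Y'),
      forall X Y, is_vfield X -> is_vfield Y ->
        vsub (D X Y) (D Y X) = bracket X Y
    & forall X Y Z, is_vfield X -> is_vfield Y -> is_vfield Z ->
        forall x, Z x (ip X Y) = ip (D Z X) Y x + ip X (D Z Y) x].

Definition sharp (eta : one_form M) : vfield M := fun x =>
  xget (fun=> 0) [set v | tangent x v /\
    forall X, is_vfield X -> g x v (X x) = eta X x].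

Definition flat (X : vfield M) : one_form M := fun Y => ip X Y.

(* the inner product that g induces on one-forms *)
Definition cometric (eta theta : one_form M) : M -> R := eta (sharp theta).

Definition gradient (f : M -> R) : vfield M := sharp (differential f).

(* the action of a (1,1) tensor on one-forms through g-duality *)
Definition dual_action (A : vfield M -> vfield M) (eta : one_form M) : one_form M :=
  flat (A (sharp eta)).

(* E consists of global vector fields which are orthonormal near x. *)
Definition orthonormal_near (x : M) (k : nat) (E : 'I_k -> vfield M) :=
  (forall i, is_vfield (E i)) /\
  (forall i j, \forall y \near x, ip (E i) (E j) y = (i == j)%:R).

Definition C1_curve (c : R -> M) :=
  forall f, smooth f ->
    (forall t, derivable (f \o c) t 1) /\ continuous (derive1 (f \o c)).

Definition velocity (c : R -> M) (t : R) : (M -> R) -> R :=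
  fun f => if `[< smooth f >] then derive1 (f \o c) t else 0.

Definition curve_length (c : R -> M) : R :=
  \int[lebesgue_measure]_(t in `[0, 1])
    Num.sqrt (g (c t) (velocity c t) (velocity c t)).

(* A piecewise C^1 curve becomes C^1 after a reparametrization which stops at
   the corners and endpoints, so C^1 curves R -> M give the usual infimum. *)
Definition riemannian_dist (x y : M) : R :=
  inf [set l | exists c, [/\ C1_curve c, c 0 = x, c 1 = y
                           & l = curve_length c]].

Definition complete_metric :=
  forall u : nat -> M,
    (forall e : R, 0 < e -> exists N : nat, forall p q : nat,
       (N <= p)%N -> (N <= q)%N -> riemannian_dist (u p) (u q) < e) ->
    exists l : M, u @ \oo --> l.

Definition coordinate_vector (c : chart R d M) (i : 'I_d) (x : M) :
    (M -> R) -> R :=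
  fun f => if `[< smooth f >]
           then 'D_(delta_mx 0 i) (f \o chart_inv c) (chart_map c x) else 0.

Definition gram (c : chart R d M) (x : M) : 'M[R]_d :=
  \matrix_(i, j) g x (coordinate_vector c i x) (coordinate_vector c j x).

(* mu has density sqrt (det g_ij) in charts, expressed against continuous
   functions with compact support, which determines a Radon measure. *)
Definition is_riemannian_volume
    (mu : {measure set (g_sigma_algebraType (@open M)) -> \bar R}) :=
  forall c, atlas c -> forall f : M -> R,
    continuous f -> compact_support f ->
    closure [set x | f x != 0] `<=` chart_dom c ->
    (\int[mu]_(x in [set: M]) (f x)%:E)%E =
    (iterated_integral (fun u : 'rV[R]_d =>
       if u \in (chart_map c @` chart_dom c) then
         f (chart_inv c u) * Num.sqrt (\det (gram c (chart_inv c u)))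
       else 0))%:E.

End Riemannian.

Section Foliation.
Context {R : realType} {n m : nat} (M : manifold R (n + m)).
Variable g : M -> ((M -> R) -> R) -> ((M -> R) -> R) -> R.
(* V x is the tangent space at x of the leaf through x. *)
Variable V : M -> set ((M -> R) -> R).

Definition horizontal (x : M) : set ((M -> R) -> R) :=
  [set v | tangent x v /\ forall w, V x w -> g x v w = 0].

(* Near every point the leaves are the fibers of a Riemannian submersion p from
   an open set U onto an open part of R^n with metric h.  The components of p
   are taken smooth on all of M: shrinking U and multiplying by a cutoff
   function gives such an extension. *)
Definition is_riemannian_foliation :=
  forall x0 : M, exists (U : set M) (p : 'I_n -> M -> R) (B : set 'rV[R]_n)
      (h : 'rV[R]_n -> 'M[R]_n),
    let pr x : 'rV[R]_n := \row_i p i x in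
    let dp (v : (M -> R) -> R) : 'rV[R]_n := \row_i v (p i) in
    [/\ [/\ open U, U x0, forall i, smooth (p i), open B & pr @` U `<=` B],
        [/\ forall i j, smooth_on B (fun b => h b i j),
            forall b, B b -> (h b)^T = h b
          & forall b (w : 'rV[R]_n), B b -> w != 0 ->
              0 < (w *m h b *m w^T) 0 0],
        forall x, U x -> forall w : 'rV[R]_n,
          exists2 v, tangent x v & dp v = w,
        forall x, U x -> V x = [set v | tangent x v /\ dp v = 0]
      & forall x, U x -> forall v w, horizontal x v -> horizontal x w ->
          g x v w = (dp v *m h (pr x) *m (dp w)^T) 0 0].

Definition is_horizontal (X : vfield M) := forall x, horizontal x (X x).
Definition is_vertical (X : vfield M) := forall x, V x (X x).

Definition hproj (X : vfield M) : vfield M := fun x =>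
  xget (fun=> 0) [set w | horizontal x w /\ V x (fun f => X x f - w f)].
Definition vproj (X : vfield M) : vfield M := vsub X (hproj X).

Definition hgrad (f : M -> R) : vfield M := hproj (gradient g f).
Definition vgrad (f : M -> R) : vfield M := vproj (gradient g f).

Definition horizontal_form (eta : one_form M) :=
  is_one_form eta /\
  forall X, is_vfield X -> is_vertical X -> forall x, eta X x = 0.
Definition vertical_form (eta : one_form M) :=
  is_one_form eta /\
  forall X, is_vfield X -> is_horizontal X -> forall x, eta X x = 0.

Definition horizontal_frame (x : M) (E : 'I_n -> vfield M) :=
  orthonormal_near g x E /\
  forall j, \forall y \near x, horizontal y (E j y).
Definition vertical_frame (x : M) (Z : 'I_m -> vfield M) :=
  orthonormal_near g x Z /\
  forall l, \forall y \near x, V y (Z l y).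

Definition trace_H (E : 'I_n -> vfield M) (A : vfield M -> vfield M) : M -> R :=
  fun x => \sum_(j < n) ip g (A (E j)) (E j) x.

Definition Gamma (f h : M -> R) : M -> R := ip g (hgrad f) (hgrad h).
Definition GammaV (f h : M -> R) : M -> R := ip g (vgrad f) (vgrad h).

(* The integration by parts formula only sees compactly supported functions;
   it determines L on all of C^oo(M) because L, being a differential operator,
   is local. *)
Definition is_horizontal_laplacian
    (mu : {measure set (g_sigma_algebraType (@open M)) -> \bar R})
    (L : (M -> R) -> (M -> R)) :=
  [/\ forall f, smooth f -> smooth (L f),
      forall f h (U : set M), smooth f -> smooth h -> open U ->
        (forall x, U x -> f x = h x) -> forall x, U x -> L f x = L h x
    & forall f h, smooth f -> smooth h ->
        compact_support f -> compact_support h ->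
        (\int[mu]_(x in [set: M]) (f x * L h x)%:E)%E =
        (- \int[mu]_(x in [set: M]) (Gamma f h x)%:E)%E].

Definition Gamma2 (L : (M -> R) -> (M -> R)) (f h : M -> R) : M -> R := fun x =>
  2^-1 * (L (Gamma f h) x - Gamma h (L f) x - Gamma f (L h) x).
Definition GammaV2 (L : (M -> R) -> (M -> R)) (f h : M -> R) : M -> R := fun x =>
  2^-1 * (L (GammaV f h) x - GammaV h (L f) x - GammaV f (L h) x).

Section Bott.
Variable D : vfield M -> vfield M -> vfield M.

(* second fundamental form of the leaves vanishes *)
Definition totally_geodesic_leaves :=
  forall X Y, is_vfield X -> is_vfield Y -> is_vertical X -> is_vertical Y ->
    is_vertical (D X Y).

Definition bott (X Y : vfield M) : vfield M :=
  vadd (vadd (hproj (D (hproj X) (hproj Y)))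
             (hproj (bracket (vproj X) (hproj Y))))
       (vadd (vproj (bracket (hproj X) (vproj Y)))
             (vproj (D (vproj X) (vproj Y)))).

Definition torsion (X Y : vfield M) : vfield M :=
  vsub (vsub (bott X Y) (bott Y X)) (bracket X Y).

Definition nabla_torsion (X Y Z : vfield M) : vfield M :=
  vsub (vsub (bott X (torsion Y Z)) (torsion (bott X Y) Z))
       (torsion Y (bott X Z)).

Definition delta_torsion (E : 'I_n -> vfield M) (X : vfield M) : vfield M :=
  vopp (vsum (fun j => nabla_torsion (E j) (E j) X)).

Definition yang_mills :=
  forall x E, horizontal_frame x E ->
  forall X, is_vfield X -> delta_torsion E X x = (fun=> 0).

Definition J (Z X : vfield M) : vfield M := fun x =>
  xget (fun=> 0) [set w | horizontal x w /\
    forall Y, is_vfield Y -> is_horizontal Y ->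
      g x w (Y x) = g x (Z x) (torsion (hproj X) Y x)].

Definition J_form (eta : one_form M) : vfield M -> vfield M := J (sharp g eta).

Definition J2 (Z : 'I_m -> vfield M) (X : vfield M) : vfield M :=
  vsum (fun l => J (Z l) (J (Z l) X)).

Definition curvature (X Y Z : vfield M) : vfield M :=
  vsub (vsub (bott X (bott Y Z)) (bott Y (bott X Z))) (bott (bracket X Y) Z).

Definition ricci (E : 'I_(n + m) -> vfield M) (Y Z : vfield M) : M -> R :=
  fun x => \sum_(i < n + m) ip g (curvature (E i) Y Z) (E i) x.

Definition Ric_H (E : 'I_(n + m) -> vfield M) (eta : one_form M) : one_form M :=
  fun X => ricci E (hproj (sharp g eta)) (hproj X).

End Bott.
End Foliation.

(* Main.v *)
Require Import Defs.
From HB Require Import structures.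
From mathcomp Require Import all_boot all_order all_algebra.
From mathcomp Require Import perm.
From mathcomp Require Import all_classical all_reals all_analysis.
From mathcomp Require Import ring lra.
Set Implicit Arguments.
Unset Strict Implicit.
Unset Printing Implicit Defensive.
Import Order.TTheory GRing.Theory Num.Theory.
Import numFieldNormedType.Exports.
Local Open Scope classical_set_scope.
Local Open Scope ring_scope.

(** Write A and B for the horizontal and the vertical part of the gradient of f,
    nab for the Bott connection, T for its torsion, R for its curvature and E_i
    for a horizontal orthonormal frame. The theorem is a pair of Bochner formulas,
    [bochner_horizontal] and [bochner_vertical]:

    - Gamma_2(f, f) = sum_i g (R(E_i, A) A, E_i) + |nab_(E_i) A|^2
        - 2 g (T(E_i, A), nab_(E_i) B),
    - Gamma_2^V(f, f) = sum_i |nab_(E_i) B|^2,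

    followed by completing a square. The cross term is absorbed by
    eps |nab_(E_i) B|^2 at the cost of eps^-1 |T(E_i, A)|^2, whose sum over i is
    - eps^-1 g (J^2 A, A), at most kappa eps^-1 |A|^2. The matrix
    g (nab_(E_i) A, E_j) has trace L f, which gives the square of L f, and its
    antisymmetric part is - 1/2 g (T(E_i, E_j), B), whose norm squared is
    - 1/4 Tr J_B^2, at least rho2 |B|^2. What remains is the Ricci curvature of A.

    The Bochner formulas rest on a few properties of the connection. It preserves
    the horizontal and the vertical distribution, and it is metric on each of
    them: on the horizontal one since the metric is bundle-like
    ([nab_metric_hh]), on the vertical one since the leaves are totally geodesic
    ([nab_metric_vv]). Its torsion is vertical and vanishes as soon as one of the
    arguments is vertical. Hence the horizontal Hessian is symmetric up to T
    ([hessian_sym]) and the mixed second derivatives agree, g (nab_B A, E) =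
    g (nab_E B, B) ([hessian_mixed]); the latter also proves the second claim,
    both of whose sides equal 2 g (nab_B A, A). The derivative of the torsion
    along the frame disappears by the Yang-Mills condition. The curvature term of
    Gamma_2^V disappears because the Bianchi identity, in which only vertical
    terms are lost, rewrites it as g (R(A, B) E_i, E_i) ([curv_vertical_trace]).

    All this presupposes that L h = sum_i g (nab_(E_i) A_h, E_i), A_h being the
    horizontal gradient of h ([laplacian_frame]). As L is only given through an
    integration by parts formula, its value at a point is found by testing with
    functions supported in a chart ([density_form]); this yields the coordinate
    formula of the divergence, which Jacobi's formula for the derivative of a
    determinant turns into the trace of the covariant derivative of A_h over an
    orthonormal frame ([divergence_trace]). The vertical part of this trace is
    zero since the leaves are totally geodesic.

    Tangent vectors are derivations of global smooth functions. Cutoff functions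
    and Hadamard's lemma ([hadamard]) show that they are combinations of
    coordinate derivatives ([tangent_coordinates]), and Gram-Schmidt then provides
    frames of global fields which are orthonormal near a point and adapted to the
    foliation ([adapted_frame]). *)

(** * Differentiability of finite order on R^d *)

Section Line.
Context {R : realType} {V : normedModType R}.

Lemma is_derive_line (f : V -> R) (x v : V) (s : R) :
  derivable f (x + s *: v) v ->
  is_derive s 1 (fun t : R => f (x + t *: v)) ('D_v f (x + s *: v)).
Proof.
have E : (fun h : R => h^-1 *: (((fun t : R => f (x + t *: v)) \o shift s) (h *: 1) - f (x + s *: v)))
   = (fun h : R => h^-1 *: ((f \o shift (x + s *: v)) (h *: v) - f (x + s *: v))).
  apply/funext => h /=; rewrite [h%:A]mulr1; congr (_ *: (f _ - _)).
  by rewrite scalerDl addrCA.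
by move=> df; split; [rewrite /derivable E | rewrite /derive E].
Qed.

(** The mean value theorem on [0, 1] for t |-> f (x + (t * a) *: v), which leaves
    the sign of a free. *)
Lemma MVT_line (f : V -> R) (x v : V) (a : R) :
  (forall s : R, 0 <= s <= 1 -> derivable f (x + (s * a) *: v) v) ->
  exists2 s : R, 0 <= s <= 1 &
    f (x + a *: v) - f x = a * 'D_v f (x + (s * a) *: v).
Proof.
move=> df.
pose phi (t : R) := f (x + (t * a) *: v).
have dphi (s : R) : 0 <= s <= 1 -> is_derive s 1 phi (a * 'D_v f (x + (s * a) *: v)).
  move=> s01; rewrite mulrC.
  apply: (@is_derive1_comp _ (fun t : R => f (x + t *: v)) (fun t => t * a)).
    exact/is_derive_line/df.
  have -> : (fun t : R => t * a) = a *: (id : R -> R).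
    by apply/funext => t; rewrite mulrC.
  by apply: is_derive_eq; rewrite [_%:A]mulr1.
have [||c] := @MVT_segment _ phi (fun s : R => a * 'D_v f (x + (s * a) *: v)) 0 1 ler01.
- by move=> s; rewrite in_itv/= => /andP[s0 s1]; apply: dphi; rewrite !ltW.
- apply: derivable_within_continuous => s; rewrite in_itv/= => s01.
  by have [] := dphi _ s01.
rewrite in_itv/= subr0 mulr1 /phi mul1r mul0r scale0r addr0 => c01 E.
by exists c.
Qed.

End Line.

Lemma diff_intro (R : realType) (V W : normedModType R) (f : V -> W)
    (df : {linear V -> W}) (x : V) : continuous df ->
  (forall e : R, 0 < e -> \forall h \near (0 : V),
     `|f (h + x) - (f x + df h)| <= e * `|h|) ->
  differentiable f x /\ 'd f x = df :> (V -> W).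
Proof.
move=> cont E.
have {}E : f \o shift x = cst (f x) + df +o_ 0 id by apply/eqaddoP.
have dE := diff_unique cont E.
by split=> //; apply/diff_locallyP; rewrite dE.
Qed.

Section FrechetDifferentiability.
Context {R : realType} {d : nat}.
Implicit Types (f : 'rV[R]_d -> R) (b h : 'rV[R]_d).

Lemma coord_le_norm h i : `|h 0 i| <= `|h|.
Proof.
have -> : `|h| = mx_norm h by [].
rewrite mx_normrE; exact: (le_bigmax 0 (fun ij => `|h ij.1 ij.2|) (ord0, i)).
Qed.

Lemma norm_le_coord h (e : R) : 0 <= e -> (forall i, `|h 0 i| <= e) -> `|h| <= e.
Proof.
move=> e0 he; have -> : `|h| = mx_norm h by [].
rewrite mx_normrE; apply: bigmax_le => // -[i j] _ /=.
by rewrite (ord1 i).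
Qed.

(* The points trunc h 0, ..., trunc h d lead from 0 to h parallel to the axes. *)
Let trunc h (j : nat) : 'rV[R]_d := \row_(i < d) (if (i < j)%N then h 0 i else 0).

Definition grad_form f b : 'rV[R]_d -> R :=
  fun h => \sum_(i < d) h 0 i * 'D_(delta_mx 0 i) f b.

Lemma grad_form_is_linear f b : linear (grad_form f b).
Proof.
move=> a u v; rewrite /grad_form scaler_sumr -big_split /=; apply: eq_bigr => i _.
by rewrite !mxE mulrDl -mulrA.
Qed.
HB.instance Definition _ f b :=
  GRing.isLinear.Build R 'rV[R]_d R _ (grad_form f b) (grad_form_is_linear f b).

(** Walking from b to b + h one coordinate at a time, the mean value theorem
    turns each increment into a partial derivative at a nearby point. *)
Lemma C1_diff f b :
  (\forall u \near b, forall i, derivable f u (delta_mx 0 i)) ->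
  (forall i, {for b, continuous ('D_(delta_mx 0 i) f)}) ->
  differentiable f b /\ 'd f b = grad_form f b :> (_ -> _).
Proof.
move=> nd cd.
have cont : continuous (grad_form f b).
  apply: (@continuous_big _ _ +%R 0 predT add_continuous) => i _ u.
  exact: (cvgM (@coord_continuous R _ _ 0 i u) (cvg_cst _)).
apply: diff_intro => // e e0.
pose e' := e / d.+1%:R.
have e'0 : 0 < e' by rewrite divr_gt0.
have nd2 : \forall u \near b, forall i,
    `|'D_(delta_mx 0 i) f u - 'D_(delta_mx 0 i) f b| <= e'.
  apply: (@filter_forall _ _ (fun i u => `|'D_(delta_mx 0 i) f u - 'D_(delta_mx 0 i) f b| <= e') (nbhs b)) => i.
  by have /cvgrPdist_le /(_ _ e'0) := cd i; apply: filterS => u; rewrite distrC.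
have [r /= r0 Hr] : exists2 r : R, 0 < r & forall u, ball b r u ->
   (forall i, derivable f u (delta_mx 0 i)) /\ (forall i, `|'D_(delta_mx 0 i) f u - 'D_(delta_mx 0 i) f b| <= e').
  by apply/(@nbhs_ballP R 'rV[R]_d); apply: filterI.
near=> h.
have hr : `|h| < r.
  near: h; apply/nbhs_ballP; exists r => //= h; rewrite -ball_normE /=.
  by rewrite sub0r normrN.
have step (j : 'I_d) : `|f (b + trunc h j.+1) - f (b + trunc h j)
     - h 0 j * 'D_(delta_mx 0 j) f b| <= e' * `|h|.
  have tE : b + trunc h j.+1 = (b + trunc h j) + h 0 j *: delta_mx 0 j.
    rewrite -addrA; congr (_ + _); apply/rowP => i; rewrite !mxE eqxx /= ltnS leq_eqVlt.
    have [->|ij] := eqVneq i j; first by rewrite ltnn eqxx mulr1 add0r.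
    by rewrite eq_sym -(inj_eq val_inj) /= in ij; rewrite eq_sym (negbTE ij) mulr0 addr0.
  have inb s : 0 <= s <= 1 -> ball b r (b + trunc h j + (s * h 0 j) *: delta_mx 0 j).
    move=> /andP[s0 s1]; rewrite -ball_normE /= -addrA opprD addrA subrr sub0r normrN.
    apply: le_lt_trans hr; apply: norm_le_coord => // i.
    rewrite !mxE eqxx /=; case: (eqVneq i j) => [->|ij].
      rewrite ltnn add0r mulr1 normrM (ger0_norm s0).
      by apply: le_trans (coord_le_norm h j); rewrite ler_piMl.
    rewrite mulr0 addr0; case: ifP => _; last by rewrite normr0.
    exact: coord_le_norm.
  have [s s01 E] : exists2 s : R, 0 <= s <= 1 &
      f (b + trunc h j + h 0 j *: delta_mx 0 j) - f (b + trunc h j) =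
      h 0 j * 'D_(delta_mx 0 j) f (b + trunc h j + (s * h 0 j) *: delta_mx 0 j).
    by apply: MVT_line => s s01; have [] := Hr _ (inb _ s01).
  rewrite tE E -mulrBr normrM mulrC; apply: ler_pM => //; last exact: coord_le_norm.
  by have [] := Hr _ (inb _ s01).
have -> : f (h + b) - (f b + grad_form f b h) =
   \sum_(j < d) (f (b + trunc h j.+1) - f (b + trunc h j) - h 0 j * 'D_(delta_mx 0 j) f b).
  rewrite big_split /= sumrN -/(grad_form f b h).
  rewrite (_ : \sum_(i < d) _ = f (h + b) - f b); first by rewrite opprD addrA.
  rewrite -(big_mkord xpredT (fun j => f (b + trunc h j.+1) - f (b + trunc h j))).
  rewrite telescope_sumr//; congr (f _ - f _).
    by rewrite addrC; congr (_ + _); apply/rowP => i; rewrite mxE ltn_ord.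
  by rewrite -[RHS]addr0; congr (_ + _); apply/rowP => i; rewrite !mxE.
apply: le_trans (ler_norm_sum _ _ _) _.
apply: le_trans (ler_sum _ (fun j _ => step j)) _.
rewrite sumr_const card_ord -mulr_natl mulrA; apply: ler_wpM2r => //.
rewrite /e' mulrCA ler_piMr ?(ltW e0)// ler_pdivrMr// mul1r ler_nat. exact: leqnSn.
Unshelve. all: by end_near. Qed.

End FrechetDifferentiability.

Section ChainRule.
Context {R : realType}.

Lemma derive_line0 (V W : normedModType R) (f : V -> W) (x v : V) :
  'D_v f x = 'D_1 (fun h : R => f (h *: v + x)) 0.
Proof.
rewrite /derive; set g1 := fun h => h^-1 *: _; set g2 := fun h => h^-1 *: _.
suff -> : g1 = g2 by [].
by rewrite funeqE /g1 /g2 => h /=; rewrite addr0 scale0r add0r [_%:A]mulr1.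
Qed.

(** Continuity of the partial derivatives of phi makes phi Frechet
    differentiable; their mere existence would not give the chain rule. *)
Lemma is_derive_comp_C1 (V : normedModType R) (k : nat) (phi : 'rV[R]_k -> R)
    (q : 'I_k -> V -> R) (u v : V) :
  (\forall b \near \row_j q j u, forall j, derivable phi b (delta_mx 0 j)) ->
  (forall j, {for \row_j q j u, continuous ('D_(delta_mx 0 j) phi)}) ->
  (forall j, derivable (q j) u v) ->
  is_derive u v (fun u => phi (\row_j q j u))
    (\sum_(j < k) 'D_v (q j) u * 'D_(delta_mx 0 j) phi (\row_j q j u)).
Proof.
move=> nphi cphi dq.
pose Q u : 'rV[R]_k := \row_j q j u.
have [dphi Ephi] := C1_diff nphi cphi.
have dQ : derivable Q u v.
  apply/derivable_mxP => i j; rewrite (_ : (fun x => Q x i j) = q j) //.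
  by apply/funext => x; rewrite mxE.
pose L (h : R) := Q (h *: v + u).
have L0 : L 0 = Q u by rewrite /L scale0r add0r.
have dL : differentiable L 0.
  exact: (@derivable1_diffP R 'rV[R]_k L 0).1 ((derivable1P Q u v).1 dQ).
have dphiL : differentiable (phi \o L) 0.
  by apply: differentiable_comp; rewrite ?L0.
have dd : derivable (phi \o Q) u v.
  exact: (derivable1P (phi \o Q) u v).2 ((@derivable1_diffP R R (phi \o L) 0).2 dphiL).
split=> //.
rewrite -[LHS]/('D_v (phi \o Q) u) derive_line0 -[LHS]/('D_1 (phi \o L) 0).
rewrite deriveE // diff_comp ?L0 //= Ephi -deriveE //.
rewrite -derive_line0 (derive_mx dQ) /grad_form; apply: eq_bigr => j _.
rewrite mxE (_ : (fun t => Q t 0 j) = q j) //.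
by apply/funext => x; rewrite mxE.
Qed.
End ChainRule.

Lemma continuous_row {R : realType} (T : topologicalType) (k : nat) (q : 'I_k -> T -> R) (u : T) :
  (forall j, {for u, continuous (q j)}) ->
  {for u, continuous (fun w => \row_j q j w)}.
Proof.
move=> cq; apply/(@cvgrPdist_le _ 'rV[R]_k) => e e0.
have : \forall w \near u, forall j, `|q j u - q j w| <= e.
  apply: filter_forall => j.
  by have /cvgrPdist_le /(_ _ e0) := cq j.
apply: filterS => w H; apply: norm_le_coord; first exact: ltW.
by move=> j; rewrite !mxE.
Qed.

Lemma near_eq_continuous (T U : topologicalType) (f h : T -> U) (u : T) :
  (\forall w \near u, f w = h w) -> {for u, continuous f} -> {for u, continuous h}.
Proof.
move=> fh; rewrite /prop_for /continuous_at -(nbhs_singleton fh).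
by apply: cvg_trans; exact: near_eq_cvg.
Qed.

Section Ck.
Context {R : realType}.

(** The innermost derivative is peeled off first, as an induction on the order of
    differentiability needs; smooth_on applies its list in the other order. *)
Fixpoint Ck (N d : nat) (Omega : set 'rV[R]_d) (f : 'rV[R]_d -> R) : Prop :=
  (forall u, Omega u -> {for u, continuous f} /\
     forall i, derivable f u (delta_mx 0 i)) /\
  match N with
  | 0 => True
  | N'.+1 => forall i, Ck N' Omega ('D_(delta_mx 0 i) f)
  end.

Lemma smooth_onP d (Omega : set 'rV[R]_d) f :
  smooth_on Omega f <-> forall N, Ck N Omega f.
Proof.
split.
  move=> sf N; elim: N f sf => [|N IH] f sf; split => //.
  - by move=> u Ou; exact: (sf [::] u Ou).
  - by move=> u Ou; exact: (sf [::] u Ou).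
  - move=> i; apply: IH => s u Ou.
    by have := sf (rcons s i) u Ou; rewrite /ipartial foldr_rcons.
move=> H s; elim/last_ind: s f H => [|s i IH] f H u Ou.
  by have [/(_ u Ou)] := H 0%N.
have := IH ('D_(delta_mx 0 i) f) (fun N => (H N.+1).2 i) u Ou.
by rewrite /ipartial foldr_rcons.
Qed.

Section Basic.
Context {d : nat} (Omega : set 'rV[R]_d) (oO : open Omega).
Implicit Types f h : 'rV[R]_d -> R.

Lemma open_near u (P : 'rV[R]_d -> Prop) :
  Omega u -> (forall w, Omega w -> P w) -> \forall w \near u, P w.
Proof.
move=> Ou H; apply: filterS H _; exact: open_nbhs_nbhs.
Qed.

Lemma Ck_weak N f : Ck N.+1 Omega f -> Ck N Omega f.
Proof.
by elim: N f => [|N IH] f [H1 H2]; split => // i; apply: IH.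
Qed.

Lemma Ck0 N f : Ck N Omega f -> Ck 0 Omega f.
Proof. by case: N => [|N] [H _]; split. Qed.

Lemma Ck_ext N f h : (forall u, Omega u -> f u = h u) -> Ck N Omega f -> Ck N Omega h.
Proof.
have zeroth f' h' : (forall u, Omega u -> f' u = h' u) ->
    (forall u, Omega u -> {for u, continuous f'} /\
       forall i, derivable f' u (delta_mx 0 i)) ->
    (forall u, Omega u -> {for u, continuous h'} /\
       forall i, derivable h' u (delta_mx 0 i)).
  move=> fh H1 u Ou; have [c dr] := H1 _ Ou; split; last first.
    by move=> i; apply: near_eq_derivable (dr i); exact: (open_near Ou fh).
  exact: near_eq_continuous (open_near Ou fh) c.
elim: N f h => [|N IH] f h fh [H1 H2].
  by split => //; exact: zeroth H1.
split; first exact: zeroth H1.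
move=> i; apply: IH (H2 i) => u Ou; apply: near_eq_derive.
exact: (open_near Ou fh).
Qed.

Lemma Ck_cst N (a : R) : Ck N Omega (cst a).
Proof.
have zeroth u : {for u, continuous (cst a : 'rV[R]_d -> R)} /\
   forall i, derivable (cst a : 'rV[R]_d -> R) u (delta_mx 0 i).
  by split => [|i]; [exact: cst_continuous | exact: derivable_cst].
elim: N a zeroth => [|N IH] a zeroth; split => // i.
rewrite (_ : 'D__ _ = cst 0); last by apply/funext => u; exact: derive_cst.
by apply: IH => u; split => [|j]; [exact: cst_continuous | exact: derivable_cst].
Qed.

Lemma Ck_coord N (i : 'I_d) : Ck N Omega (fun u => u 0 i).
Proof.
have dE j u : is_derive u (delta_mx 0 j) (fun u : 'rV[R]_d => u 0 i : R) (i == j)%:R.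
  have df := @differentiable_coord R _ _ u 0 i.
  have lf : linear (fun u : 'rV[R]_d => u 0 i : R) by move=> a x y; rewrite !mxE.
  pose lm := GRing.isLinear.Build _ _ _ _ _ lf.
  pose L : {linear 'rV[R]_d -> R} := HB.pack (fun u : 'rV[R]_d => u 0 i : R) lm.
  split; first exact: diff_derivable.
  rewrite deriveE // -[X in 'd X _]/(L : _ -> _) diff_lin /=; last exact: coord_continuous.
  by rewrite mxE eqxx.
have c0 u : {for u, continuous (fun u : 'rV[R]_d => u 0 i : R)} by exact: coord_continuous.
have d0 j u : derivable (fun u : 'rV[R]_d => u 0 i : R) u (delta_mx 0 j).
  by have [] := dE j u.
case: N => [|N]; split => // j.
apply: (@Ck_ext N (cst (i == j)%:R)); last exact: Ck_cst.
by move=> u _; have [_ ->] := dE j u.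
Qed.

Lemma CkD N f h : Ck N Omega f -> Ck N Omega h -> Ck N Omega (fun u => f u + h u).
Proof.
have zeroth f' h' : Ck 0 Omega f' -> Ck 0 Omega h' -> Ck 0 Omega (fun u => f' u + h' u).
  move=> [f1 _] [h1 _]; split => // u Ou.
  have [cf df] := f1 u Ou; have [ch dh] := h1 u Ou.
  by split => [|i]; [exact: continuousD|exact: derivableD].
elim: N f h => [|N IH] f h Cf Ch; first exact: zeroth.
have [f1 f2] := Cf; have [h1 h2] := Ch; split; first exact: (zeroth _ _ (Ck0 Cf) (Ck0 Ch)).1.
move=> i; apply: Ck_ext (IH _ _ (f2 i) (h2 i)) => u Ou.
have [_ df] := f1 u Ou; have [_ dh] := h1 u Ou.
by rewrite -[RHS]/('D_(delta_mx 0 i) (f + h) u) (deriveD (df i) (dh i)).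
Qed.

Lemma CkM N f h : Ck N Omega f -> Ck N Omega h -> Ck N Omega (fun u => f u * h u).
Proof.
have zeroth f' h' : Ck 0 Omega f' -> Ck 0 Omega h' -> Ck 0 Omega (fun u => f' u * h' u).
  move=> [f1 _] [h1 _]; split => // u Ou.
  have [cf df] := f1 u Ou; have [ch dh] := h1 u Ou.
  by split => [|i]; [exact: continuousM|exact: derivableM].
elim: N f h => [|N IH] f h Cf Ch; first exact: zeroth.
have [f1 f2] := Cf; have [h1 h2] := Ch; split; first exact: (zeroth _ _ (Ck0 Cf) (Ck0 Ch)).1.
move=> i; apply: Ck_ext (CkD (IH _ _ (Ck_weak Cf) (h2 i)) (IH _ _ (Ck_weak Ch) (f2 i))) => u Ou.
have [_ df] := f1 u Ou; have [_ dh] := h1 u Ou.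
by rewrite -[RHS]/('D_(delta_mx 0 i) (f * h) u) (deriveM (df i) (dh i)).
Qed.

Lemma Ck_sum N (I : finType) (f : I -> 'rV[R]_d -> R) :
  (forall i, Ck N Omega (f i)) -> Ck N Omega (fun u => \sum_i f i u).
Proof.
move=> Cf; elim: (index_enum I) => [|i s IH].
  by apply: Ck_ext (Ck_cst N 0) => u _; rewrite big_nil.
by apply: Ck_ext (CkD (Cf i) IH) => u _; rewrite big_cons.
Qed.

End Basic.

(** One order is lost at each stage because the chain rule asks for a C^1
    function phi. *)
Lemma Ck_comp N d k (Omega : set 'rV[R]_d) (B : set 'rV[R]_k) phi
    (q : 'I_k -> 'rV[R]_d -> R) :
  open Omega -> open B -> (forall u, Omega u -> B (\row_j q j u)) ->
  Ck N.+1 B phi -> (forall j, Ck N.+1 Omega (q j)) ->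
  Ck N Omega (fun u => phi (\row_j q j u)).
Proof.
move=> oO oB qB.
move=> Cphi Cq.
have first phi0 u i : Ck 1 B phi0 -> Omega u ->
    is_derive u (delta_mx 0 i) (fun u => phi0 (\row_j q j u))
     (\sum_(j < k) 'D_(delta_mx 0 i) (q j) u * 'D_(delta_mx 0 j) phi0 (\row_j q j u)).
  move=> [C0 C1] Ou; apply: is_derive_comp_C1.
  - by apply: open_near (qB _ Ou) _ => // w Bw; have [] := C0 w Bw.
  - by move=> j; have [] := (C1 j).1 _ (qB _ Ou).
  - by move=> j; have [_] := (Cq j).1 _ Ou.
have Ck1 M phi0 : Ck M.+1 B phi0 -> Ck 1 B phi0.
  by case=> C0 C1; split => // i; exact: Ck0 (C1 i).
have zeroth phi0 u : Ck 1 B phi0 -> Omega u ->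
   {for u, continuous (fun u => phi0 (\row_j q j u))} /\
   (forall i, derivable (fun u => phi0 (\row_j q j u)) u (delta_mx 0 i)).
  move=> C1 Ou; split; last by move=> i; have [] := first phi0 u i C1 Ou.
  apply: (@continuous_comp _ _ _ (fun u => \row_j q j u) phi0).
    by apply: continuous_row => j; have [] := (Cq j).1 _ Ou.
  by have [] := C1.1 _ (qB _ Ou).
elim: N phi Cphi Cq => [|N IH] phi Cphi Cq.
  split => // u Ou; exact: zeroth (Ck1 _ _ Cphi) Ou.
split; first by move=> u Ou; exact: zeroth (Ck1 _ _ Cphi) Ou.
move=> i.
have Cq' j : Ck N.+1 Omega (q j) by exact: Ck_weak.
apply: (Ck_ext oO (f := fun u => \sum_(j < k)
   ('D_(delta_mx 0 i) (q j) u * 'D_(delta_mx 0 j) phi (\row_j q j u)))).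
  by move=> u Ou; have [_] := first phi u i (Ck1 _ _ Cphi) Ou; move=> ->.
apply: Ck_sum => // j; apply: CkM => //; first exact: ((Cq' j).2 i).
exact: IH (Cphi.2 j) Cq'.
Qed.

Lemma smooth_on_comp d k (Omega : set 'rV[R]_d) (B : set 'rV[R]_k) phi
    (q : 'I_k -> 'rV[R]_d -> R) :
  open Omega -> open B -> (forall u, Omega u -> B (\row_j q j u)) ->
  smooth_on B phi -> (forall j, smooth_on Omega (q j)) ->
  smooth_on Omega (fun u => phi (\row_j q j u)).
Proof.
move=> oO oB qB /smooth_onP sp sq; apply/smooth_onP => N.
by apply: (Ck_comp (B := B)) => // j; have /smooth_onP := sq j.
Qed.

End Ck.

(** * Smooth functions on open subsets of R^d *)

Section SmoothOn.
Context {R : realType} {d : nat} (Omega : set 'rV[R]_d) (oO : open Omega).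
Implicit Types f h : 'rV[R]_d -> R.

Lemma smooth_on_ext f h : (forall u, Omega u -> f u = h u) ->
  smooth_on Omega f -> smooth_on Omega h.
Proof.
by move=> fh /smooth_onP sf; apply/smooth_onP => N; apply: Ck_ext (sf N).
Qed.

Lemma smooth_on_cst (a : R) : smooth_on Omega (cst a).
Proof. by apply/smooth_onP => N; exact: Ck_cst. Qed.

Lemma smooth_on_coord (i : 'I_d) : smooth_on Omega (fun u => u 0 i).
Proof. by apply/smooth_onP => N; exact: Ck_coord. Qed.

Lemma smooth_onD f h : smooth_on Omega f -> smooth_on Omega h ->
  smooth_on Omega (fun u => f u + h u).
Proof.
move=> /smooth_onP sf /smooth_onP sh; apply/smooth_onP => N; exact: CkD.
Qed.

Lemma smooth_onM f h : smooth_on Omega f -> smooth_on Omega h ->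
  smooth_on Omega (fun u => f u * h u).
Proof.
move=> /smooth_onP sf /smooth_onP sh; apply/smooth_onP => N; exact: CkM.
Qed.

Lemma smooth_on_sum (I : finType) (f : I -> 'rV[R]_d -> R) :
  (forall i, smooth_on Omega (f i)) -> smooth_on Omega (fun u => \sum_i f i u).
Proof.
move=> sf; apply/smooth_onP => N; apply: Ck_sum => // i.
by have /smooth_onP := sf i.
Qed.

Lemma smooth_on_partial f i : smooth_on Omega f ->
  smooth_on Omega ('D_(delta_mx 0 i) f).
Proof. by move=> /smooth_onP sf; apply/smooth_onP => N; exact: (sf N.+1).2. Qed.

Lemma smooth_on_continuous f u : smooth_on Omega f -> Omega u -> {for u, continuous f}.
Proof. by move=> sf Ou; have [] := sf [::] u Ou. Qed.

Lemma smooth_on_derivable f u i : smooth_on Omega f -> Omega u ->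
  derivable f u (delta_mx 0 i).
Proof. by move=> sf Ou; have [] := sf [::] u Ou. Qed.

Lemma smooth_on_diff f u : smooth_on Omega f -> Omega u ->
  differentiable f u /\ 'd f u = grad_form f u :> (_ -> _).
Proof.
move=> sf Ou; apply: C1_diff.
  by apply: (open_near oO Ou) => w Ow i; exact: smooth_on_derivable.
by move=> i; apply: smooth_on_continuous Ou; exact: smooth_on_partial.
Qed.

(** Closing a family under differentiation lets one induction on the order treat
    all its members at once, where a single member would need a formula for
    each of its derivatives. *)
Lemma smooth_on_family (I : Type) (f : I -> 'rV[R]_d -> R)
    (df : I -> 'I_d -> 'rV[R]_d -> R) :
  (forall i u, Omega u -> {for u, continuous (f i)}) ->
  (forall i j u, Omega u -> is_derive u (delta_mx 0 j) (f i) (df i j u)) ->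
  (forall N, (forall i, Ck N Omega (f i)) -> forall i j, Ck N Omega (df i j)) ->
  forall i, smooth_on Omega (f i).
Proof.
move=> cf dfE Hdf i; apply/smooth_onP => N; elim: N i => [|N IH] i.
  split=> // u Ou; split; first exact: cf.
  by move=> j; have [] := dfE i j u Ou.
split.
  move=> u Ou; split; first exact: cf.
  by move=> j; have [] := dfE i j u Ou.
move=> j; apply: Ck_ext (Hdf N IH i j) => // u Ou.
by have [_ ->] := dfE i j u Ou.
Qed.

End SmoothOn.

Lemma smooth_on_sub (R : realType) (d : nat) (A B : set 'rV[R]_d) f :
  A `<=` B -> smooth_on B f -> smooth_on A f.
Proof. by move=> AB sf s u Au; exact: sf (AB _ Au). Qed.

Section OneVariable.
Context {R : realType}.

Lemma is_derive_lift (p : R -> R) (w : 'rV[R]_1) (a : R) j :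
  is_derive (w 0 0) 1 p a ->
  is_derive w (delta_mx 0 j) (fun w : 'rV[R]_1 => p (w 0 0)) a.
Proof.
rewrite (ord1 j) => -[dp <-].
have E : (fun h : R => h^-1 *: (((fun w : 'rV[R]_1 => p (w 0 0)) \o shift w) (h *: delta_mx 0 0) - p (w 0 0)))
   = (fun h : R => h^-1 *: ((p \o shift (w 0 0)) (h *: 1) - p (w 0 0))).
  by apply/funext => h /=; rewrite !mxE.
by split; [rewrite /derivable E | rewrite /derive E].
Qed.

Lemma continuous_lift (p : R -> R) (w : 'rV[R]_1) :
  {for w 0 0, continuous p} ->
  {for w, continuous (fun w : 'rV[R]_1 => p (w 0 0))}.
Proof.
move=> cp; apply: (@continuous_comp _ _ _ (fun w : 'rV[R]_1 => w 0 0) p) => //.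
exact: coord_continuous.
Qed.

Lemma open_lift (U : set R) : open U -> open [set w : 'rV[R]_1 | U (w 0 0)].
Proof.
move=> oU; apply: (@open_comp _ _ (fun w : 'rV[R]_1 => w 0 0)) => // w _.
exact: coord_continuous.
Qed.

Lemma smooth_on_inv :
  smooth_on [set w : 'rV[R]_1 | w 0 0 != 0] (fun w => (w 0 0)^-1).
Proof.
have oO : open [set w : 'rV[R]_1 | w 0 0 != 0] by apply: (open_lift (@open_neq R 0)).
apply: (@smooth_on_family _ _ _ oO unit (fun _ w => (w 0 0)^-1)
   (fun _ _ w => -1 * ((w 0 0)^-1 * (w 0 0)^-1))) => //=.
- by move=> _ w w0; apply: continuous_lift; exact: inv_continuous.
- move=> _ j w w0; apply: is_derive_lift.
  apply: is_derive_eq; first exact: (is_deriveV w0 (is_derive_id _ _)).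
  by rewrite mulN1r scaleNr [_%:A]mulr1 -exprVn expr2.
- move=> N IH _ _; apply: CkM => //; first exact: Ck_cst.
  by apply: CkM => //; exact: IH tt.
Qed.

Lemma smooth_on_sqrt :
  smooth_on [set w : 'rV[R]_1 | 0 < w 0 0] (fun w => Num.sqrt (w 0 0)).
Proof.
have oO : open [set w : 'rV[R]_1 | 0 < w 0 0] by apply: (open_lift (@open_gt R 0)).
apply: (@smooth_on_family _ _ _ oO unit (fun _ w => Num.sqrt (w 0 0))
   (fun _ _ w => 2^-1 * (Num.sqrt (w 0 0) * (w 0 0)^-1))) => //=.
- by move=> _ w w0; apply: continuous_lift; exact: sqrt_continuous.
- move=> _ j w w0; apply: is_derive_lift.
  apply: is_derive_eq; first exact: is_derive1_sqrt.
  rewrite invfM; congr (_ * _).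
  have s0 : Num.sqrt (w 0 0) != 0 by rewrite gt_eqF // sqrtr_gt0.
  rewrite -[X in _ = _ / X](sqr_sqrtr (ltW w0)) expr2 invfM mulrA divff // mul1r //.
- move=> N IH _ _; apply: CkM => //; first exact: Ck_cst.
  apply: CkM => //; first exact: IH tt.
  have := smooth_on_sub _ smooth_on_inv => /(_ [set w : 'rV[R]_1 | 0 < w 0 0]) H.
  have /smooth_onP := H (fun w w0 => lt0r_neq0 w0); exact.
Qed.

(** The derivatives of the flat function exp (- 1 / t) are combinations of these
    functions. *)
Definition flat_exp (k : nat) (t : R) : R :=
  if 0 < t then t^-1 ^+ k * expR (- t^-1) else 0.

Lemma flat_exp_ge0 k t : 0 <= flat_exp k t.
Proof.
rewrite /flat_exp; case: ifP => // t0.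
by rewrite mulr_ge0 ?expR_ge0// exprn_ge0// invr_ge0 ltW.
Qed.

Lemma flat_exp_gt0 k t : 0 < t -> 0 < flat_exp k t.
Proof. by move=> t0; rewrite /flat_exp t0 mulr_gt0 ?expR_gt0// exprn_gt0// invr_gt0. Qed.

Lemma flat_exp_le0 k t : t <= 0 -> flat_exp k t = 0.
Proof. by move=> t0; rewrite /flat_exp ltNge t0. Qed.

(** From exp s >= (s / (k + 1)) ^ (k + 1) with s = 1 / t, which is a power of
    exp s >= 1 + s. *)
Lemma flat_exp_bound k t : flat_exp k t <= k.+1%:R ^+ k.+1 * `|t|.
Proof.
rewrite /flat_exp; case: ifP => [t0|_]; last by rewrite mulr_ge0 // exprn_ge0.
rewrite gtr0_norm // expRN.
have le1 : (k.+1%:R^-1 * t^-1) ^+ k.+1 <= expR t^-1.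
  have -> : expR t^-1 = expR (k.+1%:R^-1 * t^-1) ^+ k.+1.
    by rewrite -expRM_natl mulrA divff ?mul1r// pnatr_eq0.
  rewrite lerXn2r ?nnegrE ?mulr_ge0 ?expR_ge0 ?invr_ge0 ?(ltW t0)//.
  by apply: le_trans (expR_ge1Dx _); rewrite lerDr.
have pos : 0 < (k.+1%:R^-1 * t^-1) ^+ k.+1 by rewrite exprn_gt0// mulr_gt0 ?invr_gt0.
have : (expR t^-1)^-1 <= ((k.+1%:R^-1 * t^-1) ^+ k.+1)^-1.
  by rewrite lef_pV2 ?posrE ?expR_gt0.
move=> /(ler_wpM2l (exprn_ge0 k (ltW _ : 0 <= t^-1))) H.
apply: le_trans (H _) _; first by rewrite invr_gt0.
rewrite -exprVn invfM !invrK exprMn mulrCA ler_wpM2l ?exprn_ge0//.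
by rewrite exprS mulrCA -exprMn mulVf ?gt_eqF// expr1n mulr1.
Qed.

Lemma is_derive_flat_exp k (t : R) :
  is_derive t 1 (flat_exp k) (- k%:R * flat_exp k.+1 t + flat_exp k.+2 t).
Proof.
have [t0|t0|->] := ltgtP t 0.
- apply: (@near_eq_is_derive _ _ _ (cst 0)).
    have : nbhs t [set x : R | x < 0] by apply: open_nbhs_nbhs; split => //; exact: open_lt.
    by apply: filterS => x /ltW x0; rewrite flat_exp_le0.
  by rewrite !flat_exp_le0 ?ltW// mulr0 addr0; exact: is_derive_cst.
- apply: (@near_eq_is_derive R R R (fun t : R => t^-1 ^+ k * expR (- t^-1))).
    have : nbhs t [set x : R | 0 < x] by apply: open_nbhs_nbhs; split => //; exact: open_gt.
    by apply: filterS => x x0; rewrite /flat_exp x0.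
  have t1 : t != 0 by rewrite gt_eqF.
  have dV : is_derive t 1 (fun t : R => t^-1) (- (t^-1 * t^-1)).
    apply: is_derive_eq; first exact: (is_deriveV t1 (is_derive_id _ _)).
    by rewrite scaleNr [_%:A]mulr1 -exprVn expr2.
  have dE : is_derive t 1 (fun t : R => expR (- t^-1)) (expR (- t^-1) * - (- (t^-1 * t^-1))).
    exact: (@is_derive1_comp _ expR (fun t => - t^-1) t _ _ (is_derive_expR _) (is_deriveN dV)).
  have dP : is_derive t^-1 1 (fun x : R => x ^+ k) (k%:R * t^-1 ^+ k.-1).
    by split; [exact: exprn_derivable | rewrite exp_derive [LHS]mulr1].
  have dX : is_derive t 1 (fun t : R => t^-1 ^+ k) (k%:R * t^-1 ^+ k.-1 * - (t^-1 * t^-1)).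
    exact: (is_derive1_comp dP dV).
  have dM := is_deriveM dX dE.
  refine (is_derive_eq dM _).
  rewrite /flat_exp t0 /= /GRing.scale /=.
  clear.
  by case: k => [|k] /=; rewrite ?exprS; ring.
(* at 0 the difference quotient of flat_exp k is flat_exp k.+1 *)
- rewrite !flat_exp_le0// mulr0 addr0.
  have E : (fun h : R => h^-1 *: ((flat_exp k \o shift 0) (h *: 1) - flat_exp k 0))
     = flat_exp k.+1.
    apply/funext => h /=; rewrite [h%:A]mulr1 addr0 (flat_exp_le0 _ (lexx 0)) subr0.
    rewrite /flat_exp; case: ifP => _; last by rewrite scaler0.
    by rewrite exprS -mulrA.
  have c0 : flat_exp k.+1 h @[h --> 0^'] --> (0 : R).
    apply/cvgrPdist_le => e e0; near=> h.
    rewrite sub0r normrN ger0_norm ?flat_exp_ge0//.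
    apply: le_trans (flat_exp_bound _ _) _.
    rewrite mulrC -ler_pdivlMr ?exprn_gt0//.
    near: h; apply: nbhs_dnbhs.
    apply/nbhs_ballP; exists (e / k.+2%:R ^+ k.+2) => /=; first by rewrite divr_gt0 ?exprn_gt0.
    by move=> x; rewrite -ball_normE /= sub0r normrN => /ltW.
  split; first by rewrite /derivable E; apply: cvgP c0.
  by rewrite /derive E; apply: cvg_lim c0.
Unshelve. all: by end_near. Qed.

Lemma smooth_on_flat_exp : smooth_on setT (fun w : 'rV[R]_1 => flat_exp 0 (w 0 0)).
Proof.
apply: (@smooth_on_family _ _ _ openT nat (fun k w => flat_exp k (w 0 0))
   (fun k _ w => - k%:R * flat_exp k.+1 (w 0 0) + flat_exp k.+2 (w 0 0))) => //=.
- move=> k w _; apply: continuous_lift; apply: differentiable_continuous.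
  by apply/derivable1_diffP; have [] := is_derive_flat_exp k (w 0 0).
- by move=> k j w _; apply: is_derive_lift; exact: is_derive_flat_exp.
- move=> N IH k _; apply: CkD; [exact: openT| |exact: IH].
  by apply: CkM; [exact: openT|exact: Ck_cst|exact: IH].
Qed.

End OneVariable.

Local Opaque smooth_on.

Section Composition1.
Context {R : realType} {d : nat} (Omega : set 'rV[R]_d) (oO : open Omega).
Implicit Types f : 'rV[R]_d -> R.

Lemma smooth_on_comp1 (U : set R) (p : R -> R) f :
  open U -> smooth_on [set w : 'rV[R]_1 | U (w 0 0)] (fun w => p (w 0 0)) ->
  (forall u, Omega u -> U (f u)) -> smooth_on Omega f ->
  smooth_on Omega (fun u => p (f u)).
Proof.
move=> oU sp fU sf.
have := @smooth_on_comp _ _ _ Omega [set w : 'rV[R]_1 | U (w 0 0)]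
  (fun w => p (w 0 0)) (fun _ => f) oO (open_lift oU).
move=> H; apply: (smooth_on_ext oO (f := fun u => p ((\row_(j < 1) f u) 0 0))).
  by move=> u _; rewrite mxE.
by apply: H => // u Ou /=; rewrite mxE; exact: fU.
Qed.

Lemma smooth_onV f : (forall u, Omega u -> f u != 0) ->
  smooth_on Omega f -> smooth_on Omega (fun u => (f u)^-1).
Proof.
by move=> f0; apply: (smooth_on_comp1 (@open_neq R 0)) => //; exact: smooth_on_inv.
Qed.

Lemma smooth_onB f h : smooth_on Omega f -> smooth_on Omega h ->
  smooth_on Omega (fun u => f u - h u).
Proof.
move=> sf sh; apply: (smooth_on_ext oO (f := fun u => f u + (-1) * h u)).
  by move=> u _; rewrite mulN1r.
exact: (smooth_onD oO sf (smooth_onM oO (smooth_on_cst _) sh)).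
Qed.

End Composition1.

Section Bump.
Context {R : realType} {d : nat}.

(** A plateau function: the quotient of a flat exponential by a sum of two of
    them which never vanish simultaneously. *)
Lemma plateau (q : 'rV[R]_d -> R) (c : R) : 0 < c -> smooth_on setT q ->
  exists B : 'rV[R]_d -> R,
    [/\ smooth_on setT B, forall u, 0 <= B u,
        forall u, q u <= c / 2 -> B u = 1
      & forall u, c <= q u -> B u = 0].
Proof.
move=> c0 sq.
have c2 : c / 2 < c by rewrite ltr_pdivrMr// ltr_pMr// ltr1n.
have sp : smooth_on setT (fun u => flat_exp 0 (c - q u)).
  apply: (smooth_on_comp1 openT (@openT R) smooth_on_flat_exp (fun _ _ => I)).
  exact: (smooth_onB openT (smooth_on_cst _) sq).
have sn : smooth_on setT (fun u => flat_exp 0 (q u - c / 2)).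
  apply: (smooth_on_comp1 openT (@openT R) smooth_on_flat_exp (fun _ _ => I)).
  exact: (smooth_onB openT sq (smooth_on_cst _)).
have pn u : 0 < flat_exp 0 (c - q u) + flat_exp 0 (q u - c / 2).
  have [H|H] := ltP (q u) c.
    by rewrite ltr_wpDr ?flat_exp_ge0// flat_exp_gt0// subr_gt0.
  rewrite ltr_wpDl ?flat_exp_ge0// flat_exp_gt0// subr_gt0.
  exact: lt_le_trans H.
have sD := smooth_onD openT sp sn.
have sV := smooth_onV openT (fun u _ => lt0r_neq0 (pn u)) sD.
exists (fun u => flat_exp 0 (c - q u) * (flat_exp 0 (c - q u) + flat_exp 0 (q u - c / 2))^-1).
split.
- exact: (smooth_onM openT sp sV).
- by move=> u; rewrite mulr_ge0 ?flat_exp_ge0// invr_ge0 ltW.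
- move=> u qc; have -> : flat_exp 0 (q u - c / 2) = 0 by rewrite flat_exp_le0// subr_le0.
  by rewrite addr0 divff// gt_eqF// flat_exp_gt0// subr_gt0; apply: le_lt_trans qc _.
- by move=> u qc; rewrite flat_exp_le0 ?mul0r// subr_le0.
Qed.

(** The plateau is taken of the square of the Euclidean distance, which is
    smooth, unlike the norm in which the balls are measured. *)
Lemma bump_exists (a : 'rV[R]_d) (e : R) : 0 < e ->
  exists B : 'rV[R]_d -> R,
    [/\ smooth_on setT B, forall u, 0 <= B u,
        exists2 r, 0 < r & forall u, `|u - a| < r -> B u = 1
      & forall u, e <= `|u - a| -> B u = 0].
Proof.
move=> e0.
have [c c0 cE] : exists2 c : R, 0 < c & c = e / 2 by exists (e / 2); rewrite ?divr_gt0.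
pose q (u : 'rV[R]_d) := \sum_(i < d) (u 0 i - a 0 i) * (u 0 i - a 0 i) : R.
have sq : smooth_on setT q.
  apply: (smooth_on_sum openT) => i.
  have sc := smooth_onB openT (smooth_on_coord openT i) (smooth_on_cst (a 0 i)).
  exact: (smooth_onM openT sc sc).
have c2 : 0 < c ^+ 2 by rewrite exprn_gt0.
have [B [sB B0 B1 Bz]] := plateau c2 sq.
exists B; split => //.
- exists (c / d.+2%:R); first by rewrite divr_gt0.
  move=> u ua; apply: B1.
  apply: (@le_trans _ _ (\sum_(i < d) (c / d.+2%:R) ^+ 2)).
    apply: ler_sum => i _; rewrite -expr2 -[leLHS]real_normK ?num_real//.
    rewrite ler_pXn2r ?nnegrE ?normr_ge0 ?divr_ge0 ?(ltW c0)//.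
    by apply: le_trans (ltW ua); have := coord_le_norm (u - a) i; rewrite !mxE.
  rewrite sumr_const card_ord expr_div_n -[leLHS]mulr_natl mulrCA; apply: ler_wpM2l; first exact: ltW.
  rewrite ler_pdivrMr ?exprn_gt0// mulrC ler_pdivlMr// -natrX -natrM ler_nat expnS expn1.
  by apply: leq_mul => //; apply: leqW; apply: leqW.
- move=> u ua; apply: Bz.
  rewrite leNgt; apply/negP => qc.
  suff : `|u - a| <= c.
    apply/negP; rewrite -ltNge; apply: lt_le_trans ua.
    by rewrite cE ltr_pdivrMr// ltr_pMr// ltr1n.
  apply: norm_le_coord; first exact: ltW.
  move=> i; rewrite -(ler_pXn2r (ltn0Sn 1)) ?nnegrE ?normr_ge0 ?(ltW c0)//.
  apply: le_trans (ltW qc); rewrite /q (bigD1 i) //= !mxE.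
  rewrite real_normK ?num_real// expr2 lerDl sumr_ge0// => j _.
  by rewrite -expr2 sqr_ge0.
Qed.

End Bump.

(** * Test functions, mixed derivatives and Hadamard's lemma *)

Section TestFunctions.
Context {R : realType} {d : nat}.
Implicit Types (F G : 'rV[R]_d -> R).

Definition testfun F := smooth_on setT F /\ exists K : R, forall u, K < `|u| -> F u = 0.

Lemma testfun_partial F i : testfun F -> testfun ('D_(delta_mx 0 i) F).
Proof.
move=> [sF [K HK]]; split; first exact: smooth_on_partial.
exists (K + 1) => u Ku.
rewrite (@near_eq_derive _ _ _ _ (cst 0)); first exact: derive_cst.
apply/(@nbhs_ballP R 'rV[R]_d); exists 1 => //= w; rewrite -ball_normE /= => uw.
apply: HK; rewrite -(ltrD2r 1); apply: lt_le_trans Ku _.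
rewrite -[u](subrK w) addrC; apply: le_trans (ler_normD _ _) _.
by rewrite lerD2l ltW.
Qed.

Lemma testfun_continuous F : testfun F -> continuous F.
Proof. by move=> [sF _] u; exact: smooth_on_continuous sF _. Qed.

Lemma testfun_bounded F : testfun F -> exists2 C, 0 < C & forall u, `|F u| <= C.
Proof.
move=> tF; have [sF [K HK]] := tF.
pose A : set 'rV[R]_d := [set u | `|u| <= Num.max K 0].
have cA : compact A.
  apply: bounded_closed_compact.
    exists (Num.max K 0); split; first exact: num_real.
    by move=> x Kx u Au; apply: le_trans Au (ltW Kx).
  apply: (@closed_comp _ _ (fun u : 'rV[R]_d => `|u|) [set x | x <= Num.max K 0]); last exact: closed_le.
  by move=> u _; exact: norm_continuous.
have [||c _ Hc] := @EVT_max_rV _ _ (fun u => `|F u|) A _ cA.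
- by exists 0; rewrite /A /= normr0 le_max lexx orbT.
- apply: continuous_subspaceT => u; apply: continuous_comp.
    exact: testfun_continuous.
  exact: norm_continuous.
exists (`|F c| + 1); first by rewrite ltr_wpDl.
move=> u; have [uA|] := boolP (u \in A); first by rewrite ler_wpDr// Hc.
rewrite notin_setE /A /= => /negP; rewrite -ltNge gt_max => /andP[/HK -> _].
by rewrite normr0 addr_ge0.
Qed.

Lemma testfun_lipschitz F : testfun F ->
  exists2 C, 0 < C & forall u v, `|F u - F v| <= C * `|u - v|.
Proof.
move=> tF; have [sF _] := tF.
have /choice[C HC] : forall i : 'I_d, exists C, 0 < C /\ forall u, `|'D_(delta_mx 0 i) F u| <= C.
  by move=> i; have [C] := testfun_bounded (testfun_partial i tF); exists C.
exists (\sum_i C i + 1).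
  by rewrite ltr_wpDl// sumr_ge0// => i _; rewrite ltW//; have [] := HC i.
move=> u v.
have dF w : differentiable F w /\ 'd F w = grad_form F w :> (_ -> _).
  exact: (smooth_on_diff openT sF).
have [|s _ E] := @MVT_line _ _ F v (u - v) 1.
  by move=> s _; apply: diff_derivable; have [] := dF (v + (s * 1) *: (u - v)).
rewrite mul1r scale1r [v + (u - v)]addrC subrK in E; rewrite E deriveE; last by have [] := dF (v + (s * 1) *: (u - v)).
have [_ ->] := dF (v + (s * 1) *: (u - v)).
apply: le_trans (ler_norm_sum _ _ _) _.
rewrite mulrDl mul1r mulr_suml; apply: ler_wpDr => //; apply: ler_sum => i _.
rewrite normrM mulrC; apply: ler_pM => //; first by have [] := HC i.
exact: coord_le_norm.
Qed.

End TestFunctions.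

(** Meant for two functions of which one only knows that they take a common
    value at points near u, as mixed second derivatives do. *)
Lemma eq_at_of_near_values (R : realType) (V : normedModType R) (g1 g2 : V -> R) (u : V) (r : R) :
  0 < r -> {for u, continuous g1} -> {for u, continuous g2} ->
  (forall h, 0 < h -> h + h < r -> exists w1 w2,
     [/\ `|w1 - u| <= h + h, `|w2 - u| <= h + h & g1 w1 = g2 w2]) ->
  g1 u = g2 u.
Proof.
move=> r0 c1 c2 H.
apply/eqP; rewrite -subr_eq0 -normr_le0; apply/ler_addgt0Pr => eps eps0; rewrite add0r.
have e2 : 0 < eps / 2 by rewrite divr_gt0.
move/(@cvgrPdist_le R R) : c1 => /(_ _ e2) n1; move/(@cvgrPdist_le R R) : c2 => /(_ _ e2) n2.
have [s /= s0 Hs] := (@nbhs_ballP R V u _).1 (@filterI _ (nbhs u) _ _ _ n1 n2).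
pose h := Num.min r s / 3.
have m0 : 0 < Num.min r s by rewrite lt_min r0.
have h0 : 0 < h by rewrite divr_gt0.
have hh : h + h < Num.min r s by rewrite /h; lra.
have hr : h + h < r by apply: lt_le_trans hh _; rewrite ge_min lexx.
have hs : h + h < s by apply: lt_le_trans hh _; rewrite ge_min lexx orbT.
have [w1 [w2 [Hw1 Hw2 E]]] := H h h0 hr.
have [B1 _] : `|g1 u - g1 w1| <= eps / 2 /\ `|g2 u - g2 w1| <= eps / 2.
  by apply: Hs; rewrite -ball_normE /= distrC; exact: le_lt_trans hs.
have [_ B2] : `|g1 u - g1 w2| <= eps / 2 /\ `|g2 u - g2 w2| <= eps / 2.
  by apply: Hs; rewrite -ball_normE /= distrC; exact: le_lt_trans hs.
have -> : g1 u - g2 u = (g1 u - g1 w1) - (g2 u - g2 w2) by rewrite E; ring.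
by apply: le_trans (ler_normB _ _) _; rewrite [leRHS]splitr lerD.
Qed.

Section Schwarz.
Context {R : realType} {d : nat} (Omega : set 'rV[R]_d) (oO : open Omega).

(** The second difference of f over a small square equals h ^ 2 times either of
    the mixed derivatives, each at its own point of the square. *)
Lemma schwarz f (i j : 'I_d) u : smooth_on Omega f -> Omega u ->
  'D_(delta_mx 0 i) ('D_(delta_mx 0 j) f) u = 'D_(delta_mx 0 j) ('D_(delta_mx 0 i) f) u.
Proof.
move=> sf Ou.
pose e k : 'rV[R]_d := delta_mx 0 k.
have ne k (a : R) : `|a *: e k| <= `|a|.
  apply: norm_le_coord => // l; rewrite !mxE eqxx /=.
  by case: eqP => _; rewrite ?mulr1// mulr0 normr0.
have [r r0 Hr] : exists2 r : R, 0 < r & forall w, ball u r w -> Omega w.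
  apply/(@nbhs_ballP R 'rV[R]_d); exact: open_nbhs_nbhs.
have key (k l : 'I_d) (h : R) : 0 < h -> h + h < r -> exists2 w, `|w - u| <= h + h &
   f (u + h *: e k + h *: e l) - f (u + h *: e k) - f (u + h *: e l) + f u
   = h * h * 'D_(e l) ('D_(e k) f) w.
  move=> h0 hr.
  have inO (a b : R) : 0 <= a <= 1 -> 0 <= b <= 1 -> Omega (u + (a * h) *: e k + (b * h) *: e l).
    move=> /andP[a0 a1] /andP[b0 b1]; apply: Hr; rewrite -ball_normE /=.
    rewrite -addrA opprD addrA subrr sub0r normrN; apply: le_lt_trans hr.
    apply: le_trans (ler_normD _ _) _; apply: lerD; apply: le_trans (ne _ _) _.
      by rewrite ger0_norm ?mulr_ge0 ?(ltW h0)// ler_piMl// ltW.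
    by rewrite ger0_norm ?mulr_ge0 ?(ltW h0)// ler_piMl// ltW.
  have inO0 (a : R) : 0 <= a <= 1 -> Omega (u + (a * h) *: e k).
    by move=> a01; have := inO a 0 a01; rewrite mul0r scale0r addr0 lexx ler01; apply.
  have inO1 (a : R) : 0 <= a <= 1 -> Omega (u + (a * h) *: e k + h *: e l).
    by move=> a01; have := inO a 1 a01; rewrite mul1r lexx ler01; apply.
  pose G x := f (x + h *: e l) - f x.
  have dsh x : Omega (x + h *: e l) ->
      is_derive x (e k) (fun x => f (x + h *: e l)) ('D_(e k) f (x + h *: e l)).
    move=> Ox; have df := smooth_on_derivable (i:=k) sf Ox.
    have E : (fun t : R => t^-1 *: (((fun x => f (x + h *: e l)) \o shift x) (t *: e k) - f (x + h *: e l)))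
      = (fun t : R => t^-1 *: ((f \o shift (x + h *: e l)) (t *: e k) - f (x + h *: e l))).
      by apply/funext => t /=; rewrite addrA.
    by split; [rewrite /derivable E | rewrite /derive E].
  have dG (a : R) : 0 <= a <= 1 -> is_derive (u + (a * h) *: e k) (e k) G
     ('D_(e k) f (u + (a * h) *: e k + h *: e l) - 'D_(e k) f (u + (a * h) *: e k)).
    move=> a01; apply: is_deriveB; first exact/dsh/inO1.
    exact: derivableP (smooth_on_derivable (i:=k) sf (inO0 _ a01)).
  have [|a a01 E1] := @MVT_line _ _ G u (e k) h; first by move=> a /dG[].
  have [_ EG] := dG a a01; rewrite {}EG in E1.
  have [|b b01 E2] := @MVT_line _ _ ('D_(e k) f) (u + (a * h) *: e k) (e l) h.
    by move=> b b01; apply: smooth_on_derivable (inO _ _ a01 b01); exact: smooth_on_partial.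
  exists (u + (a * h) *: e k + (b * h) *: e l).
    rewrite -[X in `|X - u|]addrA [u + _]addrC addrK; move: a01 b01 => /andP[a0 a1] /andP[b0 b1].
    apply: le_trans (ler_normD _ _) _; apply: lerD; apply: le_trans (ne _ _) _.
      by rewrite ger0_norm ?mulr_ge0 ?(ltW h0)// ler_piMl// ltW.
    by rewrite ger0_norm ?mulr_ge0 ?(ltW h0)// ler_piMl// ltW.
  by rewrite -mulrA -E2 -E1 /G opprB addrA addrAC.
apply: (@eq_at_of_near_values _ _ ('D_(delta_mx 0 i) ('D_(delta_mx 0 j) f))
  ('D_(delta_mx 0 j) ('D_(delta_mx 0 i) f)) u r r0).
- by apply: (smooth_on_continuous _ Ou); do 2!apply: smooth_on_partial.
- by apply: (smooth_on_continuous _ Ou); do 2!apply: smooth_on_partial.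
move=> h h0 hr.
have [w1 Hw1 E1] := key i j h h0 hr; have [w2 Hw2 E2] := key j i h h0 hr.
exists w2, w1; split; [exact: Hw2 | exact: Hw1 |].
have h2 : h * h != 0 by rewrite mulf_neq0 ?gt_eqF.
move: E1 E2; rewrite [u + h *: e j + _]addrAC.
move: ('D_(e j) _ w1) ('D_(e i) _ w2) => x y E1 E2.
apply: (mulfI h2); rewrite -E1 -E2.
move: (f _) (f (_ + _)) (f (u + _)) (f u) => a1 a2 a3 a4; ring.
Qed.

End Schwarz.

Section ContinuousOperations.
Context {R : realType} (T : topologicalType).
Implicit Types f g : T -> R.

Lemma continuous_addf f g : continuous f -> continuous g -> continuous (fun x => f x + g x).
Proof. by move=> cf cg x; exact: (cvgD (cf x) (cg x)). Qed.

Lemma continuous_mulf f g : continuous f -> continuous g -> continuous (fun x => f x * g x).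
Proof. by move=> cf cg x; exact: (cvgM (cf x) (cg x)). Qed.

Lemma continuous_scalef (c : R) f : continuous f -> continuous (fun x => c * f x).
Proof. by move=> cf; apply: continuous_mulf => //; exact: cst_continuous. Qed.

End ContinuousOperations.

Section SegmentIntegral.
Context {R : realType}.
Local Notation mu := lebesgue_measure.

Lemma continuous_integrable (a b : R) (k : R -> R) :
  continuous k -> mu.-integrable `[a, b] (EFin \o k).
Proof.
move=> ck; apply: continuous_compact_integrable; first exact: segment_compact.
exact: continuous_subspaceT.
Qed.

Lemma segment_integral_lin (a b c : R) (k l : R -> R) : continuous k -> continuous l ->
  \int[mu]_(t in `[a, b]) (c * k t + l t) =
  c * (\int[mu]_(t in `[a, b]) k t) + \int[mu]_(t in `[a, b]) l t.
Proof.
move=> ck cl; rewrite RintegralD //; last 2 first.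
- apply: (@continuous_integrable a b (fun t => c * k t)).
  exact: continuous_scalef.
- exact: continuous_integrable.
by rewrite RintegralZl //; exact: continuous_integrable.
Qed.

Lemma segment_integral_bound (a b C : R) (k : R -> R) : a <= b -> continuous k ->
  (forall t, a <= t <= b -> `|k t| <= C) ->
  `|\int[mu]_(t in `[a, b]) k t| <= (b - a) * C.
Proof.
move=> ab ck kC.
apply: (le_trans (@le_normr_Rintegral _ _ _ mu _ k _ (@continuous_integrable a b k ck))) => //.
have cabs : continuous (fun t => `|k t|).
  by move=> t; apply: continuous_comp (ck t) _; exact: norm_continuous.
apply: le_trans (@le_Rintegral _ _ _ mu `[a, b] (fun t => `|k t|) (cst C) _ _ _ _) _ => //; last first.
- rewrite Rintegral_cst //= lebesgue_measure_itv /= lte_fin.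
  case: ltP => [_|ba]; first by rewrite -EFinD /= mulrC.
  by rewrite /= mulr0 (le_anti (introT andP (conj ab ba))) subrr mul0r.
- by apply: continuous_integrable; exact: cst_continuous.
- exact: continuous_integrable.
Qed.

Lemma segment_integral_FTC (a b : R) (k K : R -> R) : a < b -> continuous k ->
  (forall t : R, is_derive t 1 K (k t)) ->
  \int[mu]_(t in `[a, b]) k t = K b - K a.
Proof.
move=> ab ck dK.
have cK : continuous K.
  by move=> t; apply/differentiable_continuous/derivable1_diffP; have [] := dK t.
rewrite /Rintegral (@continuous_FTC2 _ k K a b) //.
- exact: continuous_subspaceT.
- split.
  + by move=> t _; have [] := dK t.
  + exact: cvg_at_right_filter (cK a).
  + exact: cvg_at_left_filter (cK b).
- by move=> t _; rewrite derive1E; have [_ ->] := dK t.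
Qed.

Lemma is_derive_of_bound (V : normedModType R) (f : V -> R) (x v : V) (l C : R) :
  (forall h : R, h != 0 -> `|h^-1 * (f (x + h *: v) - f x) - l| <= C * `|h|) ->
  is_derive x v f l.
Proof.
move=> H.
have C0 : 0 <= C.
  by have := H 1 (oner_neq0 _); rewrite normr1 mulr1; apply: le_trans.
suff L : h^-1 *: ((f \o shift x) (h *: v) - f x) @[h --> 0^'] --> l.
  by split; [exact: cvgP L | exact: cvg_lim L].
apply/cvgrPdist_le => e e0; near=> h.
rewrite distrC /= [_ + x]addrC; apply: le_trans (H h _) _.
  by near: h; exact: nbhs_dnbhs_neq.
apply: (@le_trans _ _ ((C + 1) * `|h|)); first by rewrite ler_wpM2r// lerDl.
rewrite mulrC -ler_pdivlMr ?ltr_wpDl//.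
near: h; apply: nbhs_dnbhs.
apply/nbhs_ballP; exists (e / (C + 1)) => /=; first by rewrite divr_gt0 ?ltr_wpDl.
by move=> t; rewrite -ball_normE /= sub0r normrN => /ltW.
Unshelve. all: by end_near. Qed.

Lemma lipschitz_continuous (V : normedModType R) (f : V -> R) (C : R) : 0 < C ->
  (forall x y, `|f x - f y| <= C * `|x - y|) -> continuous f.
Proof.
move=> C0 H x; apply/(@cvgrPdist_le R R) => e e0.
apply/(@nbhs_ballP R V); exists (e / C); first by rewrite /= divr_gt0.
move=> t; rewrite -ball_normE /= => xt; apply: le_trans (H x t) _.
by rewrite mulrC -ler_pdivlMr// ltW.
Qed.

End SegmentIntegral.

Section Hadamard.
Context {R : realType} {d : nat} (p : 'rV[R]_d).
Local Notation mu := lebesgue_measure.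
Implicit Types (F : 'rV[R]_d -> R).

(** Differentiation under the integral produces one more factor s, whence the
    weight s ^ a. *)
Definition ray_integral (a : nat) F (u : 'rV[R]_d) : R :=
  \int[mu]_(s in `[0, 1]) (s ^+ a * F (p + s *: (u - p))).

Lemma ray_integrand_continuous a F u : continuous F ->
  continuous (fun s : R => s ^+ a * F (p + s *: (u - p))).
Proof.
move=> cF; apply: continuous_mulf; first exact: exprn_continuous.
move=> s; apply: (@continuous_comp _ _ _ (fun s : R => p + s *: (u - p)) F); last exact: cF.
apply: continuousD; first exact: cst_continuous.
exact: scalel_continuous.
Qed.

Lemma ray_integral_lipschitz a F : testfun F ->
  exists2 C, 0 < C & forall u v, `|ray_integral a F u - ray_integral a F v| <= C * `|u - v|.
Proof.
move=> tF; have [C C0 HC] := testfun_lipschitz tF; exists C => // u v.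
have cF := testfun_continuous tF.
rewrite /ray_integral addrC -mulN1r -segment_integral_lin; try exact: ray_integrand_continuous.
apply: le_trans (@segment_integral_bound R 0 1 (C * `|u - v|) _ ler01 _ _) _.
- apply: continuous_addf; last exact: ray_integrand_continuous.
  exact/continuous_scalef/ray_integrand_continuous.
- move=> s /andP[s0 s1]; rewrite mulN1r addrC -mulrBr normrM ger0_norm ?exprn_ge0//.
  apply: (@le_trans _ _ (1 * `|F (p + s *: (u - p)) - F (p + s *: (v - p))|)).
    by rewrite ler_wpM2r// exprn_ile1.
  rewrite mul1r; apply: le_trans (HC _ _) _; rewrite ler_pM2l//.
  rewrite opprD addrACA subrr add0r -scalerBr opprB addrA subrK normrZ ger0_norm//.
  by rewrite ler_piMl.
by rewrite subr0 mul1r.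
Qed.

(** Differentiation under the integral: by the mean value theorem the error of
    the difference quotient is O(h) uniformly along the segment, the partial
    derivative of F being Lipschitz. *)
Lemma ray_integral_derive a F i u : testfun F ->
  is_derive u (delta_mx 0 i) (ray_integral a F)
    (ray_integral a.+1 ('D_(delta_mx 0 i) F) u).
Proof.
move=> tF; have tD := testfun_partial i tF.
have [C C0 HC] := testfun_lipschitz tD.
have cF := testfun_continuous tF; have cD := testfun_continuous tD.
apply: (@is_derive_of_bound _ _ _ _ _ _ C) => h h0.
set e := delta_mx 0 i.
have ck a' G v := @ray_integrand_continuous a' G v.
have -> : h^-1 * (ray_integral a F (u + h *: e) - ray_integral a F u) -
    ray_integral a.+1 ('D_e F) u =
    -1 * ray_integral a.+1 ('D_e F) u +
     (h^-1 * ray_integral a F (u + h *: e) +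
     ((- h^-1) * ray_integral a F u + \int[mu]_(s in `[0, 1]) cst 0 s)).
  by rewrite Rintegral_cst //= mul0r; ring.
have c0 : continuous (cst 0 : R -> R) by exact: cst_continuous.
have lc (x : R) (k l : R -> R) : continuous k -> continuous l -> continuous (fun s => x * k s + l s).
  by move=> kc lc; apply: continuous_addf => //; exact: continuous_scalef.
have cA := ck a F u cF; have cB := ck a F (u + h *: e) cF; have cC := ck a.+1 _ u cD.
have c1 := lc (- h^-1) _ _ cA c0; have c2 := lc h^-1 _ _ cB c1; have c3 := lc (-1) _ _ cC c2.
rewrite /ray_integral -(segment_integral_lin _ _ _ cA c0).
rewrite -(segment_integral_lin _ _ _ cB c1) -(segment_integral_lin _ _ _ cC c2).
apply: le_trans (@segment_integral_bound R 0 1 (C * `|h|) _ ler01 c3 _) _; last first.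
  by rewrite subr0 mul1r.
move=> s /andP[s0 s1] /=.
pose x := p + s *: (u - p).
have xE : p + s *: (u + h *: e - p) = x + (s * h) *: e.
  by apply/rowP => k; rewrite /x !mxE; ring.
have [|t /andP[t0 t1] E] := @MVT_line _ _ F x e (s * h).
  by move=> t _; apply: (smooth_on_derivable (proj1 tF)).
have -> : -1 * (s ^+ a.+1 * 'D_e F (p + s *: (u - p))) +
   (h^-1 * (s ^+ a * F (p + s *: (u + h *: e - p))) +
     (- h^-1 * (s ^+ a * F (p + s *: (u - p))) + 0)) =
   s ^+ a.+1 * ('D_e F (x + (t * (s * h)) *: e) - 'D_e F x).
  move/eqP: E; rewrite subr_eq => /eqP E; rewrite xE -/x E exprS.
  move: (F x) ('D_e F x) ('D_e F _) (s ^+ a) => y1 y2 y3 y4.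
  by field.
rewrite normrM ger0_norm ?exprn_ge0//.
apply: le_trans (_ : 1 * `|'D_e F (x + (t * (s * h)) *: e) - 'D_e F x| <= _).
  by rewrite ler_wpM2r// exprn_ile1.
rewrite mul1r; apply: le_trans (HC _ _) _; rewrite ler_pM2l//.
rewrite [x + _]addrC addrK normrZ.
apply: (@le_trans _ _ (`|h| * 1)); last by rewrite mulr1.
rewrite !normrM (ger0_norm t0) (ger0_norm s0) mulrA [_ * `|h|]mulrC -mulrA ler_wpM2l//.
rewrite -[leRHS]mulr1; apply: ler_pM; rewrite ?mulr_ge0//.
  by rewrite -[leRHS]mulr1; apply: ler_pM.
apply: norm_le_coord => // k; rewrite !mxE eqxx /=.
by case: eqP; rewrite ?normr1 ?normr0.
Qed.

Lemma smooth_on_ray_integral a F : testfun F -> smooth_on setT (ray_integral a F).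
Proof.
move=> tF.
pose I := {aF : nat * ('rV[R]_d -> R) | testfun aF.2}.
pose f (i : I) := ray_integral (sval i).1 (sval i).2.
pose sh (i : I) (j : 'I_d) : I :=
  exist _ ((sval i).1.+1, 'D_(delta_mx 0 j) (sval i).2) (testfun_partial j (svalP i)).
apply: (@smooth_on_family _ _ setT openT I f (fun i j => f (sh i j)) _ _ _ (exist _ (a, F) tF)).
- move=> [[b G] /= tG] u _; rewrite /f /=.
  have [C C0 HC] := ray_integral_lipschitz b tG.
  exact: (lipschitz_continuous C0 HC).
- by move=> [[b G] /= tG] j u _; rewrite /f /=; exact: ray_integral_derive.
- by move=> N H i j; exact: H.
Qed.

(** Hadamard's lemma: integrate the derivative of F along the segment from p to
    u; the coefficients are the means of the partial derivatives over it. *)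
Lemma hadamard F : testfun F ->
  exists2 G : 'I_d -> 'rV[R]_d -> R,
    forall i, smooth_on setT (G i) /\ G i p = 'D_(delta_mx 0 i) F p &
    forall u, F u = F p + \sum_(i < d) (u 0 i - p 0 i) * G i u.
Proof.
move=> tF; exists (fun i => ray_integral 0 ('D_(delta_mx 0 i) F)).
  move=> i; split; first exact/smooth_on_ray_integral/testfun_partial.
  rewrite /ray_integral; under eq_Rintegral do rewrite expr0 mul1r subrr scaler0 addr0.
  rewrite Rintegral_cst //= lebesgue_measure_itv /= lte_fin ltr01 -EFinD /=.
  by rewrite subr0 mulr1.
move=> u; apply/eqP; rewrite addrC -subr_eq; apply/eqP.
have dF w : differentiable F w /\ 'd F w = grad_form F w :> (_ -> _).
  exact: (smooth_on_diff openT (proj1 tF)).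
pose k (s : R) := \sum_(i < d) (u 0 i - p 0 i) * 'D_(delta_mx 0 i) F (p + s *: (u - p)).
have ci i : continuous (fun s : R => 'D_(delta_mx 0 i) F (p + s *: (u - p))).
  move=> s; have := @ray_integrand_continuous 0 _ u (testfun_continuous (testfun_partial i tF)) s.
  by under eq_fun do rewrite expr0 mul1r.
have ck : continuous k.
  apply: (@continuous_big _ _ +%R 0 predT add_continuous) => i _.
  exact: continuous_scalef.
have dk (s : R) : is_derive s 1 (fun s => F (p + s *: (u - p))) (k s).
  have [df E] := dF (p + s *: (u - p)).
  have -> : k s = 'D_(u - p) F (p + s *: (u - p)).
    by rewrite deriveE // E /k /grad_form; apply: eq_bigr => i _; rewrite !mxE.
  by apply: is_derive_line; exact: diff_derivable.
have := segment_integral_FTC (@ltr01 R) ck dk.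
rewrite scale1r scale0r addr0 [p + _]addrC subrK => <-.
rewrite /k /ray_integral.
have aux (s : seq 'I_d) :
    continuous (fun t : R => \sum_(i <- s) (u 0 i - p 0 i) * 'D_(delta_mx 0 i) F (p + t *: (u - p))) /\
  \int[mu]_(t in `[0, 1]) (\sum_(i <- s) (u 0 i - p 0 i) * 'D_(delta_mx 0 i) F (p + t *: (u - p)))
  = \sum_(i <- s) (u 0 i - p 0 i) * \int[mu]_(t in `[0, 1]) (t ^+ 0 * 'D_(delta_mx 0 i) F (p + t *: (u - p))).
  elim: s => [|i s [IH1 IH2]].
    split; first by under eq_fun do rewrite big_nil; exact: cst_continuous.
    under eq_Rintegral do rewrite big_nil.
    by rewrite big_nil Rintegral_cst //= mul0r.
  split.
    under eq_fun do rewrite big_cons; apply: continuous_addf; last exact: IH1.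
    exact: continuous_scalef.
  under eq_Rintegral do rewrite big_cons.
  rewrite (segment_integral_lin _ _ _ (ci i) IH1) big_cons IH2; congr (_ * _ + _).
  by apply: eq_Rintegral => t _; rewrite expr0 mul1r.
exact: (aux _).2.
Qed.

End Hadamard.

(** * Iterated integrals of test functions *)

Section LineIntegral.
Context {R : realType}.
Local Notation mu := (@lebesgue_measure R).

Lemma Rintegral_supp (g : R -> R) (K : R) : (forall t, K < `|t| -> g t = 0) ->
  \int[mu]_(t in [set: R]) g t = \int[mu]_(t in `[- K, K]) g t.
Proof.
move=> gK; rewrite [RHS](Rintegral_mkcond mu) ; apply: eq_Rintegral => t _.
rewrite patchE; case: ifPn => // /negP; rewrite inE /= in_itv /= => H.
apply: gK; rewrite ltNge ler_norml; exact/negP.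
Qed.

(** g stays above half of g t0 on an interval. *)
Lemma Rintegral_gt0 (g : R -> R) (K t0 : R) : continuous g ->
  (forall t, K < `|t| -> g t = 0) -> (forall t, 0 <= g t) -> 0 < g t0 ->
  0 < \int[mu]_(t in [set: R]) g t.
Proof.
move=> cg gK g0 gt0.
have tK : `|t0| <= K by rewrite leNgt; apply/negP => /gK E; rewrite E ltxx in gt0.
pose c := g t0 / 2; have c0 : 0 < c by rewrite divr_gt0.
have /(@cvgrPdist_lt R R) /(_ _ c0) /(@nbhs_ballP R R) [r /= r0 Hr] := cg t0.
pose b := r / 2; have b0 : 0 < b by rewrite divr_gt0.
have br : b < r by rewrite ltr_pdivrMr// ltr_pMr// ltr1n.
have gc t : t0 - b <= t <= t0 + b -> c <= g t.
  move=> tb; have /Hr : ball t0 r t.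
    rewrite -ball_normE /= distrC; apply: le_lt_trans br.
    by rewrite ler_norml; move: tb; lra.
  by rewrite /= ltr_norml /c; lra.
have itvS : measurable (`[t0 - b, t0 + b] : set R) by exact: measurable_itv.
have bb : t0 - b < t0 + b by lra.
apply: (@lt_le_trans _ _ (\int[mu]_(t in `[t0 - b, t0 + b]) cst c t)).
  rewrite Rintegral_cst //= lebesgue_measure_itv /= lte_fin bb -EFinD /=.
  by rewrite mulr_gt0// subr_gt0.
rewrite [leLHS](Rintegral_mkcond mu).
apply: le_Rintegral => //.
- have := (integrable_mkcond (mu := mu) (EFin \o cst c) itvS).1
    (@continuous_integrable R _ _ (cst c) (@cst_continuous _ _ c)).
  by rewrite (restrict_EFin _ _).
- have itvK : measurable (`[- K, K] : set R) by exact: measurable_itv.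
  have := (integrable_mkcond (mu := mu) (EFin \o g) itvK).1 (@continuous_integrable R _ _ g cg).
  rewrite (restrict_EFin _ _) (_ : g \_ _ = g) //.
  apply/funext => t; rewrite patchE; case: ifPn => // /negP; rewrite inE /= in_itv /= => H.
  by apply/esym/gK; rewrite ltNge ler_norml; exact/negP.
- move=> t _; rewrite patchE; case: ifPn => [|_]; last exact: g0.
  by rewrite inE /= in_itv /= => /gc.
Qed.

End LineIntegral.

Section Slices.
Context {R : realType} {d : nat}.
Implicit Types (F : 'rV[R]_d.+1 -> R) (v w : 'rV[R]_d) (t s : R).

Definition join (t : R) (v : 'rV[R]_d) : 'rV[R]_d.+1 := row_mx (t%:M : 'M[R]_1) v.
Definition slice (t : R) F : 'rV[R]_d -> R := fun v => F (join t v).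

Lemma iterated_integralS F :
  iterated_integral F = \int[lebesgue_measure]_(t in [set: R]) iterated_integral (slice t F).
Proof. by []. Qed.

Lemma join0 t v : join t v 0 ord0 = t.
Proof.
rewrite /join (_ : ord0 = @lshift 1 d 0); last exact: val_inj.
by rewrite (@row_mxEl _ 1 1 d) mxE eqxx.
Qed.

Lemma joinS t v (j : 'I_d) : join t v 0 (lift ord0 j) = v 0 j.
Proof.
rewrite /join (_ : lift ord0 j = @rshift 1 d j); last exact: val_inj.
by rewrite (@row_mxEr _ 1 1 d).
Qed.

Lemma join_surj (u : 'rV[R]_d.+1) : u = join (u 0 0) (\row_j u 0 (lift ord0 j)).
Proof.
apply/rowP => i; case: (unliftP ord0 i) => [j|] ->; first by rewrite joinS mxE.
by rewrite join0.
Qed.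

Lemma norm_le_join (u : 'rV[R]_d.+1) (e : R) : 0 <= e -> `|u 0 0| <= e ->
  (forall j, `|u 0 (lift ord0 j)| <= e) -> `|u| <= e.
Proof.
move=> e0 h1 h2; apply: norm_le_coord => // i.
by case: (unliftP ord0 i) => [j|] ->.
Qed.

Lemma norm_join_fst t v : `|t| <= `|join t v|.
Proof. by have := coord_le_norm (join t v) ord0; rewrite join0. Qed.

Lemma norm_join_snd t v : `|v| <= `|join t v|.
Proof.
apply: norm_le_coord => // j.
by have := coord_le_norm (join t v) (lift ord0 j); rewrite joinS.
Qed.

Lemma dist_join_snd t v w : `|join t v - join t w| <= `|v - w|.
Proof.
apply: norm_le_join => // [|j]; rewrite mxE [X in _ + X]mxE.
  by rewrite !join0 subrr normr0.
by rewrite !joinS; have := coord_le_norm (v - w) j; rewrite !mxE.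
Qed.

Lemma dist_join_fst t s v : `|join t v - join s v| <= `|t - s|.
Proof.
apply: norm_le_join => // [|j]; rewrite mxE [X in _ + X]mxE.
  by rewrite !join0.
by rewrite !joinS subrr normr0.
Qed.

Lemma join_addr t v (h : R) j :
  join t (v + h *: delta_mx 0 j) = join t v + h *: delta_mx 0 (lift ord0 j).
Proof.
apply/rowP => i; rewrite [RHS]mxE; case: (unliftP ord0 i) => [k|] ->.
  by rewrite !joinS !mxE eqxx /= (inj_eq (@lift_inj _ _)).
by rewrite !join0 !mxE eqxx /= mulr0 addr0.
Qed.

Lemma join_addl t v (h : R) : join (t + h) v = join t v + h *: delta_mx 0 0.
Proof.
apply/rowP => i; rewrite [RHS]mxE; case: (unliftP ord0 i) => [k|] ->.
  by rewrite !joinS !mxE eqxx /= mulr0 addr0.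
by rewrite !join0 !mxE !eqxx /= mulr1.
Qed.

Lemma testfun_slice t F : testfun F -> testfun (slice t F).
Proof.
move=> [sF [K HK]]; split; last first.
  by exists K => v Kv; apply: HK; apply: lt_le_trans Kv (norm_join_snd _ _).
have sq (i : 'I_d.+1) : smooth_on setT (fun v : 'rV[R]_d => join t v 0 i).
  case: (unliftP ord0 i) => [j|] ->.
    apply: (smooth_on_ext openT (f := fun v => v 0 j)); first by move=> v _; rewrite joinS.
    exact: smooth_on_coord openT j.
  apply: (smooth_on_ext openT (f := cst t)); first by move=> v _; rewrite join0.
  exact: smooth_on_cst.
have := smooth_on_comp openT openT (fun _ _ => I) sF sq.
apply: smooth_on_ext; first exact: openT.
by move=> v _; rewrite /slice; congr F; apply/rowP => i; rewrite mxE.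
Qed.

Lemma slice_partial t F j :
  slice t ('D_(delta_mx 0 (lift ord0 j)) F) = 'D_(delta_mx 0 j) (slice t F).
Proof.
apply/funext => v; rewrite /slice /derive.
set g1 := fun h => h^-1 *: _; set g2 := fun h => h^-1 *: _.
suff -> : g1 = g2 by [].
by apply/funext => h; rewrite /g1 /g2 /= [h *: delta_mx 0 (lift _ _) + _]addrC -join_addr [v + _]addrC.
Qed.

End Slices.

Section IteratedIntegral.
Context {R : realType}.

(** Lipschitz functions supported in a box: a class stable under slicing on
    which the iterated integral is well behaved. *)
Definition tame d (K C : R) (F : 'rV[R]_d -> R) :=
  (forall u v, `|F u - F v| <= C * `|u - v|) /\ (forall u, K < `|u| -> F u = 0).

Lemma tame_lin d K C D a (F G : 'rV[R]_d -> R) : tame K C F -> tame K D G ->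
  tame K (`|a| * C + D) (fun u => a * F u + G u).
Proof.
move=> [F1 F2] [G1 G2]; split => [u v|u Ku]; last by rewrite F2 // G2 // mulr0 addr0.
rewrite opprD addrACA -mulrBr mulrDl -mulrA; apply: le_trans (ler_normD _ _) _.
by rewrite normrM lerD// ler_wpM2l.
Qed.

Lemma tame_slice d K C t (F : 'rV[R]_d.+1 -> R) : 0 <= C -> tame K C F -> tame K C (slice t F).
Proof.
move=> C0 [F1 F2]; split => [u v|u Ku].
  by apply: le_trans (F1 _ _) _; rewrite ler_wpM2l// dist_join_snd.
by apply: F2; apply: lt_le_trans Ku (norm_join_snd _ _).
Qed.

Lemma testfun_tame d (F : 'rV[R]_d -> R) : testfun F ->
  exists K C : R, [/\ 0 < K, 0 < C & tame K C F].
Proof.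
move=> tF; have [_ [K HK]] := tF; have [C C0 HC] := testfun_lipschitz tF.
exists (Num.max K 1), C; split => //; first by rewrite lt_max ltr01 orbT.
by split => // u; rewrite gt_max => /andP[/HK].
Qed.

Lemma tame_weak d K L C (F : 'rV[R]_d -> R) : K <= L -> tame K C F -> tame L C F.
Proof. by move=> KL [F1 F2]; split => // u /(le_lt_trans KL) /F2. Qed.

(** Linearity and the bound are proved together: the bound, applied to the
    difference of two slices, makes the integral of a slice Lipschitz in the
    outer variable, hence integrable, and linearity needs this. *)
Lemma tame_iterated_integral d (K : R) : 0 < K ->
  (forall C D a (F G : 'rV[R]_d -> R), 0 <= C -> 0 <= D -> tame K C F -> tame K D G ->
    iterated_integral (fun u => a * F u + G u) =
    a * iterated_integral F + iterated_integral G) /\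
  (forall C B (F : 'rV[R]_d -> R), 0 <= C -> tame K C F -> (forall u, `|F u| <= B) ->
    `|iterated_integral F| <= (K + K) ^+ d * B).
Proof.
move=> K0; have K20 : 0 <= K + K by rewrite addr_ge0// ltW.
elim: d => [|d [IHl IHb]]; first by split => // C B F C0 _ HB; rewrite expr0 mul1r; exact: HB.
have slice0 t C (F : 'rV[R]_d.+1 -> R) : tame K C F -> K < `|t| -> iterated_integral (slice t F) = 0.
  move=> [_ F2] Kt; have E0 : slice t F = fun _ => 0.
    by apply/funext => v; apply: F2; apply: lt_le_trans Kt (norm_join_fst _ _).
  rewrite E0; apply/eqP; rewrite -normr_le0.
  have t0 : tame K 0 (fun _ : 'rV[R]_d => 0 : R).
    by split => // u v; rewrite subrr normr0 mul0r.
  have := IHb 0 0 _ (lexx 0) t0; rewrite mulr0; apply => u; by rewrite normr0.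
have slip C (F : 'rV[R]_d.+1 -> R) : 0 <= C -> tame K C F ->
   forall s t, `|iterated_integral (slice s F) - iterated_integral (slice t F)| <= ((K + K) ^+ d * C) * `|s - t|.
  move=> C0 tF s t; have ts := tame_slice s C0 tF; have tt' := tame_slice t C0 tF.
  rewrite addrC -mulN1r -(IHl _ _ _ _ _ C0 C0 tt' ts) -mulrA.
  apply: (IHb _ _ _ _ (tame_lin (-1) tt' ts)); first by rewrite addr_ge0// mulr_ge0.
  move=> v; rewrite mulN1r addrC /slice; apply: le_trans (tF.1 _ _) _.
  by rewrite ler_wpM2l// dist_join_fst.
have cont C (F : 'rV[R]_d.+1 -> R) : 0 <= C -> tame K C F ->
    continuous (fun t => iterated_integral (slice t F)).
  move=> C0 tF; apply: (@lipschitz_continuous _ _ _ ((K + K) ^+ d * C + 1)).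
    by rewrite ltr_wpDl// mulr_ge0// exprn_ge0.
  move=> s t; apply: le_trans (slip C F C0 tF s t) _.
  by rewrite ler_wpM2r// lerDl.
split.
  move=> C D a F G C0 D0 tF tG; rewrite !iterated_integralS.
  have tH := tame_lin a tF tG.
  have H0 : 0 <= `|a| * C + D by rewrite addr_ge0// mulr_ge0.
  rewrite (Rintegral_supp (fun t => slice0 t _ _ tF)) (Rintegral_supp (fun t => slice0 t _ _ tG)).
  rewrite (Rintegral_supp (fun t => slice0 t _ _ tH)).
  rewrite -(segment_integral_lin _ _ _ (cont _ _ C0 tF) (cont _ _ D0 tG)).
  apply: eq_Rintegral => t _.
  exact: (IHl _ _ _ _ _ C0 D0 (tame_slice t C0 tF) (tame_slice t D0 tG)).
move=> C B F C0 tF HB; rewrite iterated_integralS (Rintegral_supp (fun t => slice0 t _ _ tF)).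
have KK : - K <= K by rewrite ge0_cp// ltW.
apply: le_trans (segment_integral_bound KK (cont _ _ C0 tF) (C := (K + K) ^+ d * B) _) _.
  by move=> t _; apply: (IHb _ _ _ _ (tame_slice t C0 tF)) => // v; exact: HB.
by rewrite opprK exprS mulrA.
Qed.

Lemma iterated_integral_lin d a (F G : 'rV[R]_d -> R) : testfun F -> testfun G ->
  iterated_integral (fun u => a * F u + G u) =
  a * iterated_integral F + iterated_integral G.
Proof.
move=> /testfun_tame [K [C [K0 C0 tF]]] /testfun_tame [L [D [L0 D0 tG]]].
have KL : 0 < Num.max K L by rewrite lt_max K0.
apply: (tame_iterated_integral d KL).1 (ltW C0) (ltW D0) _ _.
  by apply: tame_weak tF; rewrite le_max lexx.
by apply: tame_weak tG; rewrite le_max lexx orbT.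
Qed.

Lemma iterated_integral0 d : iterated_integral (fun _ : 'rV[R]_d => 0 : R) = 0.
Proof.
elim: d => [|d IH] //=; under eq_Rintegral do rewrite IH.
by rewrite Rintegral_cst //= mul0r.
Qed.

Lemma iterated_integral_ge0 d (F : 'rV[R]_d -> R) : (forall u, 0 <= F u) ->
  0 <= iterated_integral F.
Proof.
elim: d F => [|d IH] F F0; first exact: F0.
by rewrite iterated_integralS; apply: Rintegral_ge0 => t _; apply: IH => v; exact: F0.
Qed.

(** Differentiation under the inner integrals: the error of the difference
    quotient is O(h) on a fixed box, the partial derivative being Lipschitz. *)
Lemma slice_integral_derive d (F : 'rV[R]_d.+1 -> R) (t : R) : testfun F ->
  is_derive t 1 (fun t => iterated_integral (slice t F))
    (iterated_integral (slice t ('D_(delta_mx 0 0) F))).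
Proof.
move=> tF; have tD := testfun_partial 0 tF.
have [K [C [K0 C0 tmF]]] := testfun_tame tF.
have [L [D [L0 D0 tmD]]] := testfun_tame tD.
pose N := Num.max K L.
have N0 : 0 < N by rewrite lt_max K0.
have KN : K <= N by rewrite le_max lexx.
have LN : L <= N by rewrite le_max lexx orbT.
have [lin bound] := @tame_iterated_integral d N N0.
apply: (@is_derive_of_bound _ _ _ _ _ _ ((N + N) ^+ d * D)) => h h0.
rewrite [h%:A]mulr1.
have tame_F s := tame_weak KN (tame_slice s (ltW C0) tmF).
have tame_D s := tame_weak LN (tame_slice s (ltW D0) tmD).
have E1 := lin _ _ (-1) _ _ (ltW D0) (ltW C0) (tame_D t) (tame_F t).
have -> : h^-1 * (iterated_integral (slice (t + h) F) - iterated_integral (slice t F))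
   - iterated_integral (slice t ('D_(delta_mx 0 0) F)) =
   h^-1 * iterated_integral (slice (t + h) F) +
   ((- h^-1) * iterated_integral (slice t F) +
     (-1 * iterated_integral (slice t ('D_(delta_mx 0 0) F)) + iterated_integral (fun _ : 'rV[R]_d => 0))).
  by rewrite iterated_integral0; ring.
have tame0 : tame N 0 (fun _ : 'rV[R]_d => 0 : R).
  by split => // u v; rewrite subrr normr0 mul0r.
have p1 : 0 <= `|-1 : R| * D + 0 by rewrite addr_ge0// mulr_ge0// ltW.
have t1 := tame_lin (-1) (tame_D t) tame0.
have p2 : 0 <= `|- h^-1| * C + (`|-1| * D + 0) by rewrite addr_ge0// mulr_ge0// ltW.
have t2 := tame_lin (- h^-1) (tame_F t) t1.
have p3 : 0 <= `|h^-1| * C + (`|- h^-1| * C + (`|-1| * D + 0)) by rewrite addr_ge0// mulr_ge0// ltW.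
have t3 := tame_lin h^-1 (tame_F (t + h)) t2.
rewrite -(lin _ _ _ _ _ (ltW D0) (lexx 0) (tame_D t) tame0).
rewrite -(lin _ _ _ _ _ (ltW C0) p1 (tame_F t) t1) -(lin _ _ _ _ _ (ltW C0) p2 (tame_F (t + h)) t2).
rewrite -mulrA; apply: bound p3 t3 _ => v.
rewrite /slice join_addl.
have [|s /andP[s0 s1] E] := @MVT_line _ _ F (join t v) (delta_mx 0 0) h.
  by move=> s _; apply: (smooth_on_derivable (proj1 tF)).
move/eqP: E; rewrite subr_eq => /eqP ->.
have -> : h^-1 * (h * 'D_'e_0 F (join t v + (s * h) *: 'e_0) + F (join t v)) +
   (- h^-1 * F (join t v) + (-1 * 'D_'e_0 F (join t v) + 0)) =
   'D_'e_0 F (join t v + (s * h) *: 'e_0) - 'D_'e_0 F (join t v).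
  move: (F _) ('D_'e_0 F (join t v)) ('D_'e_0 F _) => y1 y2 y3.
  by field.
apply: le_trans (tmD.1 _ _) _; rewrite ler_wpM2l ?(ltW D0)//.
rewrite [_ + _ *: _]addrC addrK normrZ normrM (ger0_norm s0).
rewrite -[leRHS]mulr1; apply: ler_pM; rewrite ?mulr_ge0//.
  by rewrite ler_piMl.
apply: norm_le_coord => // k; rewrite !mxE eqxx /=.
by case: eqP; rewrite ?normr1 ?normr0.
Qed.

(** In the outermost variable this is the fundamental theorem of calculus on an
    interval beyond the support; the other variables belong to the inner
    integrals. *)
Lemma iterated_integral_partial d (F : 'rV[R]_d -> R) i : testfun F ->
  iterated_integral ('D_(delta_mx 0 i) F) = 0.
Proof.
elim: d F i => [|d IH] F i tF; first by case: i.
rewrite iterated_integralS.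
case: (unliftP ord0 i) => [j|] ->.
  transitivity (\int[lebesgue_measure]_(t in [set: R]) (cst 0 t : R)).
    by apply: eq_Rintegral => t _; rewrite slice_partial IH //; exact: testfun_slice.
  by rewrite Rintegral_cst //= mul0r.
have [_ [K HK]] := tF; have [_ [L HL]] := testfun_partial 0 tF.
pose N := Num.max (Num.max K L) 1.
have [NK NL N1] : [/\ K <= N, L <= N & 1 <= N] by rewrite /N !le_max !lexx !orbT.
have z G P : P <= N -> (forall u, P < `|u| -> G u = 0) ->
    forall t, N < `|t| -> iterated_integral (slice t G : 'rV[R]_d -> R) = 0.
  move=> PN GP t Nt; rewrite (_ : slice t G = fun=> 0) ?iterated_integral0//.
  apply/funext => v; apply: GP; apply: le_lt_trans PN _.
  by apply: lt_le_trans Nt (norm_join_fst _ _).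
have NM : N <= N + 1 by rewrite lerDl.
have M0 : - (N + 1) < N + 1 by lra.
rewrite (Rintegral_supp (K := N + 1)); last first.
  by move=> t Nt; apply: (z _ _ NL HL); exact: le_lt_trans Nt.
have cD : continuous (fun t => iterated_integral (slice t ('D_(delta_mx 0 0) F))).
  move=> t; apply/differentiable_continuous/derivable1_diffP.
  by have [] := slice_integral_derive t (testfun_partial 0 tF).
rewrite (segment_integral_FTC M0 cD (fun t => slice_integral_derive t tF)).
by rewrite !(z _ _ NK HK) ?subrr// ?normrN ger0_norm; lra.
Qed.

Lemma iterated_integral_gt0 d (F : 'rV[R]_d -> R) u0 : testfun F ->
  (forall u, 0 <= F u) -> 0 < F u0 -> 0 < iterated_integral F.
Proof.
elim: d F u0 => [|d IH] F u0 tF F0 Fu0.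
  by rewrite /= (_ : 0 = u0) //; apply/rowP => -[].
rewrite iterated_integralS; have [_ [K HK]] := tF.
apply: (@Rintegral_gt0 _ _ K (u0 0 0)).
- move=> t; apply/differentiable_continuous/derivable1_diffP.
  by have [] := slice_integral_derive t tF.
- move=> t Kt; rewrite (_ : slice t F = fun=> 0) ?iterated_integral0//.
  by apply/funext => v; apply: HK; apply: lt_le_trans Kt (norm_join_fst _ _).
- by move=> t; apply: iterated_integral_ge0 => v; exact: F0.
- apply: (IH _ (\row_j u0 0 (lift ord0 j))); first exact: testfun_slice.
    by move=> v; exact: F0.
  by rewrite /slice -join_surj.
Qed.

End IteratedIntegral.

(** * Smooth functions on a manifold *)

Lemma nbhs_open_sub (T : topologicalType) (u : T) (P : set T) :
  nbhs u P -> exists2 W, open_nbhs u W & W `<=` P.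
Proof. by rewrite nbhsE. Qed.

Lemma near_all (T : topologicalType) (u : T) (P : T -> Prop) :
  (forall w, P w) -> \forall w \near u, P w.
Proof. by move=> H; exact: nearW. Qed.

Lemma smooth_on_local (R : realType) (d : nat) (Omega : set 'rV[R]_d) (f : 'rV[R]_d -> R) :
  (forall u, Omega u -> exists W h, [/\ open W, W u, smooth_on W h &
     \forall w \near u, f w = h w]) -> smooth_on Omega f.
Proof.
move=> H s u /H [W [h [oW Wu sh fh]]].
have [W' /= [oW' W'u] W'fh] := nbhs_open_sub fh.
have oWW : open (W `&` W') by exact: openI.
suff : smooth_on (W `&` W') f by apply.
apply: (smooth_on_ext oWW (f := h)); first by move=> w [_ /W'fh].
by apply: smooth_on_sub sh => w [].
Qed.

Section Cutoff.
Context {R : realType} {d : nat} (a : 'rV[R]_d) (e : R).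

Definition cut_off_ball (G : 'rV[R]_d -> R) (u : 'rV[R]_d) : R :=
  if `|u - a| <= e then G u else 0.

Lemma near_outside_ball u : e < `|u - a| -> \forall w \near u, e < `|w - a|.
Proof.
move=> eu; apply/(@nbhs_ballP R 'rV[R]_d); exists (`|u - a| - e); first by rewrite /= subr_gt0.
move=> w; rewrite -ball_normE /= ltrBrDr -ltrBrDl => H; apply: lt_le_trans H _.
rewrite lerBlDr [leRHS]addrC; apply: le_trans (ler_normD _ _).
by rewrite addrA subrK.
Qed.

Lemma testfun_cut_off (Omega : set 'rV[R]_d) G : open Omega ->
  (forall u, `|u - a| <= e -> Omega u) -> smooth_on Omega G ->
  (forall u, e <= `|u - a| -> G u = 0) -> testfun (cut_off_ball G).
Proof.
move=> oO ballO sG G0; split; last first.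
  exists (e + `|a|) => u; rewrite /cut_off_ball; case: ifP => // H.
  rewrite -{1}[u](subrK a) => /lt_le_trans /(_ (ler_normD _ _)); rewrite ltrD2r.
  by rewrite ltNge H.
apply: smooth_on_local => u _; have [H|H] := lerP `|u - a| e.
  exists Omega, G; split => //; first exact: ballO.
  apply: near_all => w; rewrite /cut_off_ball; case: lerP => // /ltW.
  by move=> /G0.
exists setT, (cst 0); split => //; [exact: openT|exact: smooth_on_cst|].
by apply: filterS (near_outside_ball H) => w ew; rewrite /cut_off_ball leNgt ew.
Qed.

End Cutoff.

Section SmoothFunctions.
Context {R : realType} {d : nat} {M : manifold R d}.
Implicit Types (f h : M -> R) (c : chart R d M).

Definition cod c : set 'rV[R]_d := chart_map c @` chart_dom c.

Lemma cod_open c : open (cod c). Proof. exact: chart_cod_open. Qed.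

Lemma cod_map c x : chart_dom c x -> cod c (chart_map c x).
Proof. by move=> cx; exists x. Qed.

Lemma cod_inv_dom c u : cod c u -> chart_dom c (chart_inv c u).
Proof. by move=> [x cx <-]; rewrite chart_mapK. Qed.

Lemma cod_invK c u : cod c u -> chart_map c (chart_inv c u) = u.
Proof. by move=> [x cx <-]; rewrite chart_mapK. Qed.

Lemma near_chart_inv c u (P : M -> Prop) : cod c u ->
  (\forall y \near chart_inv c u, P y) -> \forall w \near u, P (chart_inv c w).
Proof. by move=> cu; exact: chart_inv_continuous. Qed.

Lemma near_chart_map c x (P : 'rV[R]_d -> Prop) : chart_dom c x ->
  (\forall u \near chart_map c x, P u) -> \forall y \near x, P (chart_map c y).
Proof. by move=> cx; exact: chart_map_continuous. Qed.

Lemma near_chart_dom c x : chart_dom c x -> \forall y \near x, chart_dom c y.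
Proof. by move=> cx; apply: open_nbhs_nbhs; split => //; exact: chart_dom_open. Qed.

Lemma smooth_chart f c : smooth f -> atlas c -> smooth_on (cod c) (f \o chart_inv c).
Proof. by move=> sf ac; exact: sf. Qed.

(** Germs are represented by global functions, since tangent vectors act on these
    only. *)
Definition smooth_at f (x : M) := exists2 h, smooth h & \forall y \near x, f y = h y.

Lemma smooth_local f : (forall x, smooth_at f x) -> smooth f.
Proof.
move=> H c ac; apply: smooth_on_local => u cu.
have [h sh fh] := H (chart_inv c u).
exists (cod c), (h \o chart_inv c); split => //; [exact: cod_open | exact: sh|].
exact: near_chart_inv fh.
Qed.

Lemma smooth_ext f h : (forall x, f x = h x) -> smooth f -> smooth h.
Proof. by move=> /funext ->. Qed.

Lemma smooth_cst (a : R) : smooth (fun _ : M => a).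
Proof. by move=> c _; exact: (smooth_on_cst a). Qed.

Lemma smoothD f h : smooth f -> smooth h -> smooth (fun x => f x + h x).
Proof. by move=> sf sh c ac; refine (smooth_onD (@cod_open c) (sf c ac) (sh c ac)). Qed.

Lemma smoothM f h : smooth f -> smooth h -> smooth (fun x => f x * h x).
Proof. by move=> sf sh c ac; refine (smooth_onM (@cod_open c) (sf c ac) (sh c ac)). Qed.

Lemma smoothZ (a : R) f : smooth f -> smooth (fun x => a * f x).
Proof. by move=> sf; apply: smoothM => //; exact: smooth_cst. Qed.

Lemma smoothN f : smooth f -> smooth (fun x => - f x).
Proof. by move=> sf; apply: smooth_ext (smoothZ (-1) sf) => x; rewrite mulN1r. Qed.

Lemma smoothB f h : smooth f -> smooth h -> smooth (fun x => f x - h x).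
Proof. by move=> sf sh; exact: smoothD sf (smoothN sh). Qed.

Lemma smooth_sum (I : finType) (f : I -> M -> R) :
  (forall i, smooth (f i)) -> smooth (fun x => \sum_i f i x).
Proof.
move=> sf c ac; refine (smooth_on_sum (@cod_open c) (f := fun i => f i \o chart_inv c) _).
by move=> i; exact: sf.
Qed.

Lemma smooth_prod (I : finType) (f : I -> M -> R) :
  (forall i, smooth (f i)) -> smooth (fun x => \prod_i f i x).
Proof.
move=> sf; elim: (index_enum I) => [|i s IH].
  by apply: smooth_ext (smooth_cst 1) => x; rewrite big_nil.
by apply: smooth_ext (smoothM (sf i) IH) => x; rewrite big_cons.
Qed.

Lemma smooth_det n (A : M -> 'M[R]_n) :
  (forall i j, smooth (fun x => A x i j)) -> smooth (fun x => \det (A x)).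
Proof.
move=> sA; apply: smooth_sum => s; apply: smoothZ; apply: smooth_prod => i.
exact: sA.
Qed.

Lemma smooth_continuous f : smooth f -> continuous f.
Proof.
move=> sf x; have [c ac cx] := atlas_cover x.
have E : \forall y \near x, (f \o chart_inv c) (chart_map c y) = f y.
  by apply: filterS (near_chart_dom cx) => y cy /=; rewrite chart_mapK.
apply: near_eq_continuous E _.
apply: (@continuous_comp _ _ _ (chart_map c) (f \o chart_inv c)).
  exact: chart_map_continuous.
exact: smooth_on_continuous (sf c ac) (cod_map cx).
Qed.

(** Meant for functions G which vanish from the sphere of radius e on, so that
    the extension by zero is smooth. *)
Definition glue c (a : 'rV[R]_d) (e : R) (G : 'rV[R]_d -> R) (x : M) : R :=
  if `[< chart_dom c x >] && (`|chart_map c x - a| <= e) then G (chart_map c x) else 0.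

Definition chart_ball c (a : 'rV[R]_d) (e : R) : set M :=
  [set x | chart_dom c x /\ `|chart_map c x - a| <= e].

Lemma compact_chart_ball c a e : (forall u, `|u - a| <= e -> cod c u) ->
  compact (chart_ball c a e).
Proof.
move=> ballc.
pose A : set 'rV[R]_d := [set u | `|u - a| <= e].
have cA : compact A.
  apply: bounded_closed_compact.
    exists (e + `|a|); split; first exact: num_real.
    move=> x Kx u Au; apply: le_trans (ltW Kx); rewrite -{1}[u](subrK a).
    by apply: le_trans (ler_normD _ _) _; rewrite lerD2r.
  apply: (@closed_comp _ _ (fun u : 'rV[R]_d => `|u - a|) [set x | x <= e]); last exact: closed_le.
  move=> u _; apply: (@continuous_comp _ _ _ (fun u : 'rV[R]_d => u - a) (fun u => `|u|)).
    by apply: continuousD; [exact: cvg_id|exact: cst_continuous].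
  exact: norm_continuous.
have -> : chart_ball c a e = chart_inv c @` A.
  apply/seteqP; split => [x [cx H]|_ [u Au <-]].
    by exists (chart_map c x) => //; exact: chart_mapK.
  by split; rewrite ?cod_invK; [exact/cod_inv_dom/ballc| exact: Au|exact: ballc].
apply: continuous_compact cA; apply: continuous_in_subspaceT => u.
by rewrite inE => /ballc; exact: chart_inv_continuous.
Qed.

Lemma near_chart_ball c a e x : (forall u, `|u - a| <= e -> cod c u) ->
  ~ chart_ball c a e x -> \forall y \near x, ~ chart_ball c a e y.
Proof.
move=> /compact_chart_ball cK Kx.
have clK := compact_closed (@manifold_hausdorff _ _ M) cK.
by apply: open_nbhs_nbhs; split => //; exact: closed_openC.
Qed.

Lemma glue_out c a e G x : ~ chart_ball c a e x -> glue c a e G x = 0.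
Proof. by rewrite /glue; case: ifP => // /andP[/asboolP ? ?] []; split. Qed.

Lemma glue_in c a e G x : chart_dom c x ->
  (forall u, cod c u -> e <= `|u - a| -> G u = 0) -> glue c a e G x = G (chart_map c x).
Proof.
move=> cx G0; rewrite /glue asboolT //=; case: lerP => // /ltW.
by move=> /(G0 _ (cod_map cx)).
Qed.

(** The closed ball of the chart is compact, hence closed in the manifold, so
    that the glued function vanishes near the points outside of it. *)
Lemma smooth_glue c a e G (Omega : set 'rV[R]_d) : atlas c -> open Omega ->
  Omega `<=` cod c -> (forall u, `|u - a| <= e -> Omega u) ->
  smooth_on Omega G -> (forall u, cod c u -> e <= `|u - a| -> G u = 0) -> smooth (glue c a e G).
Proof.
move=> ac oO Oc ballO sG G0 c' ac'; apply: smooth_on_local => u' cu'.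
have ballc u : `|u - a| <= e -> cod c u by move=> /ballO /Oc.
have [[cx xe]|H] := pselect (chart_ball c a e (chart_inv c' u')); last first.
  exists setT, (cst 0); split => //; [exact: openT|exact: smooth_on_cst|].
  by apply: filterS (near_chart_inv cu' (near_chart_ball ballc H)) => w /= /glue_out ->.
pose W : set 'rV[R]_d := [set w | cod c' w /\ chart_dom c (chart_inv c' w) /\
   Omega (chart_map c (chart_inv c' w))].
have oW : open W.
  rewrite openE => w [cw [dw Ow]]; apply: filterI.
    by apply: open_nbhs_nbhs; split => //; exact: cod_open.
  apply: (near_chart_inv (P := fun y => chart_dom c y /\ Omega (chart_map c y)) cw).
  apply: filterI; first exact: near_chart_dom.
  by apply: (near_chart_map dw); exact: open_nbhs_nbhs.
exists W, (fun w => G (\row_j chart_map c (chart_inv c' w) 0 j)); split => //.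
- by split => //; split => //; exact: ballO.
- apply: (smooth_on_comp oW oO) => //.
    move=> w [_ [_]]; rewrite (_ : \row_j _ = chart_map c (chart_inv c' w)) //.
    by apply/rowP => j; rewrite mxE.
  move=> j; apply: smooth_on_sub (atlas_compatible ac' ac j) => w [cw [dw _]].
  by exists (chart_inv c' w); [split => //; exact: cod_inv_dom | exact: cod_invK].
apply: filterS (near_chart_inv cu' (near_chart_dom cx)) => w dw /=.
by rewrite glue_in //; congr G; apply/rowP => j; rewrite mxE.
Qed.

Lemma chart_ball_exists c x (N : set M) : chart_dom c x -> nbhs x N ->
  exists2 e, 0 < e & forall u, `|u - chart_map c x| <= e -> cod c u /\ N (chart_inv c u).
Proof.
move=> cx Nx.
have nN : \forall u \near chart_map c x, cod c u /\ N (chart_inv c u).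
  apply: filterI; first by apply: open_nbhs_nbhs; split; [exact: cod_open|exact: cod_map].
  by apply: near_chart_inv; [exact: cod_map|rewrite chart_mapK].
have [r /= r0 Hr] := (@nbhs_ballP R 'rV[R]_d (chart_map c x) _).1 nN.
exists (r / 2); first by rewrite divr_gt0.
move=> u ur; apply: Hr; rewrite -ball_normE /= distrC; apply: le_lt_trans ur _.
by rewrite ltr_pdivrMr// ltr_pMr// ltr1n.
Qed.

(** A function which is smooth in a chart near a point extends, after
    multiplication by a plateau, to the whole manifold. *)
Lemma smooth_at_chart c x f (Omega : set 'rV[R]_d) : atlas c -> chart_dom c x ->
  open Omega -> Omega (chart_map c x) -> smooth_on Omega (f \o chart_inv c) -> smooth_at f x.
Proof.
move=> ac cx oO Ox sf; set a := chart_map c x.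
have [|e e0 He] := chart_ball_exists (N := [set y | Omega (chart_map c y)]) cx.
  by apply: (near_chart_map cx); exact: open_nbhs_nbhs.
have [B [sB B0 [r r0 Br] Be]] := bump_exists a e0.
have oOc : open (Omega `&` cod c) by apply: openI => //; exact: cod_open.
exists (glue c a e (fun u => B u * (f \o chart_inv c) u)).
  apply: (@smooth_glue c a e _ (Omega `&` cod c)) => //.
  - by move=> u /He [cu]; rewrite /= cod_invK.
  - apply: smooth_onM => //; first exact: smooth_on_sub (fun _ _ => I) sB.
    by apply: smooth_on_sub sf => u [].
  - by move=> u cu /Be ->; rewrite mul0r.
have nr : \forall u \near a, `|u - a| < r.
  apply/(@nbhs_ballP R 'rV[R]_d); exists r => // u.
  by rewrite -ball_normE /= distrC.
apply: filterS2 (near_chart_dom cx) (near_chart_map cx nr) => y cy yr.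
rewrite glue_in //; last by move=> u _ /Be ->; rewrite mul0r.
by rewrite Br // mul1r /= chart_mapK.
Qed.

Lemma cutoff (x : M) (N : set M) : nbhs x N -> exists chi : M -> R,
  [/\ smooth chi, forall y, 0 <= chi y, \forall y \near (x : M), chi y = 1 &
      forall y, ~ N y -> chi y = 0].
Proof.
move=> Nx; have [c ac cx] := atlas_cover x; set a := chart_map c x.
have [e e0 He] := chart_ball_exists cx Nx.
have [B [sB B0 [r r0 Br] Be]] := bump_exists a e0.
exists (glue c a e B); split.
- apply: (@smooth_glue c a e _ (cod c)) => //; first exact: cod_open.
  + by move=> u /He [].
  + exact: smooth_on_sub (fun _ _ => I) sB.
  + by move=> u _; exact: Be.
- by move=> y; rewrite /glue; case: ifP.
- have nr : \forall u \near a, `|u - a| < r.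
    apply/(@nbhs_ballP R 'rV[R]_d); exists r => // u.
    by rewrite -ball_normE /= distrC.
  apply: filterS2 (near_chart_dom cx) (near_chart_map cx nr) => y cy yr.
  by rewrite glue_in ?Br // => u _; exact: Be.
- move=> y Ny; apply: glue_out => -[cy yr]; apply: Ny.
  by have [_] := He _ yr; rewrite chart_mapK.
Qed.

Lemma smooth_at_comp k (B : set 'rV[R]_k) (phi : 'rV[R]_k -> R) (q : 'I_k -> M -> R) x :
  open B -> smooth_on B phi -> (forall j, smooth (q j)) -> B (\row_j q j x) ->
  smooth_at (fun y => phi (\row_j q j y)) x.
Proof.
move=> oB sphi sq Bx; have [c ac cx] := atlas_cover x.
pose W : set 'rV[R]_d := [set w | cod c w /\ B (\row_j q j (chart_inv c w))].
have cq u : cod c u -> {for u, continuous (fun w => \row_j (q j \o chart_inv c) w)}.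
  by move=> cu; apply: continuous_row => j; exact: smooth_on_continuous (sq j c ac) cu.
have oW : open W.
  rewrite openE => w [cw Bw]; apply: filterI.
    by apply: open_nbhs_nbhs; split => //; exact: cod_open.
  by apply: (cq w cw); exact: open_nbhs_nbhs.
apply: (smooth_at_chart ac cx oW).
  by split; [exact: cod_map | rewrite chart_mapK].
apply: (smooth_on_comp oW oB) => //; first by move=> u [].
by move=> j; apply: smooth_on_sub (sq j c ac) => u [].
Qed.

Lemma smooth_at_comp1 (U : set R) (p : R -> R) f x : open U ->
  smooth_on [set w : 'rV[R]_1 | U (w 0 0)] (fun w => p (w 0 0)) ->
  smooth f -> U (f x) -> smooth_at (fun y => p (f y)) x.
Proof.
move=> oU sp sf Ux.
have [|h sh E] := @smooth_at_comp 1 [set w : 'rV[R]_1 | U (w 0 0)] (fun w => p (w 0 0)) (fun _ => f) x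
  (open_lift oU) sp (fun _ => sf); first by rewrite /= mxE.
by exists h => //; apply: filterS E => y; rewrite mxE.
Qed.

Lemma smooth_atV f x : smooth f -> f x != 0 -> smooth_at (fun y => (f y)^-1) x.
Proof.
by move=> sf fx; apply: (smooth_at_comp1 (@open_neq R 0)) => //; exact: smooth_on_inv.
Qed.

Lemma smooth_at_sqrt f x : smooth f -> 0 < f x -> smooth_at (fun y => Num.sqrt (f y)) x.
Proof.
by move=> sf fx; apply: (smooth_at_comp1 (@open_gt R 0)) => //; exact: smooth_on_sqrt.
Qed.

End SmoothFunctions.

(** * Tangent vectors and vector fields *)

Local Opaque smooth.

(** Smoothness, tangency and being a vector field, sealed in singleton variants.
    Their unfoldings involve iterated derivatives; the seal keeps unification
    from comparing these when it should merely fail. *)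
Section Seals.
Context {R : realType} {d : nat} {M : manifold R d}.
Implicit Types (f h : M -> R).

Variant Smooth f : Prop := SmoothI of smooth f.
Variant Tangent (x : M) (v : (M -> R) -> R) : Prop := TangentI of tangent x v.
Variant VField (X : vfield M) : Prop := VFieldI of is_vfield X.

Lemma Smooth_cst (a : R) : Smooth (fun _ : M => a).
Proof. exact: SmoothI (smooth_cst a). Qed.

Lemma SmoothD f h : Smooth f -> Smooth h -> Smooth (fun x => f x + h x).
Proof. by move=> [sf] [sh]; exact: SmoothI (smoothD sf sh). Qed.

Lemma SmoothM f h : Smooth f -> Smooth h -> Smooth (fun x => f x * h x).
Proof. by move=> [sf] [sh]; exact: SmoothI (smoothM sf sh). Qed.

Lemma SmoothZ a f : Smooth f -> Smooth (fun x => a * f x).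
Proof. by move=> [sf]; exact: SmoothI (smoothZ a sf). Qed.

Lemma SmoothN f : Smooth f -> Smooth (fun x => - f x).
Proof. by move=> [sf]; exact: SmoothI (smoothN sf). Qed.

Lemma SmoothB f h : Smooth f -> Smooth h -> Smooth (fun x => f x - h x).
Proof. by move=> [sf] [sh]; exact: SmoothI (smoothB sf sh). Qed.

Lemma Smooth_sum (I : finType) (f : I -> M -> R) :
  (forall i, Smooth (f i)) -> Smooth (fun x => \sum_i f i x).
Proof.
by move=> sf; constructor; apply: smooth_sum => i; have [] := sf i.
Qed.

Lemma Smooth_det n (A : M -> 'M[R]_n) :
  (forall i j, Smooth (fun x => A x i j)) -> Smooth (fun x => \det (A x)).
Proof.
by move=> sA; constructor; apply: smooth_det => i j; have [] := sA i j.
Qed.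

Lemma Smooth_ext f h : (forall x, f x = h x) -> Smooth f -> Smooth h.
Proof. by move=> /funext ->. Qed.

Lemma Smooth_local f :
  (forall x, exists2 h, Smooth h & \forall y \near (x : M), f y = h y) -> Smooth f.
Proof.
move=> H; constructor; apply: smooth_local => x.
by have [h [sh] E] := H x; exists h.
Qed.

Lemma Smooth_atV f (x : M) : Smooth f -> f x != 0 ->
  exists2 h, Smooth h & \forall y \near x, (f y)^-1 = h y.
Proof.
by move=> [sf] /(smooth_atV sf) [h sh E]; exists h => //; constructor.
Qed.

Lemma Smooth_at_sqrt f (x : M) : Smooth f -> 0 < f x ->
  exists2 h, Smooth h & \forall y \near x, Num.sqrt (f y) = h y.
Proof.
by move=> [sf] /(smooth_at_sqrt sf) [h sh E]; exists h => //; constructor.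
Qed.

Lemma Smooth_at_comp k (B : set 'rV[R]_k) (phi : 'rV[R]_k -> R) (q : 'I_k -> M -> R) (x : M) :
  open B -> smooth_on B phi -> (forall j, Smooth (q j)) -> B (\row_j q j x) ->
  exists2 h, Smooth h & \forall y \near x, phi (\row_j q j y) = h y.
Proof.
move=> oB sphi sq Bx.
have [|h sh E] := smooth_at_comp oB sphi _ Bx; first by move=> j; have [] := sq j.
by exists h => //; constructor.
Qed.

Lemma Smooth_chart f c : Smooth f -> atlas c -> smooth_on (cod c) (f \o chart_inv c).
Proof. by move=> [sf]; exact: smooth_chart. Qed.

Lemma Smooth_glue c a e G (Omega : set 'rV[R]_d) : atlas c -> open Omega ->
  Omega `<=` cod c -> (forall u, `|u - a| <= e -> Omega u) ->
  smooth_on Omega G -> (forall u, cod c u -> e <= `|u - a| -> G u = 0) ->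
  Smooth (glue (M := M) c a e G).
Proof. by move=> *; constructor; exact: (@smooth_glue _ _ _ _ _ _ _ Omega). Qed.

Lemma Cutoff (x : M) (N : set M) : nbhs x N -> exists chi : M -> R,
  [/\ Smooth chi, forall y, 0 <= chi y, \forall y \near (x : M), chi y = 1 &
      forall y, ~ N y -> chi y = 0].
Proof.
by move=> /cutoff [chi [s c0 c1 cN]]; exists chi; split => //; constructor.
Qed.

End Seals.

Section Tangent.
Context {R : realType} {d : nat} {M : manifold R d}.
Implicit Types (f h : M -> R) (x : M) (u v w : (M -> R) -> R).

Lemma tangent_lin x v (a : R) f h : Tangent x v -> Smooth f -> Smooth h ->
  v (fun y => a * f y + h y) = a * v f + v h.
Proof. by move=> [[_ H _]] [sf] [sh]; exact: H. Qed.

Lemma tangentM x v f h : Tangent x v -> Smooth f -> Smooth h ->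
  v (fun y => f y * h y) = f x * v h + h x * v f.
Proof. by move=> [[_ _ H]] [sf] [sh]; exact: H. Qed.

Lemma tangentD x v f h : Tangent x v -> Smooth f -> Smooth h ->
  v (fun y => f y + h y) = v f + v h.
Proof.
move=> tv sf sh; rewrite -[v f]mul1r -(tangent_lin 1 tv sf sh).
by congr v; apply/funext => y; rewrite mul1r.
Qed.

Lemma tangent_cst x v (a : R) : Tangent x v -> v (fun _ => a) = 0.
Proof.
move=> tv; have s1 := @Smooth_cst R d M.
have v1 : v (fun _ => 1) = 0.
  have := tangentM tv (s1 1) (s1 1).
  have -> : (fun y : M => 1 * 1 : R) = fun _ => 1 by apply/funext => y; rewrite mul1r.
  lra.
have v0 : v (fun _ => 0) = 0.
  have := tangentD tv (s1 0) (s1 0).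
  have -> : (fun y : M => 0 + 0 : R) = fun _ => 0 by apply/funext => y; rewrite addr0.
  lra.
have E := tangent_lin a tv (s1 1) (s1 0).
rewrite v1 v0 in E; rewrite -[RHS](mulr0 a) -[RHS]addr0 -E.
by congr v; apply/funext => y; rewrite mulr1 addr0.
Qed.

Lemma tangentZ x v (a : R) f : Tangent x v -> Smooth f -> v (fun y => a * f y) = a * v f.
Proof.
move=> tv sf; rewrite -[RHS]addr0 -(tangent_cst 0 tv) -(tangent_lin a tv sf (@Smooth_cst _ _ _ 0)).
by congr v; apply/funext => y; rewrite addr0.
Qed.

Lemma tangentN x v f : Tangent x v -> Smooth f -> v (fun y => - f y) = - v f.
Proof.
move=> tv sf; rewrite -mulN1r -(tangentZ _ tv sf).
by congr v; apply/funext => y; rewrite mulN1r.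
Qed.

Lemma tangentB x v f h : Tangent x v -> Smooth f -> Smooth h ->
  v (fun y => f y - h y) = v f - v h.
Proof.
by move=> tv sf sh; rewrite (tangentD tv sf (SmoothN sh)) (tangentN tv sh).
Qed.

Lemma tangent_sum x v (I : finType) (f : I -> M -> R) : Tangent x v ->
  (forall i, Smooth (f i)) -> v (fun y => \sum_i f i y) = \sum_i v (f i).
Proof.
move=> tv sf; pose s := index_enum I; rewrite -/s.
suff : Smooth (fun y => \sum_(i <- s) f i y) /\ v (fun y => \sum_(i <- s) f i y) = \sum_(i <- s) v (f i) by case.
elim: s => [|i s [IH1 IH2]].
  rewrite big_nil (_ : (fun y => _) = fun _ => 0).
    by split; [exact: Smooth_cst | exact: tangent_cst tv].
  by apply/funext => y; rewrite big_nil.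
have E : (fun y => \sum_(j <- i :: s) f j y) = fun y => f i y + \sum_(j <- s) f j y.
  by apply/funext => y; rewrite big_cons.
rewrite E big_cons -IH2; split; [exact: SmoothD (sf i) IH1 | exact: tangentD tv (sf i) IH1].
Qed.

(** With a cutoff chi supported where f = h, the function (f - h) * chi is zero
    and the Leibniz rule gives v (f - h) = 0. *)
Lemma tangent_local x v f h : Tangent x v -> Smooth f -> Smooth h ->
  (\forall y \near x, f y = h y) -> v f = v h.
Proof.
move=> tv sf sh fh; apply/eqP; rewrite -subr_eq0 -(tangentB tv sf sh); apply/eqP.
have [chi [schi _ chi1 chi0]] := Cutoff fh.
have := tangentM tv (SmoothB sf sh) schi.
rewrite (nbhs_singleton fh) subrr mul0r add0r (nbhs_singleton chi1) mul1r => <-.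
rewrite (_ : (fun y => _) = fun _ => 0); first exact: tangent_cst tv.
apply/funext => y; have [H|H] := pselect (f y = h y); first by rewrite H subrr mul0r.
by rewrite chi0 // mulr0.
Qed.

Lemma tangent_zero x : Tangent x (fun _ : M -> R => 0).
Proof. by constructor; split => *; rewrite ?mulr0 ?addr0. Qed.

Lemma tangent_comb x a u v : Tangent x u -> Tangent x v -> Tangent x (fun f => a * u f + v f).
Proof.
move=> [[u1 u2 u3]] [[v1 v2 v3]]; constructor; split => [f nf|b f h sf sh|f h sf sh].
- by rewrite u1 // v1 // mulr0 addr0.
- by rewrite u2 // v2 //; ring.
- by rewrite u3 // v3 //; ring.
Qed.

Lemma tangent_add x u v : Tangent x u -> Tangent x v -> Tangent x (fun f => u f + v f).
Proof.
by move=> tu tv; have := tangent_comb 1 tu tv; under eq_fun do rewrite mul1r.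
Qed.

Lemma tangent_scale x a u : Tangent x u -> Tangent x (fun f => a * u f).
Proof.
by move=> tu; have := tangent_comb a tu (tangent_zero x); under eq_fun do rewrite addr0.
Qed.

Lemma tangent_opp x u : Tangent x u -> Tangent x (fun f => - u f).
Proof.
by move=> tu; have := tangent_scale (-1) tu; under eq_fun do rewrite mulN1r.
Qed.

Lemma tangent_sub x u v : Tangent x u -> Tangent x v -> Tangent x (fun f => u f - v f).
Proof. by move=> tu /tangent_opp; exact: tangent_add. Qed.

Lemma tangent_sumv x (I : finType) (u : I -> (M -> R) -> R) :
  (forall i, Tangent x (u i)) -> Tangent x (fun f => \sum_i u i f).
Proof.
move=> tu; elim: (index_enum I) => [|i s IH].
  by have := tangent_zero x; under [X in _ -> Tangent _ X]eq_fun do rewrite big_nil.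
by have := tangent_add (tu i) IH; under [X in _ -> Tangent _ X]eq_fun do rewrite big_cons.
Qed.

Lemma tangent_eq x u v : Tangent x u -> Tangent x v ->
  (forall f, Smooth f -> u f = v f) -> u = v.
Proof.
move=> [[u1 _ _]] [[v1 _ _]] H; apply/funext => f.
by have [sf|nf] := pselect (smooth f); [exact: H (SmoothI sf) | rewrite u1 // v1].
Qed.

End Tangent.

Section VectorFields.
Context {R : realType} {d : nat} {M : manifold R d}.
Implicit Types (f h : M -> R) (X Y : vfield M).

Lemma vfieldI X : (forall x, Tangent x (X x)) ->
  (forall f, Smooth f -> Smooth (fun x => X x f)) -> VField X.
Proof.
move=> tX sX; constructor; split => [x|f sf]; first by have [] := tX x.
by have [] := sX f (SmoothI sf).
Qed.

Lemma vfield_tangent X x : VField X -> Tangent x (X x).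
Proof. by move=> [[tX _]]; constructor. Qed.

Lemma vfield_smooth X f : VField X -> Smooth f -> Smooth (fun x => X x f).
Proof. by move=> [[_ sX]] [sf]; constructor; exact: sX. Qed.

Lemma vfield_zero : VField (fun (_ : M) (_ : M -> R) => 0 : R).
Proof. by apply: vfieldI => [x|f _]; [exact: tangent_zero|exact: Smooth_cst]. Qed.

Lemma vfieldD X Y : VField X -> VField Y -> VField (vadd X Y).
Proof.
move=> vX vY; apply: vfieldI => [x|f sf].
  exact: tangent_add (vfield_tangent x vX) (vfield_tangent x vY).
exact: SmoothD (vfield_smooth vX sf) (vfield_smooth vY sf).
Qed.

Lemma vfieldZ h X : Smooth h -> VField X -> VField (vscale h X).
Proof.
move=> sh vX; apply: vfieldI => [x|f sf]; first exact: tangent_scale (vfield_tangent x vX).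
exact: SmoothM sh (vfield_smooth vX sf).
Qed.

Lemma vfieldN X : VField X -> VField (vopp X).
Proof.
move=> vX; apply: vfieldI => [x|f sf]; first exact: tangent_opp (vfield_tangent x vX).
exact: SmoothN (vfield_smooth vX sf).
Qed.

Lemma vfieldB X Y : VField X -> VField Y -> VField (vsub X Y).
Proof. by move=> vX vY; exact: vfieldD vX (vfieldN vY). Qed.

Lemma vfield_sum k (X : 'I_k -> vfield M) : (forall i, VField (X i)) -> VField (vsum X).
Proof.
move=> vX; apply: vfieldI => [x|f sf]; first by apply: tangent_sumv => i; exact: vfield_tangent.
by apply: Smooth_sum => i; exact: vfield_smooth (vX i) sf.
Qed.

Lemma vfield_bracket X Y : VField X -> VField Y -> VField (bracket X Y).
Proof.
move=> vX vY; apply: vfieldI => [x|f sf]; last first.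
  exact: SmoothB (vfield_smooth vX (vfield_smooth vY sf)) (vfield_smooth vY (vfield_smooth vX sf)).
have tX := vfield_tangent x vX; have tY := vfield_tangent x vY.
constructor; split => [f nf|a f h /SmoothI sf /SmoothI sh|f h /SmoothI sf /SmoothI sh]; rewrite /bracket.
- have zero Z : VField Z -> (fun y => Z y f) = (fun=> 0).
    by move=> [[Z1 _]]; apply/funext => y; have [-> ] := Z1 y.
  by rewrite !zero // (tangent_cst 0 tX) (tangent_cst 0 tY) subrr.
- have E Z : VField Z -> (fun y => Z y (fun z => a * f z + h z)) =
     (fun y => a * Z y f + Z y h).
    by move=> vZ; apply/funext => y; exact: tangent_lin (vfield_tangent y vZ) sf sh.
  have sX := vfield_smooth vX; have sY := vfield_smooth vY.
  rewrite (E X vX) (E Y vY) (tangent_lin _ tX (sY _ sf) (sY _ sh)).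
  by rewrite (tangent_lin _ tY (sX _ sf) (sX _ sh)); ring.
- have E Z : VField Z -> (fun y => Z y (fun z => f z * h z)) =
     (fun y => f y * Z y h + h y * Z y f).
    by move=> vZ; apply/funext => y; exact: tangentM (vfield_tangent y vZ) sf sh.
  have sX := vfield_smooth vX; have sY := vfield_smooth vY.
  rewrite (E X vX) (E Y vY).
  rewrite (tangentD tX (SmoothM sf (sY _ sh)) (SmoothM sh (sY _ sf))).
  rewrite (tangentD tY (SmoothM sf (sX _ sh)) (SmoothM sh (sX _ sf))).
  rewrite (tangentM tX sf (sY _ sh)) (tangentM tX sh (sY _ sf)).
  by rewrite (tangentM tY sf (sX _ sh)) (tangentM tY sh (sX _ sf)); ring.
Qed.

Lemma vfield_local X : (forall x, exists2 Y, VField Y & \forall y \near (x : M), X y = Y y) ->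
  VField X.
Proof.
move=> H; apply: vfieldI => [x|f sf].
  by have [Y vY /nbhs_singleton ->] := H x; exact: vfield_tangent.
apply: Smooth_local => x; have [Y vY XY] := H x.
exists (fun y => Y y f); first exact: vfield_smooth.
by apply: filterS XY => y ->.
Qed.

Lemma vadd_scale1 X Y : vadd (vscale (fun=> 1) X) Y = vadd X Y.
Proof. by apply/funext => x; apply/funext => f; rewrite /vadd /vscale mul1r. Qed.

End VectorFields.

(** * Coordinate fields *)

Section Coordinates.
Context {R : realType} {d : nat} {M : manifold R d}.
Implicit Types (f h : M -> R) (c : chart R d M).

Lemma coordinate_vectorE c i x f : Smooth f ->
  coordinate_vector c i x f = 'D_(delta_mx 0 i) (f \o chart_inv c) (chart_map c x).
Proof. by move=> [sf]; rewrite /coordinate_vector asboolT. Qed.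

Lemma coordinate_vector_tangent c i x : atlas c -> chart_dom c x ->
  Tangent x (coordinate_vector c i x).
Proof.
move=> ac cx; have cu := cod_map cx.
have df f : Smooth f -> derivable (f \o chart_inv c) (chart_map c x) (delta_mx 0 i).
  by move=> sf; apply: (smooth_on_derivable (Smooth_chart sf ac)).
constructor; split => [f nf|a f h /SmoothI sf /SmoothI sh|f h /SmoothI sf /SmoothI sh].
- by rewrite /coordinate_vector asboolF.
- rewrite !coordinate_vectorE //; last exact: SmoothD (SmoothZ a sf) sh.
  rewrite -[LHS]/('D_(delta_mx 0 i) (a *: (f \o chart_inv c) + (h \o chart_inv c)) (chart_map c x)).
  by rewrite deriveD ?deriveZ //; [exact: df| exact: derivableZ (df _ sf)|exact: df].
- rewrite !coordinate_vectorE //; last exact: SmoothM.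
  rewrite -[LHS]/('D_(delta_mx 0 i) ((f \o chart_inv c) * (h \o chart_inv c)) (chart_map c x)).
  rewrite deriveM /=; [|exact: df|exact: df].
  by rewrite chart_mapK.
Qed.

(** By Hadamard's lemma f - f x is near x the sum of the products
    (xi i - xi i x) * g i with smooth g i, on which the Leibniz rule computes v. *)
Lemma tangent_coordinates c (x : M) (xi : 'I_d -> M -> R) v f : atlas c -> chart_dom c x ->
  (forall i, Smooth (xi i)) -> (\forall y \near x, forall i, xi i y = chart_map c y 0 i) ->
  Tangent x v -> Smooth f -> v f = \sum_(i < d) v (xi i) * coordinate_vector c i x f.
Proof.
move=> ac cx sxi xiE tv sf; set a := chart_map c x.
have [e e0 He] := chart_ball_exists (N := setT) cx filterT.
have [B [sB B0 [r r0 Br] Be]] := bump_exists a e0.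
have ballc u : `|u - a| <= e -> cod c u by move=> /He [].
have oc := @cod_open _ _ _ c.
have sBc : smooth_on (cod c) B by exact: smooth_on_sub (fun _ _ => I) sB.
have nr : \forall u \near a, `|u - a| < r.
  apply/(@nbhs_ballP R 'rV[R]_d); exists r => // u.
  by rewrite -ball_normE /= distrC.
pose F := cut_off_ball a e (fun u => B u * (f \o chart_inv c) u).
have tF : testfun F.
  apply: (testfun_cut_off oc ballc (smooth_onM oc sBc (Smooth_chart sf ac))).
  by move=> u /Be ->; rewrite mul0r.
have FE : \forall u \near a, F u = (f \o chart_inv c) u.
  apply: filterS nr => u ur; rewrite /F /cut_off_ball Br // mul1r.
  by case: lerP => // /ltW /Be; rewrite Br // => /eqP; rewrite oner_eq0.
have [G HG FG] := hadamard a tF.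
pose g i := glue c a e (fun u => B u * G i u).
have sg i : Smooth (g i).
  have sG : smooth_on (cod c) (G i) := smooth_on_sub (fun _ _ => I) (HG i).1.
  apply: (Smooth_glue ac oc (@subset_refl _ _) ballc (smooth_onM oc sBc sG)).
  by move=> u _ /Be ->; rewrite mul0r.
have gE : \forall y \near x, forall i, g i y = G i (chart_map c y).
  apply: filterS2 (near_chart_dom cx) (near_chart_map cx nr) => y cy yr i.
  rewrite /g glue_in //; last by move=> u _ /Be ->; rewrite mul0r.
  by rewrite Br // mul1r.
pose h y := f x + \sum_(i < d) (xi i y - a 0 i) * g i y.
have sxa i : Smooth (fun y => xi i y - a 0 i) by apply: SmoothB => //; exact: Smooth_cst.
have sh : Smooth h.
  apply: SmoothD; first exact: Smooth_cst.
  by apply: Smooth_sum => i; exact: SmoothM.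
have fh : \forall y \near x, f y = h y.
  have H : \forall y \near x, F (chart_map c y) = (f \o chart_inv c) (chart_map c y) /\ chart_dom c y.
    exact: filterI (near_chart_map cx FE) (near_chart_dom cx).
  apply: filterS3 H xiE gE => y [Fy cy] xiy gy.
  rewrite /= chart_mapK // in Fy; rewrite -Fy FG /h; congr (_ + _).
    by rewrite (nbhs_singleton FE) /= chart_mapK.
  by apply: eq_bigr => i _; rewrite xiy gy.
rewrite (tangent_local tv sf sh fh) (tangentD tv (Smooth_cst _)); last first.
  by apply: Smooth_sum => i; exact: SmoothM.
rewrite (tangent_cst _ tv) add0r (tangent_sum tv); last by move=> i; exact: SmoothM.
apply: eq_bigr => i _; rewrite (tangentM tv) //.
rewrite (nbhs_singleton xiE) subrr mul0r add0r (tangentB tv) //; last exact: Smooth_cst.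
rewrite (tangent_cst _ tv) subr0 mulrC (nbhs_singleton gE) (HG i).2 coordinate_vectorE //.
by congr (_ * _); apply: near_eq_derive.
Qed.

(** Coordinates and coordinate vectors are multiplied by a plateau equal to 1 on
    N, in order to be defined on the whole manifold. *)
Lemma coordinates_exist (x0 : M) : exists c (xi : 'I_d -> M -> R) (K : 'I_d -> vfield M) (N : set M),
  [/\ [/\ atlas c, open N, N x0 & N `<=` chart_dom c],
      forall i, Smooth (xi i), forall i, VField (K i),
      forall y, N y -> forall i, xi i y = chart_map c y 0 i
    & forall y, N y -> forall i, K i y = coordinate_vector c i y].
Proof.
have [c ac cx] := atlas_cover x0; set a := chart_map c x0.
have [e e0 He] := chart_ball_exists (N := setT) cx filterT.
have [B [sB B0 [r r0 Br] Be]] := bump_exists a e0.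
have ballc u : `|u - a| <= e -> cod c u by move=> /He [].
have oc := @cod_open _ _ _ c.
have sBc : smooth_on (cod c) B by exact: smooth_on_sub (fun _ _ => I) sB.
have nr : \forall u \near a, `|u - a| < r.
  apply/(@nbhs_ballP R 'rV[R]_d); exists r => // u.
  by rewrite -ball_normE /= distrC.
have [N [oN Nx] HN] := nbhs_open_sub (filterI (near_chart_dom cx) (near_chart_map cx nr)).
have sglue G : smooth_on (cod c) G -> Smooth (glue c a e (fun u => B u * G u)).
  move=> sG; apply: (Smooth_glue ac oc (@subset_refl _ _) ballc (smooth_onM oc sBc sG)).
  by move=> u _ /Be ->; rewrite mul0r.
have glueE G y : N y -> glue c a e (fun u => B u * G u) y = G (chart_map c y).
  move=> /HN [cy yr]; rewrite glue_in //; last by move=> u _ /Be ->; rewrite mul0r.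
  by rewrite Br // mul1r.
have glueM G y : glue c a e (fun u => B u * G u) y = glue c a e B y * G (chart_map c y).
  by rewrite /glue; case: ifP; rewrite ?mul0r.
exists c, (fun i => glue c a e (fun u => B u * u 0 i)),
  (fun i => vscale (glue c a e B) (coordinate_vector c i)), N; split.
- by split => // y /HN [].
- by move=> i; apply: sglue; exact: smooth_on_coord oc i.
- move=> i; apply: vfieldI => [y|f sf].
    have [cy|ncy] := pselect (chart_dom c y).
      exact: tangent_scale (coordinate_vector_tangent i ac cy).
    rewrite /vscale glue_out; last by case.
    by have := tangent_zero y; under [X in _ -> Tangent _ X]eq_fun do rewrite mul0r.
  apply: Smooth_ext (sglue ('D_(delta_mx 0 i) (f \o chart_inv c)) _).
    by move=> y; rewrite glueM /vscale coordinate_vectorE.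
  by apply: smooth_on_partial; exact: Smooth_chart.
- by move=> y Ny i; rewrite glueE.
- move=> y Ny i; apply/funext => f; rewrite /vscale.
  have -> : glue c a e B y = 1.
    have [cy yr] := HN _ Ny; rewrite glue_in ?Br // => u _; exact: Be.
  by rewrite mul1r.
Qed.

Lemma coordinate_vector_inj c (x : M) (xi : 'I_d -> M -> R) i j : atlas c -> chart_dom c x ->
  (forall i, Smooth (xi i)) -> (\forall y \near x, forall i, xi i y = chart_map c y 0 i) ->
  coordinate_vector c i x (xi j) = (i == j)%:R.
Proof.
move=> ac cx sxi xiE; rewrite coordinate_vectorE //.
have E : \forall u \near chart_map c x, (xi j \o chart_inv c) u = u 0 j.
  have xiE' : \forall y \near chart_inv c (chart_map c x), forall i, xi i y = chart_map c y 0 i.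
    by rewrite chart_mapK.
  have nc : \forall u \near chart_map c x, cod c u.
    by apply: open_nbhs_nbhs; split; [exact: cod_open|exact: cod_map].
  by apply: filterS2 nc (near_chart_inv (cod_map cx) xiE') => u cu /= ->; rewrite cod_invK.
rewrite (near_eq_derive _ E).
have df := @differentiable_coord R _ _ (chart_map c x) 0 j.
have lf : linear (fun u : 'rV[R]_d => u 0 j : R) by move=> a u v; rewrite !mxE.
pose lm := GRing.isLinear.Build _ _ _ _ _ lf.
pose L : {linear 'rV[R]_d -> R} := HB.pack (fun u : 'rV[R]_d => u 0 j : R) lm.
rewrite deriveE // -[X in 'd X _]/(L : _ -> _) diff_lin /=; last exact: coord_continuous.
by rewrite mxE eqxx eq_sym.
Qed.

(** Symmetry of the second derivatives, read in the chart. *)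
Lemma bracket_coordinates c (K : 'I_d -> vfield M) (N : set M) i j (y : M) f :
  atlas c -> open N -> N `<=` chart_dom c ->
  (forall i, VField (K i)) ->
  (forall y, N y -> forall i, K i y = coordinate_vector c i y) -> N y -> Smooth f ->
  bracket (K i) (K j) y f = 0.
Proof.
move=> ac oN Nc vK KE Ny sf; rewrite /bracket (KE y Ny i) (KE y Ny j).
have cy := Nc _ Ny; have cu := cod_map cy.
have H k l : coordinate_vector c k y (fun y => K l y f) =
    'D_(delta_mx 0 k) ('D_(delta_mx 0 l) (f \o chart_inv c)) (chart_map c y).
  rewrite coordinate_vectorE; last exact: vfield_smooth.
  apply: near_eq_derive.
  have nN : \forall y' \near chart_inv c (chart_map c y), N y'.
    by rewrite chart_mapK //; exact: open_nbhs_nbhs.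
  have nc : \forall u \near chart_map c y, cod c u.
    by apply: open_nbhs_nbhs; split => //; exact: cod_open.
  apply: filterS2 nc (near_chart_inv cu nN) => u cu' Nu /=.
  by rewrite KE // coordinate_vectorE // cod_invK.
rewrite !H; apply/eqP; rewrite subr_eq0; apply/eqP.
exact: (schwarz (@cod_open _ _ _ c) i j (Smooth_chart sf ac) cu).
Qed.

End Coordinates.

(** * Orthonormal frames and gradients *)

Section Metric.
Context {R : realType} {d : nat} {M : manifold R d}.
Implicit Types (f h : M -> R) (x y : M) (X Y Z W : vfield M) (u v w : (M -> R) -> R).
Variable g : M -> ((M -> R) -> R) -> ((M -> R) -> R) -> R.
Hypothesis g_metric : is_metric g.

Lemma g_lin x a u v w : Tangent x u -> Tangent x v -> Tangent x w ->
  g x (fun f => a * u f + v f) w = a * g x u w + g x v w.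
Proof. by move=> [tu] [tv] [tw]; have [H _ _ _] := g_metric; exact: H. Qed.

Lemma g_sym x u v : Tangent x u -> Tangent x v -> g x u v = g x v u.
Proof. by move=> [tu] [tv]; have [_ H _ _] := g_metric; exact: H. Qed.

Lemma g_add x u v w : Tangent x u -> Tangent x v -> Tangent x w ->
  g x (fun f => u f + v f) w = g x u w + g x v w.
Proof.
move=> tu tv tw; rewrite -[g x u w]mul1r -(g_lin 1 tu tv tw).
by congr (g x _ w); apply/funext => f; rewrite mul1r.
Qed.

Lemma g0l x w : Tangent x w -> g x (fun _ => 0) w = 0.
Proof.
move=> tw; have t0 := tangent_zero x; have := g_add t0 t0 tw.
rewrite (_ : (fun _ => 0 + 0) = fun _ => 0); last by apply/funext => f; rewrite addr0.
lra.
Qed.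

Lemma g_scale x a u w : Tangent x u -> Tangent x w -> g x (fun f => a * u f) w = a * g x u w.
Proof.
move=> tu tw; have t0 := tangent_zero x.
rewrite -[RHS]addr0 -(g0l tw) -(g_lin a tu t0 tw).
by congr (g x _ w); apply/funext => f; rewrite addr0.
Qed.

Lemma g_sum x (I : finType) (c : I -> R) (u : I -> (M -> R) -> R) w :
  (forall i, Tangent x (u i)) -> Tangent x w ->
  g x (fun f => \sum_i c i * u i f) w = \sum_i c i * g x (u i) w.
Proof.
move=> tu tw.
suff H s : Tangent x (fun f => \sum_(i <- s) c i * u i f) /\
   g x (fun f => \sum_(i <- s) c i * u i f) w = \sum_(i <- s) c i * g x (u i) w.
  exact: (H (index_enum I)).2.
elim: s => [|i s [IH1 IH2]].
  have -> : (fun f => \sum_(i <- [::]) c i * u i f) = fun _ => 0 by apply/funext => f; rewrite big_nil.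
  by rewrite big_nil; split; [exact: tangent_zero | exact: g0l].
have -> : (fun f => \sum_(j <- i :: s) c j * u j f) = fun f => c i * u i f + \sum_(j <- s) c j * u j f.
  by apply/funext => f; rewrite big_cons.
by rewrite big_cons; split; [exact: tangent_comb | rewrite g_lin // IH2].
Qed.

Lemma g_ge0 x v : Tangent x v -> 0 <= g x v v.
Proof.
move=> tv; have [tv'] := tv; have [_ _ H _] := g_metric.
by have [->|/(H _ _ tv') /ltW //] := eqVneq v (fun=> 0); rewrite g0l //; exact: tangent_zero.
Qed.

Lemma g_eq0 x v : Tangent x v -> g x v v = 0 -> v = fun=> 0.
Proof.
move=> [tv] v0; have [_ _ H _] := g_metric; apply/eqP/negPn/negP => /(H _ _ tv).
by rewrite v0 ltxx.
Qed.

Lemma g_inj x u v : Tangent x u -> Tangent x v ->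
  (forall w, Tangent x w -> g x u w = g x v w) -> u = v.
Proof.
move=> tu tv H; have tn := tangent_scale (-1) tv; have tD := tangent_add tu tn.
have /(g_eq0 tD) E : g x (fun f => u f + -1 * v f) (fun f => u f + -1 * v f) = 0.
  by rewrite g_add // g_scale // H // mulN1r subrr.
apply/funext => f; have := congr1 (fun k => k f) E; rewrite /= mulN1r.
by move/eqP; rewrite subr_eq0 => /eqP.
Qed.

Definition orthonormal_at x k (e : 'I_k -> (M -> R) -> R) :=
  (forall i, Tangent x (e i)) /\ (forall i j, g x (e i) (e j) = (i == j)%:R).

Lemma orthonormal_coef x k (e : 'I_k -> (M -> R) -> R) (c : 'I_k -> R) j :
  orthonormal_at x e -> g x (fun f => \sum_i c i * e i f) (e j) = c j.
Proof.
move=> [te ge]; rewrite g_sum // (bigD1 j) //= ge eqxx mulr1 big1 ?addr0// => i ij.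
by rewrite ge (negbTE ij) mulr0.
Qed.

Lemma tangent_lcomb x k (e : 'I_k -> (M -> R) -> R) (c : 'I_k -> R) :
  (forall i, Tangent x (e i)) -> Tangent x (fun f => \sum_i c i * e i f).
Proof.
by move=> te; apply: (@tangent_sumv _ _ _ x _ (fun i f => c i * e i f)) => i; exact: tangent_scale.
Qed.

(** The coordinate vectors; they bound the size of orthonormal families. *)
Lemma tangent_basis x : exists (xi : 'I_d -> M -> R) (b : 'I_d -> (M -> R) -> R),
  [/\ forall i, Smooth (xi i), forall i, Tangent x (b i),
      forall i j, b i (xi j) = (i == j)%:R
    & forall v, Tangent x v -> v = fun f => \sum_i v (xi i) * b i f].
Proof.
have [c [xi [K [N [[ac oN Nx Nc] sxi vK xiE KE]]]]] := coordinates_exist x.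
have nxi : \forall y \near x, forall i, xi i y = chart_map c y 0 i.
  have : nbhs x N by exact: open_nbhs_nbhs.
  by apply: filterS => y Ny i; exact: xiE.
have cx := Nc _ Nx.
have tb i : Tangent x (coordinate_vector c i x) := coordinate_vector_tangent i ac cx.
exists xi, (fun i => coordinate_vector c i x); split => //.
  by move=> i j; exact: coordinate_vector_inj.
move=> v tv; apply: (tangent_eq tv); first exact: tangent_lcomb.
by move=> f sf; exact: tangent_coordinates.
Qed.

Lemma orthonormal_size_le x k (e : 'I_k -> (M -> R) -> R) : orthonormal_at x e -> (k <= d)%N.
Proof.
move=> oe; have [te ge] := oe; have [xi [b [sxi tb bxi bE]]] := tangent_basis x.
pose A : 'M[R]_(k, d) := \matrix_(i, j) e i (xi j).
suff : row_free A by rewrite /row_free => /eqP <-; exact: rank_leq_col.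
apply/inj_row_free => c cA0.
pose v := fun f => \sum_i c 0 i * e i f.
have tv : Tangent x v by exact: tangent_lcomb.
have v0 : v = fun=> 0.
  rewrite (bE v tv); apply/funext => f; rewrite big1 // => j _.
  have := congr1 (fun B : 'rV[R]_d => B 0 j) cA0; rewrite !mxE => H.
  rewrite (_ : v (xi j) = 0) ?mul0r// -[RHS]H.
  by apply: eq_bigr => i _; rewrite mxE.
apply/rowP => j; rewrite -(orthonormal_coef (fun i => c 0 i) j oe) -/v v0 mxE.
by rewrite g0l.
Qed.

Lemma orthonormal_span x (e : 'I_d -> (M -> R) -> R) v : orthonormal_at x e ->
  Tangent x v -> v = fun f => \sum_i g x v (e i) * e i f.
Proof.
move=> oe tv; have [te ge] := oe; have [xi [b [sxi tb bxi bE]]] := tangent_basis x.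
pose A : 'M[R]_d := \matrix_(i, j) e i (xi j).
have uA : A \in unitmx.
  rewrite -row_free_unit; apply/inj_row_free => c cA0.
  pose w := fun f => \sum_i c 0 i * e i f.
  have tw : Tangent x w by exact: tangent_lcomb.
  have w0 : w = fun=> 0.
    rewrite (bE w tw); apply/funext => f; rewrite big1 // => j _.
    have := congr1 (fun B : 'rV[R]_d => B 0 j) cA0; rewrite !mxE => H.
    rewrite (_ : w (xi j) = 0) ?mul0r// -[RHS]H.
    by apply: eq_bigr => i _; rewrite mxE.
  apply/rowP => j; rewrite -(orthonormal_coef (fun i => c 0 i) j oe) -/w w0 mxE.
  by rewrite g0l.
pose r : 'rV[R]_d := \row_j v (xi j); pose c := r *m invmx A.
have cA : c *m A = r by rewrite /c mulmxKV.
have vE : v = fun f => \sum_i c 0 i * e i f.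
  set w := (X in _ = X); have tw : Tangent x w by exact: tangent_lcomb.
  rewrite (bE v tv) (bE w tw); apply/funext => f; apply: eq_bigr => j _; congr (_ * _).
  have := congr1 (fun B : 'rV[R]_d => B 0 j) cA; rewrite !mxE => <-.
  by rewrite /w; apply: eq_bigr => i _; rewrite [A i j]mxE.
rewrite {1}vE; apply/funext => f; apply: eq_bigr => i _; congr (_ * _).
by rewrite vE orthonormal_coef.
Qed.

Lemma orthonormal_spanning_size x k (e : 'I_k -> (M -> R) -> R) : orthonormal_at x e ->
  (forall v, Tangent x v -> v = fun f => \sum_i g x v (e i) * e i f) -> k = d.
Proof.
move=> oe sp; apply/eqP; rewrite eqn_leq (orthonormal_size_le oe) /=.
have [xi [b [sxi tb bxi bE]]] := tangent_basis x.
pose A : 'M[R]_(k, d) := \matrix_(i, j) e i (xi j).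
pose C : 'M[R]_(d, k) := \matrix_(i, j) g x (b i) (e j).
have CA : C *m A = 1%:M.
  apply/matrixP => i j; rewrite !mxE -bxi (sp _ (tb i)).
  by apply: eq_bigr => l _; rewrite !mxE.
have := mulmx_max_rank C A; rewrite CA mxrank1; exact.
Qed.

Lemma Smooth_ip X Y : VField X -> VField Y -> Smooth (ip g X Y).
Proof. by move=> [vX] [vY]; constructor; have [_ _ _] := g_metric; apply. Qed.

Lemma ipC X Y x : VField X -> VField Y -> ip g X Y x = ip g Y X x.
Proof. by move=> vX vY; exact: g_sym (vfield_tangent x vX) (vfield_tangent x vY). Qed.

Lemma ipDl X Y Z x : VField X -> VField Y -> VField Z ->
  ip g (vadd X Y) Z x = ip g X Z x + ip g Y Z x.
Proof.
move=> vX vY vZ.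
exact: g_add (vfield_tangent x vX) (vfield_tangent x vY) (vfield_tangent x vZ).
Qed.

Lemma ipZl h X Z x : VField X -> VField Z -> ip g (vscale h X) Z x = h x * ip g X Z x.
Proof. by move=> vX vZ; exact: g_scale (vfield_tangent x vX) (vfield_tangent x vZ). Qed.

Lemma ipNl X Z x : VField X -> VField Z -> ip g (vopp X) Z x = - ip g X Z x.
Proof.
move=> vX vZ; rewrite -mulN1r -(g_scale _ (vfield_tangent x vX) (vfield_tangent x vZ)).
by congr (g x _ _); apply/funext => f; rewrite mulN1r.
Qed.

Lemma ipBl X Y Z x : VField X -> VField Y -> VField Z ->
  ip g (vsub X Y) Z x = ip g X Z x - ip g Y Z x.
Proof. by move=> vX vY vZ; rewrite ipDl ?ipNl //; exact: vfieldN. Qed.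

Lemma ip_suml k (X : 'I_k -> vfield M) Z x : (forall i, VField (X i)) -> VField Z ->
  ip g (vsum X) Z x = \sum_i ip g (X i) Z x.
Proof.
move=> vX vZ; have tX i := vfield_tangent x (vX i); have tZ := vfield_tangent x vZ.
transitivity (g x (fun f => \sum_i 1 * X i x f) (Z x)).
  by congr (g x _ _); apply/funext => f; apply: eq_bigr => i _; rewrite mul1r.
by rewrite (g_sum (fun=> 1) tX tZ); apply: eq_bigr => i _; rewrite mul1r.
Qed.

Lemma tangent_extend x v : Tangent x v -> exists2 X, VField X & X x = v.
Proof.
move=> tv; have [c [xi [K [N [[ac oN Nx Nc] sxi vK xiE KE]]]]] := coordinates_exist x.
have nxi : \forall y \near x, forall i, xi i y = chart_map c y 0 i.
  have : nbhs x N by exact: open_nbhs_nbhs.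
  by apply: filterS => y Ny i; exact: xiE.
have cx := Nc _ Nx.
exists (vsum (fun i => vscale (fun _ => v (xi i)) (K i))).
  by apply: vfield_sum => i; apply: vfieldZ => //; exact: Smooth_cst.
apply: (@tangent_eq _ _ _ x) => //.
  by apply: tangent_lcomb => i; exact: vfield_tangent.
move=> f sf; rewrite (tangent_coordinates ac cx sxi nxi tv sf).
by apply: eq_bigr => i _; rewrite /vscale KE.
Qed.

(** Gram-Schmidt, one field at a time: a vector of S x0 outside the span of the
    fields found so far is made orthogonal to them, extended to a field of S and
    normalized. The dimension of the tangent space stops the process. *)
Lemma orthonormal_frame_exists (S : M -> set ((M -> R) -> R)) (x0 : M) :
  (forall x v, S x v -> Tangent x v) ->
  (forall x a u v, S x u -> S x v -> S x (fun f => a * u f + v f)) ->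
  (forall x, S x (fun=> 0)) ->
  (forall x v, S x v -> exists X, [/\ VField X, forall y, S y (X y) & X x = v]) ->
  exists k (E : 'I_k -> vfield M),
    [/\ forall i, VField (E i), forall i y, S y (E i y),
        \forall y \near x0, forall i j, ip g (E i) (E j) y = (i == j)%:R
      & forall v, S x0 v -> v = fun f => \sum_i g x0 v (E i x0) * E i x0 f].
Proof.
move=> ST Slin S0 Sext.
pose P k (E : 'I_k -> vfield M) := [/\ forall i, VField (E i), forall i y, S y (E i y) &
        \forall y \near x0, forall i j, ip g (E i) (E j) y = (i == j)%:R].
pose spans k (E : 'I_k -> vfield M) :=
  forall v, S x0 v -> v = fun f => \sum_i g x0 v (E i x0) * E i x0 f.
have Scomb y k (E : 'I_k -> vfield M) (c : 'I_k -> R) : (forall i, S y (E i y)) ->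
    S y (fun f => \sum_i c i * E i y f).
  move=> SE; elim: (index_enum _) => [|i s IH].
    by have := S0 y; under [X in _ -> S _ X]eq_fun do rewrite big_nil.
  have := Slin y (c i) _ _ (SE i) IH.
  by under [X in _ -> S _ X]eq_fun do rewrite big_cons.
have onP k (E : 'I_k -> vfield M) : P k E -> orthonormal_at x0 (fun i => E i x0).
  by move=> [vE _ /nbhs_singleton oE]; split=> [i|]; [exact: vfield_tangent|exact: oE].
have step k : (exists (E : 'I_k -> vfield M), P k E) ->
    (exists l (E : 'I_l -> vfield M), P l E /\ spans l E) \/ (exists (E : 'I_k.+1 -> vfield M), P k.+1 E).
  move=> [E PE]; have [vE SE oE] := PE; have oE0 := onP _ _ PE; have [tE gE] := oE0.
  have [sE|/existsNP[v /not_implyP[Sv nv]]] := pselect (spans k E).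
    by left; exists k, E.
  right.
  pose c i := g x0 v (E i x0).
  have tv := ST _ _ Sv.
  pose w : (M -> R) -> R := fun f => -1 * (\sum_i c i * E i x0 f) + v f.
  have Sw : S x0 w by apply: Slin => //; exact: Scomb.
  have tw := ST _ _ Sw.
  have wE j : g x0 w (E j x0) = 0.
    rewrite /w g_lin //; last exact: tangent_lcomb.
    by rewrite (orthonormal_coef c j oE0) /c mulN1r addNr.
  have w0 : 0 < g x0 w w.
    rewrite lt_neqAle g_ge0 // andbT eq_sym; apply/eqP => /(g_eq0 tw) w0; apply: nv.
    apply/funext => f; have := congr1 (fun k => k f) w0; rewrite /w /= mulN1r addrC.
    by move/eqP; rewrite subr_eq0 => /eqP.
  have [Y [vY SY Yx]] := Sext _ _ Sw.
  pose Y' := vadd (vscale (fun=> -1) (vsum (fun i => vscale (ip g Y (E i)) (E i)))) Y.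
  have vS : VField (vsum (fun i => vscale (ip g Y (E i)) (E i))).
    by apply: vfield_sum => i; apply: vfieldZ => //; exact: Smooth_ip.
  have vY' : VField Y' by apply: vfieldD => //; apply: vfieldZ => //; exact: Smooth_cst.
  have SY' y : S y (Y' y) by apply: Slin => //; exact: Scomb.
  have Y'x : Y' x0 = w.
    apply/funext => f; rewrite /Y' /vadd /vscale /vsum Yx -[RHS]add0r; congr (_ + _).
    by rewrite big1 ?mulr0// => i _; rewrite /ip Yx wE mul0r.
  have Y'E : \forall y \near x0, forall j, ip g Y' (E j) y = 0.
    apply: filterS oE => y oEy j.
    have oy : orthonormal_at y (fun i => E i y) by split => [i|]; [exact: vfield_tangent|].
    rewrite /Y' ipDl //; last by apply: vfieldZ => //; exact: Smooth_cst.
    rewrite ipZl // [X in -1 * X](orthonormal_coef (fun i => ip g Y (E i) y) j oy).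
    by rewrite mulN1r addNr.
  have q0 : 0 < ip g Y' Y' x0 by rewrite /ip Y'x.
  have sq := Smooth_ip vY' vY'.
  have [s ss sE] := Smooth_at_sqrt sq q0.
  have s0 : 0 < s x0 by rewrite -(nbhs_singleton sE) sqrtr_gt0.
  have [r sr rE] := Smooth_atV ss (lt0r_neq0 s0).
  have cq : \forall y \near x0, 0 < ip g Y' Y' y.
    have cs : continuous (ip g Y' Y') by case: sq => sq; exact: smooth_continuous.
    by have := cs x0 _ (open_nbhs_nbhs (conj (@open_gt R 0) q0)).
  pose En := vscale r Y'.
  have vEn : VField En by exact: vfieldZ.
  pose E' (i : 'I_k.+1) := if unlift ord0 i is Some j then E j else En.
  have E'0 : E' ord0 = En by rewrite /E' unlift_none.
  have E'S j : E' (lift ord0 j) = E j by rewrite /E' liftK.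
  exists E'; split.
  - by move=> i; case: (unliftP ord0 i) => [j|] ->; rewrite ?E'S ?E'0.
  - move=> i y; case: (unliftP ord0 i) => [j|] ->; rewrite ?E'S ?E'0 //.
    by have := Slin y (r y) _ _ (SY' y) (S0 y); under eq_fun do rewrite addr0.
  near=> y.
  have oy : forall i j, ip g (E i) (E j) y = (i == j)%:R by near: y.
  have Yy : forall j, ip g Y' (E j) y = 0 by near: y.
  have qy : 0 < ip g Y' Y' y by near: y.
  have sy : Num.sqrt (ip g Y' Y' y) = s y by near: y.
  have ry : (s y)^-1 = r y by near: y.
  move=> i j; case: (unliftP ord0 i) => [i'|] ->; case: (unliftP ord0 j) => [j'|] ->;
    rewrite ?E'S ?E'0.
  + by rewrite oy (inj_eq (@lift_inj _ _)).
  + by rewrite ipC // ipZl // Yy mulr0.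
  + by rewrite ipZl // Yy mulr0.
  + rewrite eqxx ipZl // ipC // ipZl // -ry -sy.
    rewrite -{3}(sqr_sqrtr (ltW qy)) expr2 mulKf ?mulVf// gt_eqF// sqrtr_gt0//.
have main k : (exists l (E : 'I_l -> vfield M), P l E /\ spans l E) \/ (exists (E : 'I_k -> vfield M), P k E).
  elim: k => [|k [IH|IH]]; [right|by left|exact: step].
  have E0 : 'I_0 -> vfield M by case.
  exists E0; split; try by case.
  by apply: near_all => y [].
have [[l [E [[vE SE oE] sE]]]|[E PE]] := main d.+1; first by exists l, E.
by have := orthonormal_size_le (onP _ _ PE); rewrite ltnn.
Unshelve. all: by end_near. Qed.

Lemma orthonormal_full_frame (x0 : M) : exists F : 'I_d -> vfield M,
  (forall i, VField (F i)) /\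
  \forall y \near x0, forall i j, ip g (F i) (F j) y = (i == j)%:R.
Proof.
have [||||k [E [vE _ oE sE]]] := @orthonormal_frame_exists (fun x v => Tangent x v) x0.
- by [].
- by move=> x a u v; exact: tangent_comb.
- by move=> x; exact: tangent_zero.
- move=> x v /tangent_extend [X vX Xx]; exists X; split => // y; exact: vfield_tangent.
have kd : k = d.
  apply: (@orthonormal_spanning_size x0 _ (fun i => E i x0)) => //.
  by split => [i|]; [exact: vfield_tangent | exact: (nbhs_singleton oE)].
by subst k; exists E.
Qed.

Lemma orthonormal_at_fields x k (E : 'I_k -> vfield M) : (forall i, VField (E i)) ->
  (forall i j, ip g (E i) (E j) x = (i == j)%:R) -> orthonormal_at x (fun i => E i x).
Proof. by move=> vE oE; split => // i; exact: vfield_tangent. Qed.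

(** A field which vanishes at x is near x a combination of a frame with
    coefficients vanishing at x; a cutoff turns this into an identity between
    global fields, to which F applies. *)
Lemma tensoriality x (F : vfield M -> R) :
  (forall X Y, VField X -> VField Y -> F (vadd X Y) = F X + F Y) ->
  (forall h X, Smooth h -> VField X -> F (vscale h X) = h x * F X) ->
  forall X Y, VField X -> VField Y -> X x = Y x -> F X = F Y.
Proof.
move=> FD FZ.
have F0 : F (fun _ _ => 0) = 0.
  have := FZ (fun=> 0) _ (Smooth_cst 0) vfield_zero; rewrite mul0r => {2}<-.
  by congr F; apply/funext => y; apply/funext => f; rewrite /vscale mul0r.
have Fsum (I : finType) (X : I -> vfield M) : (forall i, VField (X i)) ->
    F (fun y f => \sum_i X i y f) = \sum_i F (X i).
  move=> vX.
  suff H s : VField (fun y f => \sum_(i <- s) X i y f) /\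
      F (fun y f => \sum_(i <- s) X i y f) = \sum_(i <- s) F (X i).
    exact: (H (index_enum I)).2.
  elim: s => [|i s [IH1 IH2]].
    have -> : (fun y f => \sum_(i <- [::]) X i y f) = (fun _ _ => 0).
      by apply/funext => y; apply/funext => f; rewrite big_nil.
    by rewrite big_nil; split; [exact: vfield_zero|].
  have -> : (fun y f => \sum_(j <- i :: s) X j y f) = vadd (X i) (fun y f => \sum_(j <- s) X j y f).
    by apply/funext => y; apply/funext => f; rewrite big_cons.
  by rewrite big_cons (FD _ _ (vX i) IH1) IH2; split; [exact: vfieldD (vX i) IH1|].
have Fnull X : VField X -> X x = (fun=> 0) -> F X = 0.
  move=> vX X0; have [E [vE oE]] := orthonormal_full_frame x.
  have [chi [schi _ chi1 chi0]] := Cutoff oE.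
  have E1 : X = vadd (vsum (fun i => vscale (fun y => chi y * ip g X (E i) y) (E i)))
      (vscale (fun y => 1 - chi y) X).
    apply/funext => y; apply/funext => f; rewrite /vadd /vsum /vscale.
    have [oy|/chi0 ->] := pselect (forall i j, ip g (E i) (E j) y = (i == j)%:R).
      have -> : \sum_i chi y * ip g X (E i) y * E i y f = chi y * X y f.
        rewrite (orthonormal_span (orthonormal_at_fields vE oy) (vfield_tangent y vX)).
        by rewrite mulr_sumr; apply: eq_bigr => i _; rewrite mulrA.
      ring.
    by rewrite big1 ?subr0 ?mul1r ?add0r// => i _; rewrite !mul0r.
  have sc i : Smooth (fun y => chi y * ip g X (E i) y) by apply: SmoothM => //; exact: Smooth_ip.
  rewrite E1 FD; last 2 first.
  - by apply: vfield_sum => i; exact: vfieldZ.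
  - by apply: vfieldZ => //; apply: SmoothB => //; exact: Smooth_cst.
  rewrite (Fsum _ (fun i => vscale (fun y => chi y * ip g X (E i) y) (E i))); last by move=> i; exact: vfieldZ.
  rewrite big1 => [|i _]; last first.
    by rewrite FZ // /ip X0 g0l ?mulr0 ?mul0r //; exact: vfield_tangent.
  rewrite FZ //; last by apply: SmoothB => //; exact: Smooth_cst.
  by rewrite (nbhs_singleton chi1) subrr mul0r addr0.
move=> X Y vX vY XY.
have sm1 := @Smooth_cst R d M (-1).
have vNY := vfieldZ sm1 vY.
have := Fnull (vadd X (vscale (fun=> -1) Y)) (vfieldD vX vNY).
rewrite FD // FZ // => H; apply/eqP; rewrite -subr_eq0 -mulN1r H //.
by apply/funext => f; rewrite /vadd /vscale XY mulN1r subrr.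
Qed.

Lemma sharpP (eta : one_form M) x v : Tangent x v ->
  (forall X, VField X -> g x v (X x) = eta X x) -> sharp g eta x = v.
Proof.
move=> tv vE; rewrite /sharp.
case: xgetP => [u /= -> [/TangentI tu uE]|/(_ v) /= []]; last first.
  by split; [case: tv | move=> X vX; apply: vE; constructor].
apply: (g_inj tu tv) => w /tangent_extend [X vX <-].
by rewrite vE //; apply: uE; case: vX.
Qed.

Lemma sharp_flat X : VField X -> sharp g (flat g X) = X.
Proof. by move=> vX; apply/funext => x; apply: sharpP => //; exact: vfield_tangent. Qed.

Lemma gradient_frame f x (E : 'I_d -> vfield M) : (forall i, VField (E i)) ->
  (forall i j, ip g (E i) (E j) x = (i == j)%:R) ->
  gradient g f x = fun h => \sum_i E i x f * E i x h.
Proof.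
move=> vE oE; have oe := orthonormal_at_fields vE oE; have [te _] := oe.
apply: sharpP; first exact: tangent_lcomb.
move=> X vX; have tX := vfield_tangent x vX; rewrite /differential.
rewrite (g_sum _ te tX) {2}(orthonormal_span oe tX); apply: eq_bigr => i _.
by rewrite mulrC (g_sym tX).
Qed.

Lemma vfield_gradient f : Smooth f -> VField (gradient g f).
Proof.
move=> sf; apply: vfield_local => x; have [E [vE oE]] := orthonormal_full_frame x.
exists (vsum (fun i => vscale (fun y => E i y f) (E i))).
  by apply: vfield_sum => i; apply: vfieldZ => //; exact: vfield_smooth.
by apply: filterS oE => y oy; exact: gradient_frame.
Qed.

Lemma gradientP f x w : Smooth f -> Tangent x w -> g x (gradient g f x) w = w f.
Proof.
move=> sf tw; have [E [vE /nbhs_singleton oE]] := orthonormal_full_frame x.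
have oe := orthonormal_at_fields vE oE; have [te _] := oe.
rewrite (gradient_frame f vE oE) (g_sum _ te tw) {2}(orthonormal_span oe tw).
by apply: eq_bigr => i _; rewrite mulrC (g_sym tw).
Qed.

Lemma ip_gradient f X x : Smooth f -> VField X -> ip g (gradient g f) X x = X x f.
Proof. by move=> sf vX; apply: gradientP => //; exact: vfield_tangent. Qed.

End Metric.

(** * Horizontal and vertical projections *)

Section Foliation.
Context {R : realType} {n m : nat} {M : manifold R (n + m)}.
Implicit Types (f : M -> R) (x y : M) (X Y Z W : vfield M) (u v w : (M -> R) -> R).
Variable g : M -> ((M -> R) -> R) -> ((M -> R) -> R) -> R.
Hypothesis g_metric : is_metric g.
Variable V : M -> set ((M -> R) -> R).
Hypothesis V_foliation : is_riemannian_foliation g V.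

Local Notation hor := (horizontal g V).
Local Notation HP := (hproj g V).
Local Notation VP := (vproj g V).

(** What the local submersion says about the vertical distribution alone. *)
Lemma foliation_kernel x0 : exists (U : set M) (p : 'I_n -> M -> R),
  [/\ open U /\ U x0, forall i, Smooth (p i),
      forall x, U x -> forall c : 'I_n -> R, exists2 v, Tangent x v & forall i, v (p i) = c i
    & forall x, U x -> forall v, V x v <-> (Tangent x v /\ forall i, v (p i) = 0)].
Proof.
have [U [p [B [h [[oU Ux sp oB pB] _ surj VE _]]]]] := V_foliation x0.
exists U, p; split => //.
- move=> x xU c; have [v tv dv] := surj x xU (\row_i c i).
  exists v; first by constructor.
  by move=> i; have := congr1 (fun r : 'rV[R]_n => r 0 i) dv; rewrite !mxE.
- move=> x xU v; rewrite VE //; split => [[tv dv]|[[tv] dv]].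
    split; first by constructor.
    by move=> i; have := congr1 (fun r : 'rV[R]_n => r 0 i) dv; rewrite !mxE.
  by split => //; apply/rowP => i; rewrite !mxE.
Qed.

Lemma vert_tangent x v : V x v -> Tangent x v.
Proof. by have [U [p [[_ Ux] _ _ VE]]] := foliation_kernel x => /(VE _ Ux) []. Qed.

Lemma vert_comb x a u v : V x u -> V x v -> V x (fun f => a * u f + v f).
Proof.
have [U [p [[_ Ux] _ _ VE]]] := foliation_kernel x.
move=> /(VE _ Ux) [tu u0] /(VE _ Ux) [tv v0]; apply/(VE _ Ux); split.
  exact: tangent_comb.
by move=> i; rewrite u0 v0 mulr0 addr0.
Qed.

Lemma vert0 x : V x (fun=> 0).
Proof.
have [U [p [[_ Ux] _ _ VE]]] := foliation_kernel x.
by apply/(VE _ Ux); split => //; exact: tangent_zero.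
Qed.

Lemma vert_add x u v : V x u -> V x v -> V x (fun f => u f + v f).
Proof.
by move=> Vu Vv; have := vert_comb 1 Vu Vv; under eq_fun do rewrite mul1r.
Qed.

Lemma vert_scale x a u : V x u -> V x (fun f => a * u f).
Proof.
by move=> Vu; have := vert_comb a Vu (vert0 x); under eq_fun do rewrite addr0.
Qed.

Lemma vert_sub x u v : V x u -> V x v -> V x (fun f => u f - v f).
Proof.
move=> Vu Vv; have := vert_comb (-1) Vv Vu.
by under eq_fun do rewrite mulN1r addrC.
Qed.

Lemma hor_tangent x v : hor x v -> Tangent x v.
Proof. by case=> tv _; constructor. Qed.

Lemma hor_vert x u v : hor x u -> V x v -> g x u v = 0.
Proof. by case=> _; apply. Qed.

Lemma hor_comb x a u v : hor x u -> hor x v -> hor x (fun f => a * u f + v f).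
Proof.
move=> hu hv; have tu := hor_tangent hu; have tv := hor_tangent hv; split.
  by case: (tangent_comb a tu tv).
move=> w Vw; rewrite (g_lin g_metric) //; last exact: vert_tangent.
by rewrite (hor_vert hu Vw) (hor_vert hv Vw) mulr0 addr0.
Qed.

Lemma hor0 x : hor x (fun=> 0).
Proof.
split; first by case: (tangent_zero x).
by move=> w /vert_tangent tw; exact: g0l.
Qed.

Lemma hor_add x u v : hor x u -> hor x v -> hor x (fun f => u f + v f).
Proof.
by move=> hu hv; have := hor_comb 1 hu hv; under eq_fun do rewrite mul1r.
Qed.

Lemma hor_sub x u v : hor x u -> hor x v -> hor x (fun f => u f - v f).
Proof.
move=> hu hv; have := hor_comb (-1) hv hu.
by under eq_fun do rewrite mulN1r addrC.
Qed.

Lemma hor_sum x k (c : 'I_k -> R) (e : 'I_k -> (M -> R) -> R) :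
  (forall i, hor x (e i)) -> hor x (fun f => \sum_i c i * e i f).
Proof.
move=> he; elim: (index_enum _) => [|i s IH].
  by have := hor0 x; under [X in _ -> horizontal _ _ _ X]eq_fun do rewrite big_nil.
have := hor_comb (c i) (he i) IH.
by under [X in _ -> horizontal _ _ _ X]eq_fun do rewrite big_cons.
Qed.

Lemma hor_vert0 x v : hor x v -> V x v -> v = fun=> 0.
Proof.
move=> hv Vv; apply: (g_eq0 g_metric (hor_tangent hv)); exact: hor_vert.
Qed.

(** The horizontal space is spanned by the gradients of the components of the
    submersion, whose Gram matrix is invertible. *)
Section Projection.
Variables (p : 'I_n -> M -> R) (U : set M).
Hypothesis sp : forall i, Smooth (p i).
Hypothesis surj : forall x, U x -> forall c : 'I_n -> R,
  exists2 v, Tangent x v & forall i, v (p i) = c i.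
Hypothesis VE : forall x, U x -> forall v, V x v <-> (Tangent x v /\ forall i, v (p i) = 0).

Definition submersion_gram x : 'M[R]_n := \matrix_(i, j) gradient g (p i) x (p j).

Lemma hor_gradient x i : U x -> hor x (gradient g (p i) x).
Proof.
move=> Ux; have vG := vfield_gradient g_metric (sp i).
split; first by case: (vfield_tangent x vG).
by move=> w /(VE Ux) [tw w0]; rewrite (gradientP g_metric).
Qed.

(** A combination of the gradients killed by the Gram matrix is both horizontal
    and vertical, hence zero, and the differential of the submersion is onto. *)
Lemma submersion_gram_unit x : U x -> submersion_gram x \in unitmx.
Proof.
move=> Ux; rewrite -row_free_unit; apply/inj_row_free => c cA.
pose w f := \sum_i c 0 i * gradient g (p i) x f.
have hw : hor x w by apply: hor_sum => i; exact: hor_gradient.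
have w0 : w = fun=> 0.
  apply: hor_vert0 (hw) _; apply/(VE Ux); split; first exact: hor_tangent.
  move=> j; have := congr1 (fun r : 'rV[R]_n => r 0 j) cA; rewrite !mxE => <-.
  by apply: eq_bigr => i _; rewrite mxE.
apply/rowP => k; have [v tv vk] := surj Ux (fun i => (i == k)%:R).
have vG i := vfield_tangent x (vfield_gradient g_metric (sp i)).
have := g_sum g_metric (fun i => c 0 i) vG tv; rewrite -/w w0 (g0l g_metric) // mxE => E.
rewrite (bigD1 k) //= (gradientP g_metric) // vk eqxx mulr1 big1 ?addr0 in E; first by rewrite -E.
by move=> i ik; rewrite (gradientP g_metric) // vk (negbTE ik) mulr0.
Qed.

Lemma hproj_formula x v w : U x -> Tangent x v ->
  hor x w /\ V x (fun f => v f - w f) <->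
  w = fun f => \sum_j (\sum_i v (p i) * invmx (submersion_gram x) i j) * gradient g (p j) x f.
Proof.
move=> Ux tv; set w' := (X in _ <-> _ = X).
have hw' : hor x w' by apply: hor_sum => i; exact: hor_gradient.
have tw' := hor_tangent hw'.
have vw' : V x (fun f => v f - w' f).
  apply/(VE Ux); split; first exact: tangent_sub.
  move=> k; apply/eqP; rewrite subr_eq0; apply/eqP.
  pose r : 'rV[R]_n := \row_i v (p i).
  have -> : v (p k) = r 0 k by rewrite mxE.
  rewrite -{1}(mulmxKV (submersion_gram_unit Ux) r) mxE /w'.
  apply: eq_bigr => j _; rewrite !mxE; congr (_ * _).
  by apply: eq_bigr => i _; rewrite mxE.
split => [[hw vw]|-> //].
have : (fun f => w f - w' f) = fun=> 0.
  apply: (@hor_vert0 x _ (hor_sub hw hw')).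
  by have := vert_sub vw' vw; congr (V x _); apply/funext => f; ring.
move=> E; apply/funext => f; have := congr1 (fun k => k f) E.
by move/eqP; rewrite /= subr_eq0 => /eqP.
Qed.

Lemma vfield_projection X : VField X -> forall x0 : M, open U -> U x0 ->
  exists2 Y, VField Y & \forall x \near x0, Y x = fun f =>
    \sum_j (\sum_i X x (p i) * invmx (submersion_gram x) i j) * gradient g (p j) x f.
Proof.
move=> vX x0 oU Ux0.
have sA i j : Smooth (fun x => submersion_gram x i j).
  apply: Smooth_ext (vfield_smooth (vfield_gradient g_metric (sp i)) (sp j)).
  by move=> x; rewrite mxE.
have sdet := Smooth_det sA.
have det0 : \det (submersion_gram x0) != 0.
  by have := submersion_gram_unit Ux0; rewrite unitmxE unitfE.
have [r sr rE] := Smooth_atV sdet det0.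
have sadj i j : Smooth (fun x => \adj (submersion_gram x) i j).
  apply: (@Smooth_ext _ _ _ (fun x => (-1) ^+ (j + i) * \det (row' j (col' i (submersion_gram x))))).
    by move=> x; rewrite mxE.
  apply: SmoothZ; apply: Smooth_det => k l.
  by apply: Smooth_ext (sA (lift j k) (lift i l)) => x; rewrite !mxE.
exists (vsum (fun j => vscale (fun x => \sum_i X x (p i) * (r x * \adj (submersion_gram x) i j))
   (gradient g (p j)))).
  apply: vfield_sum => j; apply: vfieldZ; last exact: vfield_gradient.
  apply: Smooth_sum => i; apply: SmoothM; first exact: vfield_smooth.
  exact: SmoothM.
have nU : \forall x \near x0, U x by exact: open_nbhs_nbhs.
apply: filterS2 nU rE => x Ux rx; apply/funext => f; rewrite /vsum /vscale.
apply: eq_bigr => j _; congr (_ * _); apply: eq_bigr => i _; congr (_ * _).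
by rewrite /invmx submersion_gram_unit // [RHS]mxE rx.
Qed.

End Projection.

(** The value of hproj at a point depends on the value of the field only. *)
Definition hvec x v := xget (fun=> 0) [set w | hor x w /\ V x (fun f => v f - w f)].

Lemma hprojE X x : HP X x = hvec x (X x). Proof. by []. Qed.

Lemma hvecP x v : Tangent x v -> hor x (hvec x v) /\ V x (fun f => v f - hvec x v f).
Proof.
move=> tv; have [U [p [[oU Ux] sp surj VE]]] := foliation_kernel x.
have /hproj_formula H := Ux; have := (H _ sp surj VE _ _ tv).2 erefl.
move=> H0; rewrite /hvec; case: xgetP => [w _ //|H'].
by case: (H' _ H0).
Qed.

Lemma hvec_unique x v w : Tangent x v -> hor x w -> V x (fun f => v f - w f) -> hvec x v = w.
Proof.
move=> tv hw vw; have [hw' vw'] := hvecP tv.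
have [U [p [[oU Ux] sp surj VE]]] := foliation_kernel x.
have H := @hproj_formula _ _ sp surj VE x v _ Ux tv.
by rewrite ((H _).1 (conj hw vw)); exact: (H _).1 (conj hw' vw').
Qed.

Lemma hvec_comb x a u v : Tangent x u -> Tangent x v ->
  hvec x (fun f => a * u f + v f) = fun f => a * hvec x u f + hvec x v f.
Proof.
move=> tu tv; have [hu vu] := hvecP tu; have [hv vv] := hvecP tv.
apply: hvec_unique; [exact: tangent_comb|exact: hor_comb|].
have := vert_comb a vu vv; congr (V x _); apply/funext => f; ring.
Qed.

Lemma hvec_hor x v : hor x v -> hvec x v = v.
Proof.
move=> hv; apply: hvec_unique => //; first exact: hor_tangent.
by under eq_fun do rewrite subrr; exact: vert0.
Qed.

Lemma hvec_vert x v : V x v -> hvec x v = fun=> 0.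
Proof.
move=> Vv; apply: hvec_unique; [exact: vert_tangent|exact: hor0|].
by under eq_fun do rewrite subr0.
Qed.

Lemma vfield_hproj X : VField X -> VField (HP X).
Proof.
move=> vX; apply: vfield_local => x.
have [U [p [[oU Ux] sp surj VE]]] := foliation_kernel x.
have [Y vY YE] := vfield_projection sp surj VE vX oU Ux.
exists Y => //; have nU : \forall y \near x, U y by exact: open_nbhs_nbhs.
apply: filterS2 nU YE => y Uy ->.
have ty := vfield_tangent y vX.
by apply: (hproj_formula sp surj VE (hvec y (X y)) Uy ty).1; exact: hvecP.
Qed.

Lemma vfield_vproj X : VField X -> VField (VP X).
Proof. by move=> vX; exact: vfieldB vX (vfield_hproj vX). Qed.

Lemma hproj_horizontal X x : VField X -> hor x (HP X x).
Proof. by move=> vX; exact: (hvecP (vfield_tangent x vX)).1. Qed.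

Lemma vproj_vertical X x : VField X -> V x (VP X x).
Proof. by move=> vX; exact: (hvecP (vfield_tangent x vX)).2. Qed.

Lemma proj_decomp X : X = vadd (HP X) (VP X).
Proof.
by apply/funext => x; apply/funext => f; rewrite /vproj /vsub /vadd /vopp addrC subrK.
Qed.

Lemma hproj_id X x : hor x (X x) -> HP X x = X x.
Proof. exact: hvec_hor. Qed.

Lemma vproj_id X x : V x (X x) -> VP X x = X x.
Proof.
move=> VX; apply/funext => f.
by rewrite /vproj /vsub /vadd /vopp hprojE (hvec_vert VX) subr0.
Qed.

Lemma hproj_vert X x : V x (X x) -> HP X x = fun=> 0.
Proof. exact: hvec_vert. Qed.

Lemma vproj_hor X x : hor x (X x) -> VP X x = fun=> 0.
Proof.
move=> hX; apply/funext => f.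
by rewrite /vproj /vsub /vadd /vopp hprojE (hvec_hor hX) subrr.
Qed.

Lemma hproj_field X : is_horizontal g V X -> HP X = X.
Proof. by move=> hX; apply/funext => x; apply: hproj_id; exact: hX. Qed.

Lemma vproj_field X : is_vertical V X -> VP X = X.
Proof. by move=> hX; apply/funext => x; apply: vproj_id; exact: hX. Qed.

Lemma hproj_vfield X : is_vertical V X -> HP X = fun _ _ => 0.
Proof. by move=> hX; apply/funext => x; apply: hproj_vert; exact: hX. Qed.

Lemma vproj_hfield X : is_horizontal g V X -> VP X = fun _ _ => 0.
Proof. by move=> hX; apply/funext => x; apply: vproj_hor; exact: hX. Qed.

Lemma hproj_comb h X Y : VField X -> VField Y ->
  HP (vadd (vscale h X) Y) = vadd (vscale h (HP X)) (HP Y).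
Proof.
move=> vX vY; apply/funext => x.
exact: hvec_comb (vfield_tangent x vX) (vfield_tangent x vY).
Qed.

Lemma vproj_comb h X Y : VField X -> VField Y ->
  VP (vadd (vscale h X) Y) = vadd (vscale h (VP X)) (VP Y).
Proof.
move=> vX vY; rewrite /vproj hproj_comb //.
by apply/funext => x; apply/funext => f; rewrite /vsub /vadd /vscale /vopp; ring.
Qed.

Lemma ip_hv X Y x : hor x (X x) -> V x (Y x) -> ip g X Y x = 0.
Proof. by move=> hX vY; exact: hor_vert. Qed.

Lemma ip_vh X Y x : V x (X x) -> hor x (Y x) -> ip g X Y x = 0.
Proof.
move=> vX hY; rewrite /ip (g_sym g_metric); [exact: hor_vert|exact: vert_tangent|exact: hor_tangent].
Qed.

Lemma ip_hproj X Y x : VField X -> hor x (Y x) -> ip g (HP X) Y x = ip g X Y x.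
Proof.
move=> vX hY; have [hX VX] := hvecP (vfield_tangent x vX).
have tH := hor_tangent hX; have tV := vert_tangent VX; have tY := hor_tangent hY.
have E : X x = fun f => hvec x (X x) f + (X x f - hvec x (X x) f).
  by apply/funext => f; rewrite addrC subrK.
rewrite /ip [in RHS]E [RHS](g_add g_metric tH tV tY) [X in _ = _ + X](g_sym g_metric tV tY).
by rewrite (hor_vert hY VX) addr0.
Qed.

Lemma ip_vproj X Y x : VField X -> V x (Y x) -> ip g (VP X) Y x = ip g X Y x.
Proof.
move=> vX VY; have [hX VX] := hvecP (vfield_tangent x vX).
have tH := hor_tangent hX; have tV := vert_tangent VX; have tY := vert_tangent VY.
have E : X x = fun f => hvec x (X x) f + (X x f - hvec x (X x) f).
  by apply/funext => f; rewrite addrC subrK.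
rewrite /ip [in RHS]E [RHS](g_add g_metric tH tV tY).
by rewrite (hor_vert hX VY) add0r.
Qed.

(** The ranks come from the local submersion: its components are coordinates on
    the horizontal space, which has dimension n therefore, and the two
    orthogonal distributions span a space of dimension n + m. *)
Lemma adapted_frame (x0 : M) : exists (E : 'I_n -> vfield M) (Z : 'I_m -> vfield M),
  [/\ forall i, VField (E i) /\ is_horizontal g V (E i),
      forall i, VField (Z i) /\ is_vertical V (Z i),
      \forall y \near x0, forall i j, ip g (E i) (E j) y = (i == j)%:R
    & \forall y \near x0, forall i j, ip g (Z i) (Z j) y = (i == j)%:R].
Proof.
have [||||k [E [vE hE oE sE]]] := @orthonormal_frame_exists _ _ _ _ g_metric (fun x v => hor x v) x0.
- by move=> x v /hor_tangent.
- exact: hor_comb.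
- exact: hor0.
- move=> x v hv; have [Y vY Yx] := tangent_extend (hor_tangent hv).
  exists (HP Y); split; [exact: vfield_hproj|by move=> y; exact: hproj_horizontal|].
  by rewrite -[RHS](hvec_hor hv) -Yx.
have [||||l [Z [vZ VZ oZ sZ]]] := @orthonormal_frame_exists _ _ _ _ g_metric V x0.
- exact: vert_tangent.
- exact: vert_comb.
- exact: vert0.
- move=> x v Vv; have [Y vY Yx] := tangent_extend (vert_tangent Vv).
  exists (VP Y); split; [exact: vfield_vproj|by move=> y; exact: vproj_vertical|].
  by rewrite -Yx; apply: vproj_id; rewrite Yx.
have oE0 := nbhs_singleton oE; have oZ0 := nbhs_singleton oZ.
have [U [p [[oU Ux] sp surj VE]]] := foliation_kernel x0.
have kn : k = n.
  pose A : 'M[R]_(k, n) := \matrix_(i, j) E i x0 (p j).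
  have fA : row_free A.
    apply/inj_row_free => c cA; pose w f := \sum_i c 0 i * E i x0 f.
    have hw : hor x0 w by exact: hor_sum.
    have w0 : w = fun=> 0.
      apply: hor_vert0 (hw) _; apply/(VE _ Ux); split; first exact: hor_tangent.
      move=> j; have := congr1 (fun r : 'rV[R]_n => r 0 j) cA; rewrite !mxE => <-.
      by apply: eq_bigr => i _; rewrite mxE.
    apply/rowP => j; rewrite -(orthonormal_coef g_metric (fun i => c 0 i) j
      (orthonormal_at_fields vE oE0)) -/w w0 mxE.
    by rewrite (g0l g_metric) //; exact: vfield_tangent.
  have uA : row_full A.
    have /choice [b Hb] : forall i : 'I_n, exists v, Tangent x0 v /\ forall j, v (p j) = (i == j)%:R.
      by move=> i; have [v tv vi] := surj x0 Ux (fun j => (i == j)%:R); exists v.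
    pose C : 'M[R]_(n, k) := \matrix_(i, j) g x0 (hvec x0 (b i)) (E j x0).
    have CA : C *m A = 1%:M.
      apply/matrixP => i j; rewrite !mxE; have [tb bi] := Hb i.
      have [hb vb] := hvecP tb; have [_ b0] := (VE _ Ux _).1 vb.
      have := b0 j; rewrite bi => /eqP; rewrite subr_eq0 => /eqP ->.
      rewrite [in RHS](sE _ hb); by apply: eq_bigr => q _; rewrite !mxE.
    by apply/row_fullP; exists C.
  by apply/eqP; rewrite -(eqP fA) (eqP uA).
pose e (i : 'I_(k + l)) := match fintype.split i with inl a => E a x0 | inr b => Z b x0 end.
have te i : Tangent x0 (e i) by rewrite /e; case: fintype.split => a; exact: vfield_tangent.
have eL a : e (lshift l a) = E a x0.
  by rewrite /e (_ : fintype.split _ = inl a) // -[RHS](unsplitK (inl a : 'I_k + 'I_l)).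
have eR a : e (rshift k a) = Z a x0.
  by rewrite /e (_ : fintype.split _ = inr a) // -[RHS](unsplitK (inr a : 'I_k + 'I_l)).
have kl : (k + l)%N = (n + m)%N.
  apply: (@orthonormal_spanning_size _ _ _ _ g_metric x0 _ e).
    split => // i j; case: (split_ordP i) => a ->; case: (split_ordP j) => b ->; rewrite ?eL ?eR.
    - by rewrite (inj_eq (@lshift_inj _ _)); exact: oE0.
    - by rewrite (hor_vert (hE a x0) (VZ b x0)) eq_lrshift.
    - by rewrite (g_sym g_metric) ?(hor_vert (hE b x0) (VZ a x0)) ?eq_rlshift//; exact: vfield_tangent.
    - by rewrite (inj_eq (@rshift_inj _ _)); exact: oZ0.
  move=> v tv; have [hv vv] := hvecP tv; have tH := hor_tangent hv; have tV := vert_tangent vv.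
  have gE a : g x0 v (E a x0) = g x0 (hvec x0 v) (E a x0).
    have tEa := vfield_tangent x0 (vE a).
    have {1}-> : v = fun f => hvec x0 v f + (v f - hvec x0 v f).
      by apply/funext => f; rewrite addrC subrK.
    rewrite [LHS](g_add g_metric tH tV tEa) [X in _ + X](g_sym g_metric tV tEa).
    by rewrite (hor_vert (hE a x0) vv) addr0.
  have gZ a : g x0 v (Z a x0) = g x0 (fun f => v f - hvec x0 v f) (Z a x0).
    have tZa := vfield_tangent x0 (vZ a).
    have {1}-> : v = fun f => hvec x0 v f + (v f - hvec x0 v f).
      by apply/funext => f; rewrite addrC subrK.
    by rewrite [LHS](g_add g_metric tH tV tZa) (hor_vert hv (VZ a x0)) add0r.
  apply/funext => f; rewrite big_split_ord /=.
  rewrite -[LHS](subrK (hvec x0 v f)) addrC; congr (_ + _).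
    rewrite [LHS](congr1 (fun k => k f) (sZ _ vv)); apply: eq_bigr => a _.
    by rewrite eR gZ.
  by rewrite {1}(sE _ hv); apply: eq_bigr => a _; rewrite eL gE.
have lm : l = m by move: kl; rewrite kn => /addnI.
subst k l; exists E, Z; split; [|move=> i; split; [exact: vZ|move=> y; exact: VZ]|exact: oE|exact: oZ].
by move=> i; split; [exact: vE|move=> y; exact: hE].
Unshelve. all: by end_near. Qed.

End Foliation.

(** * Lie brackets and derivatives of determinants *)

Section FieldAlgebra.
Context {R : realType} {d : nat} {M : manifold R d}.
Implicit Types (f h : M -> R) (x : M) (X Y Z : vfield M).

Lemma field_eq X Y : VField X -> VField Y ->
  (forall x f, Smooth f -> X x f = Y x f) -> X = Y.
Proof.
move=> vX vY H; apply/funext => x.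
exact: tangent_eq (vfield_tangent x vX) (vfield_tangent x vY) (H x).
Qed.

Lemma bracketC X Y : bracket Y X = vopp (bracket X Y).
Proof. by apply/funext => x; apply/funext => f; rewrite /bracket /vopp opprB. Qed.

Lemma bracket_combl h X X' Y : Smooth h -> VField X -> VField X' -> VField Y ->
  bracket (vadd (vscale h X) X') Y =
  vadd (vadd (vscale (fun x => - Y x h) X) (vscale h (bracket X Y))) (bracket X' Y).
Proof.
move=> sh vX vX' vY; have sY := vfield_smooth vY sh.
apply: field_eq.
- exact: vfield_bracket (vfieldD (vfieldZ sh vX) vX') vY.
- apply: vfieldD; last exact: vfield_bracket.
  apply: vfieldD; first by apply: vfieldZ => //; exact: SmoothN.
  by apply: vfieldZ => //; exact: vfield_bracket.
move=> x f sf; rewrite /bracket /vadd /vscale.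
have sX := vfield_smooth vX sf; have sX' := vfield_smooth vX' sf.
have tY := vfield_tangent x vY.
rewrite (tangentD tY (SmoothM sh sX) sX') (tangentM tY sh sX); ring.
Qed.

Lemma bracket_combr h X Y Y' : Smooth h -> VField X -> VField Y -> VField Y' ->
  bracket X (vadd (vscale h Y) Y') =
  vadd (vadd (vscale (fun x => X x h) Y) (vscale h (bracket X Y))) (bracket X Y').
Proof.
move=> sh vX vY vY'; rewrite bracketC bracket_combl // [bracket Y X]bracketC [bracket Y' X]bracketC.
apply/funext => x; apply/funext => f; rewrite /vopp /vadd /vscale; ring.
Qed.

Lemma bracketDl X X' Y : VField X -> VField X' -> VField Y ->
  bracket (vadd X X') Y = vadd (bracket X Y) (bracket X' Y).
Proof.
move=> vX vX' vY; rewrite -vadd_scale1 bracket_combl //; last exact: Smooth_cst.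
apply/funext => x; apply/funext => f; rewrite /vopp /vadd /vscale.
rewrite (tangent_cst _ (vfield_tangent x vY)); ring.
Qed.

Lemma bracketDr X Y Y' : VField X -> VField Y -> VField Y' ->
  bracket X (vadd Y Y') = vadd (bracket X Y) (bracket X Y').
Proof.
move=> vX vY vY'; rewrite bracketC bracketDl // [bracket Y X]bracketC [bracket Y' X]bracketC.
by apply/funext => x; apply/funext => f; rewrite /vopp /vadd; ring.
Qed.

Lemma bracket0l X : VField X -> bracket (fun _ _ => 0) X = fun _ _ => 0.
Proof.
move=> vX; apply/funext => x; apply/funext => f; rewrite /bracket.
by rewrite (tangent_cst _ (vfield_tangent x vX)) subr0.
Qed.

Lemma bracket0r X : VField X -> bracket X (fun _ _ => 0) = fun _ _ => 0.
Proof.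
by move=> vX; rewrite bracketC bracket0l //; apply/funext => x; apply/funext => f; rewrite /vopp oppr0.
Qed.

Lemma bracketNr X Y : VField X -> VField Y -> bracket X (vopp Y) = vopp (bracket X Y).
Proof.
move=> vX vY; have vN : VField (vopp Y) := vfieldN vY.
apply/funext => x; apply/funext => f.
have E : bracket X (vadd (vopp Y) Y) x f = 0.
  rewrite (_ : vadd _ _ = fun _ _ => 0) ?bracket0r //.
  by apply/funext => y; apply/funext => k; rewrite /vadd /vopp addNr.
by move: E; rewrite (bracketDr vX vN vY) /vadd /vopp => /eqP; rewrite addr_eq0 => /eqP.
Qed.

Lemma jacobi X Y Z x f : VField X -> VField Y -> VField Z -> Smooth f ->
  bracket X (bracket Y Z) x f + bracket Y (bracket Z X) x f + bracket Z (bracket X Y) x f = 0.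
Proof.
move=> vX vY vZ sf; have sX := vfield_smooth vX; have sY := vfield_smooth vY.
have sZ := vfield_smooth vZ.
rewrite /bracket.
rewrite (tangentB (vfield_tangent x vX) (sY _ (sZ _ sf)) (sZ _ (sY _ sf))).
rewrite (tangentB (vfield_tangent x vY) (sZ _ (sX _ sf)) (sX _ (sZ _ sf))).
rewrite (tangentB (vfield_tangent x vZ) (sX _ (sY _ sf)) (sY _ (sX _ sf))).
ring.
Qed.

(** In coordinates this is the chain rule of R^d. *)
Lemma tangent_chain k (B : set 'rV[R]_k) (phi : 'rV[R]_k -> R) (q : 'I_k -> M -> R) f x v :
  open B -> smooth_on B phi -> (forall j, Smooth (q j)) -> B (\row_j q j x) ->
  Smooth f -> (\forall y \near x, f y = phi (\row_j q j y)) -> Tangent x v ->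
  v f = \sum_j v (q j) * 'D_(delta_mx 0 j) phi (\row_j q j x).
Proof.
move=> oB sphi sq Bx sf fE tv.
have [c [xi [K [N [[ac oN Nx Nc] sxi vK xiE KE]]]]] := coordinates_exist x.
have nxi : \forall y \near x, forall i, xi i y = chart_map c y 0 i.
  have : nbhs x N by exact: open_nbhs_nbhs.
  by apply: filterS => y Ny i; exact: xiE.
have cx := Nc _ Nx; have cu := cod_map cx.
have tc := tangent_coordinates ac cx sxi nxi tv.
rewrite (tc _ sf).
have rE : \row_j (q j \o chart_inv c) (chart_map c x) = \row_j q j x.
  by apply/rowP => j; rewrite !mxE /= chart_mapK.
have key i : coordinate_vector c i x f =
    \sum_j coordinate_vector c i x (q j) * 'D_(delta_mx 0 j) phi (\row_j q j x).
  rewrite coordinate_vectorE //.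
  have fE' : \forall u \near chart_map c x, (f \o chart_inv c) u = phi (\row_j (q j \o chart_inv c) u).
    have : \forall y \near chart_inv c (chart_map c x), f y = phi (\row_j q j y) by rewrite chart_mapK.
    exact: near_chart_inv cu.
  rewrite (near_eq_derive _ fE').
  have [] := @is_derive_comp_C1 R _ k phi (fun j => q j \o chart_inv c) (chart_map c x) (delta_mx 0 i).
  - rewrite rE; apply: (open_near oB Bx) => w Bw j; exact: smooth_on_derivable sphi Bw.
  - by move=> j; rewrite rE; apply: smooth_on_continuous Bx; exact: smooth_on_partial.
  - by move=> j; apply: (smooth_on_derivable (Smooth_chart (sq j) ac) cu).
  move=> _ ->; apply: eq_bigr => j _; rewrite rE coordinate_vectorE //.
under eq_bigr => i _ do rewrite key mulr_sumr.
rewrite exchange_big /=; apply: eq_bigr => j _.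
by rewrite (tc _ (sq j)) mulr_suml; apply: eq_bigr => i _; rewrite mulrA.
Qed.

Lemma bracketE X Y x f : bracket X Y x f = X x (fun y => Y y f) - Y x (fun y => X y f).
Proof. by []. Qed.

End FieldAlgebra.

Section Jacobi.
Context {R : realType} {d : nat} {M : manifold R d}.

Lemma tangent_prod x v k (f : 'I_k -> M -> R) : Tangent x v -> (forall i, Smooth (f i)) ->
  Smooth (fun y => \prod_i f i y) /\
  v (fun y => \prod_i f i y) = \sum_j \prod_i (if i == j then v (f i) else f i x).
Proof.
move=> tv; elim: k f => [f sf|k IH f sf].
  have -> : (fun y => \prod_(i < 0) f i y) = fun=> 1 by apply/funext => y; rewrite big_ord0.
  by rewrite big_ord0 (tangent_cst 1 tv); split => //; exact: Smooth_cst.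
have [sp IHv] := IH (fun i => f (lift ord0 i)) (fun i => sf _).
have E : (fun y => \prod_i f i y) = fun y => f ord0 y * \prod_i f (lift ord0 i) y.
  by apply/funext => y; rewrite big_ord_recl.
split; first by rewrite E; exact: SmoothM.
rewrite E (tangentM tv (sf ord0) sp) IHv [RHS]big_ord_recl big_ord_recl eqxx addrC; congr (_ + _).
  by rewrite mulrC; congr (_ * _).
rewrite mulr_sumr; apply: eq_bigr => j _; rewrite big_ord_recl /=; congr (_ * _).
Qed.

(** Jacobi's formula: the determinant is multilinear in the rows, and each term
    is expanded along the differentiated row. *)
Lemma tangent_det x v k (A : 'I_k -> 'I_k -> M -> R) : Tangent x v ->
  (forall i j, Smooth (A i j)) ->
  v (fun y => \det (\matrix_(i, j) A i j y)) =
  \sum_i \sum_j v (A i j) * cofactor (\matrix_(i, j) A i j x) i j.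
Proof.
move=> tv sA; pose B := \matrix_(i, j) A i j x.
pose C l : 'M[R]_k := \matrix_(i, j) if i == l then v (A i j) else A i j x.
transitivity (\sum_l \det (C l)); last first.
  apply: eq_bigr => l _; rewrite (expand_det_row _ l); apply: eq_bigr => j _.
  rewrite mxE eqxx; congr (_ * _); rewrite /cofactor; congr (_ * \det _).
  by apply/matrixP => i' j'; rewrite !mxE eq_sym (negbTE (neq_lift l i')).
have sP (s : {perm 'I_k}) := tangent_prod tv (fun i => sA i (s i)).
have -> : (fun y => \det (\matrix_(i, j) A i j y)) =
    fun y => \sum_(s : {perm 'I_k}) (-1) ^+ s * \prod_i A i (s i) y.
  apply/funext => y; rewrite /determinant; apply: eq_bigr => s _; congr (_ * _).
  by apply: eq_bigr => i _; rewrite mxE.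
rewrite (tangent_sum tv) => [|s]; last exact: SmoothZ (sP s).1.
transitivity (\sum_(s : {perm 'I_k}) \sum_l (-1) ^+ s * \prod_i (C l i (s i))).
  apply: eq_bigr => s _; rewrite (tangentZ _ tv (sP s).1) (sP s).2 mulr_sumr.
  by apply: eq_bigr => l _; congr (_ * _); apply: eq_bigr => i _; rewrite mxE.
by rewrite exchange_big.
Qed.

End Jacobi.

(** * The Riemannian volume in a chart *)

Section ChartIntegral.
Context {R : realType} {d : nat} {M : manifold R d}.
Implicit Types (f h F G : M -> R) (x y : M) (u w : 'rV[R]_d).
Variable g : M -> ((M -> R) -> R) -> ((M -> R) -> R) -> R.
Variable c : chart R d M.
Hypothesis ac : atlas c.
Variables (a : 'rV[R]_d) (r e : R) (N : set M).
Hypothesis r_gt0 : 0 < r.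
Hypothesis re : r < e.
Hypothesis ballN : forall u, `|u - a| <= e -> cod c u /\ N (chart_inv c u).

(** The margin between r and e keeps supports away from the boundary of the ball
    on which the chart is used. *)
Definition supported F := Smooth F /\ forall y, ~ chart_ball c a r y -> F y = 0.

Definition local_rep F u : R := if `|u - a| < e then F (chart_inv c u) else 0.

Let cod_r u : `|u - a| <= r -> cod c u.
Proof. by move=> H; apply: (ballN _).1; exact: le_trans H (ltW re). Qed.

Lemma local_rep_out F u : supported F -> r < `|u - a| -> local_rep F u = 0.
Proof.
move=> [_ F0] ru; rewrite /local_rep; case: ifP => // /ltW /ballN [cu _].
by apply: F0 => -[_]; rewrite (cod_invK cu) leNgt ru.
Qed.

Lemma local_rep_in F u : supported F -> cod c u -> local_rep F u = F (chart_inv c u).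
Proof.
move=> [_ F0] cu; rewrite /local_rep; case: ifP => // /negbT; rewrite -leNgt => eu.
by rewrite F0 // => -[_]; rewrite (cod_invK cu) leNgt (lt_le_trans re eu).
Qed.

Lemma testfun_local_rep F : supported F -> testfun (local_rep F).
Proof.
move=> sF; have E : local_rep F = cut_off_ball a e (local_rep F).
  apply/funext => u; rewrite /cut_off_ball; case: ifP => // /negbT; rewrite -ltNge => eu.
  exact: local_rep_out sF (lt_trans re eu).
rewrite E; apply: (@testfun_cut_off _ _ a e (cod c)) => [|u /ballN []//||u eu].
- exact: (@cod_open _ _ _ c).
- have E' u : cod c u -> (F \o chart_inv c) u = local_rep F u.
    by move=> cu; rewrite /= (local_rep_in sF cu).
  exact: (smooth_on_ext (@cod_open _ _ _ c) E' (Smooth_chart sF.1 ac)).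
- exact: local_rep_out sF (lt_le_trans re eu).
Qed.

Definition chart_integral F := iterated_integral (local_rep F).

Lemma supported_smooth F : supported F -> Smooth F. Proof. by case. Qed.

Lemma supportedM F G : supported F -> Smooth G -> supported (fun y => F y * G y).
Proof. by move=> [sF F0] sG; split=> [|y /F0 ->]; [exact: SmoothM|rewrite mul0r]. Qed.

Lemma supported_lin (k : R) F G : supported F -> supported G ->
  supported (fun y => k * F y + G y).
Proof.
move=> [sF F0] [sG G0]; split=> [|y Ny]; last by rewrite F0 // G0 // mulr0 addr0.
by apply: SmoothD => //; exact: SmoothZ.
Qed.

Lemma supported_zero : supported (fun=> 0).
Proof. by split => //; exact: Smooth_cst. Qed.

Lemma supported_vfield F X : supported F -> VField X -> supported (fun y => X y F).
Proof.
move=> [sF F0] vX; split; first exact: vfield_smooth.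
move=> y yN; have t := vfield_tangent y vX.
rewrite (tangent_local t sF (Smooth_cst 0)); first exact: tangent_cst t.
by apply: filterS (near_chart_ball cod_r yN) => z /F0.
Qed.

Lemma chart_integral_lin (k : R) F G : supported F -> supported G ->
  chart_integral (fun y => k * F y + G y) = k * chart_integral F + chart_integral G.
Proof.
move=> sF sG; rewrite /chart_integral -(iterated_integral_lin k (testfun_local_rep sF) (testfun_local_rep sG)).
congr iterated_integral; apply/funext => u; rewrite /local_rep.
by case: ifP => // _; rewrite mulr0 addr0.
Qed.

Lemma chart_integral_zero : chart_integral (fun=> 0) = 0.
Proof.
rewrite /chart_integral -[RHS](@iterated_integral0 R d); congr iterated_integral.
by apply/funext => u; rewrite /local_rep; case: ifP.
Qed.

Lemma chart_integral_sum k (F : 'I_k -> M -> R) : (forall i, supported (F i)) ->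
  supported (fun y => \sum_i F i y) /\
  chart_integral (fun y => \sum_i F i y) = \sum_i chart_integral (F i).
Proof.
move=> sF; elim: (index_enum _) => [|i s [IH1 IH2]].
  have -> : (fun y => \sum_(i <- [::]) F i y) = fun=> 0 by apply/funext => y; rewrite big_nil.
  by rewrite big_nil chart_integral_zero; split => //; exact: supported_zero.
have -> : (fun y => \sum_(j <- i :: s) F j y) = fun y => 1 * F i y + \sum_(j <- s) F j y.
  by apply/funext => y; rewrite big_cons mul1r.
split; first exact: supported_lin.
by rewrite chart_integral_lin // IH2 big_cons mul1r.
Qed.

(** In the chart this is the integral of a partial derivative of a test function. *)
Lemma chart_integral_coordinate (K : 'I_d -> vfield M) F i : (forall j, VField (K j)) ->
  (forall y, N y -> forall j, K j y = coordinate_vector c j y) -> supported F ->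
  chart_integral (fun y => K i y F) = 0.
Proof.
move=> vK KE sF; rewrite -[RHS](iterated_integral_partial i (testfun_local_rep sF)).
congr iterated_integral; apply/funext => u; have [eu|eu] := ltP `|u - a| e; last first.
  rewrite (local_rep_out (supported_vfield sF (vK i)) (lt_le_trans re eu)).
  have H : \forall w \near u, local_rep F w = 0.
    by apply: filterS (near_outside_ball (lt_le_trans re eu)) => w; exact: local_rep_out.
  by rewrite (near_eq_derive _ H) derive_cst.
have [cu Nu] := ballN (ltW eu).
rewrite (local_rep_in (supported_vfield sF (vK i)) cu) (KE _ Nu).
rewrite (coordinate_vectorE _ _ _ sF.1) (cod_invK cu); apply: near_eq_derive.
by apply: (open_near (@cod_open _ _ _ c) cu) => w cw; rewrite (local_rep_in sF cw).
Qed.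

Lemma chart_integral_gt0 F x : supported F -> (forall y, 0 <= F y) -> chart_dom c x ->
  `|chart_map c x - a| < e -> 0 < F x -> 0 < chart_integral F.
Proof.
move=> sF F0 cx ex Fx; apply: (@iterated_integral_gt0 R d _ (chart_map c x) (testfun_local_rep sF)).
  by move=> u; rewrite /local_rep; case: ifP.
by rewrite (local_rep_in sF (cod_map cx)) (chart_mapK cx).
Qed.

Lemma supported_compact F : supported F ->
  compact_support F /\ closure [set x | F x != 0] `<=` chart_dom c.
Proof.
move=> [_ F0]; have cB : compact (chart_ball c a r) by exact: compact_chart_ball.
have clB : closed (chart_ball c a r).
  exact: compact_closed (@manifold_hausdorff _ _ M) cB.
have sub : closure [set x | F x != 0] `<=` chart_ball c a r.
  rewrite [X in _ `<=` X](proj1 (closure_id _) clB); apply: closure_subset => y /= Fy.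
  by apply: contrapT => /F0 /eqP; rewrite (negbTE Fy).
split; last by move=> y /sub [].
by apply: subclosed_compact cB sub; exact: closed_closure.
Qed.

(** The defining property of the Riemannian volume, with the density replaced by
    a smooth function S on the whole manifold. *)
Lemma volume_integral (mu : {measure set (g_sigma_algebraType (@open M)) -> \bar R}) S F :
  is_riemannian_volume g mu ->
  (forall y, N y -> S y = Num.sqrt (\det (gram g c y))) -> Smooth S -> supported F ->
  (\int[mu]_(x in [set: M]) (F x)%:E)%E = (chart_integral (fun y => F y * S y))%:E.
Proof.
move=> vol SE sS sF; have [cF dF] := supported_compact sF.
have ctF : continuous F by case: sF => -[/smooth_continuous].
rewrite (vol c ac F ctF cF dF); congr (_%:E); congr iterated_integral.
apply/funext => u; rewrite /local_rep; case: ifPn => [cu|cu].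
  have {}cu : cod c u by move: cu; rewrite inE.
  case: ifP => [eu|eu]; first by rewrite SE //; exact: (ballN (ltW eu)).2.
  have := local_rep_in sF cu; rewrite /local_rep eu => <-; by rewrite mul0r.
case: ifP => // eu; case/negP: cu; rewrite inE; exact: (ballN (ltW eu)).1.
Qed.

End ChartIntegral.

(** * Algebraic identities and inequalities *)

Section CofactorTrace.
Context {R : realType} {d : nat}.
Implicit Types (A B P : 'M[R]_d).

Lemma sum_cofactor A B : \sum_i \sum_j A i j * cofactor B i j = \tr (A *m \adj B).
Proof.
rewrite /mxtrace; apply: eq_bigr => i _; rewrite mxE; apply: eq_bigr => j _.
by rewrite [\adj B j i]mxE.
Qed.

(** The cofactors of P P^T are the entries of its inverse times its determinant,
    so that the sum computes the trace of t in another basis. *)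
Lemma trace_gram P (t : 'M[R]_d) : P \in unitmx ->
  \sum_i \sum_j (P *m t *m P^T) i j * cofactor (P *m P^T) i j = \det (P *m P^T) * \tr t.
Proof.
move=> uP; rewrite sum_cofactor; set G := P *m P^T.
have E : P^T *m \adj G *m P = (\det G)%:M.
  have H : P *m (P^T *m \adj G) = (\det G)%:M by rewrite mulmxA mul_mx_adj.
  by rewrite -(mulKmx uP (P^T *m \adj G)) H mul_mx_scalar -scalemxAl mulVmx // scalemx1.
rewrite -!mulmxA mxtrace_mulC -!mulmxA (mulmxA P^T) E mul_mx_scalar.
by rewrite mxtraceZ.
Qed.

End CofactorTrace.

(** Relations between real numbers to which the tensor identities below reduce;
    there is one hypothesis for each identity that is used. *)
Section Arithmetic.
Context {R : realType}.

Lemma skew_arith (a b c e k l p q : R) : a + b + (c + e) - (k + c + (b + l)) = p + q ->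
  a - k - p = - (e - l - q).
Proof. lra. Qed.

Lemma bianchi_arith (l1 l2 l3 r1 r2 r3 p1 q1 p2 q2 q3 c : R) :
  l1 = p1 + q1 -> r1 = p2 + q2 -> l3 = - p2 -> r3 = - p1 -> l2 = r2 + c + q3 -> c = 0 ->
  q1 = q2 + q3 -> l1 - l2 - l3 = r1 - r2 - r3.
Proof. lra. Qed.

Lemma jacobi_arith (a b c : R) : a + b + c = 0 -> a = - b + - c.
Proof. lra. Qed.

Lemma self_opp (a : R) : a = - a -> a = 0.
Proof. lra. Qed.

End Arithmetic.

Section BochnerArithmetic.
Context {R : realType}.
Implicit Types (a b c d e k l p q r s t w : R).

Lemma sub_sub_arith a b c : c = a - b - (a - b - c).
Proof. ring. Qed.

Lemma double_arith a : a + a = 2 * a.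
Proof. ring. Qed.

Lemma half_arith a b : 2^-1 * (2 * a - b - b) = a - b.
Proof. by field. Qed.

Lemma horizontal_arith t1 t2 N K b k w' r c1 a p q s w c2 l s' q' d :
  t1 = c1 + a - (p + q) -> t2 = a - s -> N = p - s - w -> K = c1 - c2 - b ->
  b = k - s' - r -> k = l - w' -> w' = - w -> r = q' -> q' = q ->
  t1 - t2 - c2 - d = K + l - 2 * q - N - (s' + d).
Proof. by move=> -> -> -> -> -> -> -> -> ->; ring. Qed.

Lemma vertical_arith t1 t2 K b k r c1 a c2 l s d :
  t1 = c1 + a -> t2 = a -> K = c1 - c2 - b -> b = k - s - r -> r = 0 -> k = l -> K = 0 ->
  t1 - t2 - c2 - d = l - (s + d).
Proof. lra. Qed.

Lemma sum_eq0r (N : nat) (a b c : 'I_N -> R) : (forall i, a i = b i - c i) -> \sum_i c i = 0 ->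
  \sum_i a i = \sum_i b i.
Proof. by move=> abc c0; rewrite (eq_bigr _ (fun i _ => abc i)) sumrB c0 subr0. Qed.

End BochnerArithmetic.

Section MatrixInequality.
Context {R : realType}.

(** The variance of the a i is nonnegative. *)
Lemma sum_sqr_le n (a : 'I_n -> R) : (0 < n)%N ->
  n%:R^-1 * (\sum_i a i) ^+ 2 <= \sum_i a i ^+ 2.
Proof.
move=> n0; have nn : (n%:R : R) != 0 by rewrite pnatr_eq0 -lt0n.
set s := \sum_i a i; pose t := s / n%:R.
have H : 0 <= \sum_i (a i - t) ^+ 2 by apply: sumr_ge0 => i _; exact: sqr_ge0.
have E : \sum_i (a i - t) ^+ 2 = \sum_i a i ^+ 2 - n%:R^-1 * s ^+ 2.
  transitivity (\sum_i (a i ^+ 2 - 2 * t * a i + t ^+ 2)).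
    by apply: eq_bigr => i _; ring.
  rewrite big_split sumrB /= -mulr_sumr -/s sumr_const card_ord -[t ^+ 2 *+ n]mulr_natl /t.
  by field.
by rewrite -subr_ge0 -E.
Qed.

(** Symmetric and antisymmetric parts are orthogonal, and the symmetric part is
    at least as large as its diagonal. *)
Lemma matrix_sqr_ge n (a b : 'I_n -> 'I_n -> R) : (0 < n)%N ->
  (forall i j, a i j = a j i - b i j) ->
  n%:R^-1 * (\sum_i a i i) ^+ 2 + 4^-1 * \sum_i \sum_j b i j ^+ 2 <= \sum_i \sum_j a i j ^+ 2.
Proof.
move=> n0 ab; pose s i j := 2^-1 * (a i j + a j i).
have E : \sum_i \sum_j a i j ^+ 2 =
    \sum_i \sum_j s i j ^+ 2 + 4^-1 * \sum_i \sum_j b i j ^+ 2.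
  have C : \sum_i \sum_j a i j ^+ 2 = \sum_i \sum_j a j i ^+ 2 by rewrite exchange_big.
  have -> : \sum_i \sum_j a i j ^+ 2 = 2^-1 * (\sum_i \sum_j a i j ^+ 2 + \sum_i \sum_j a j i ^+ 2).
    by rewrite -C; field.
  rewrite mulr_sumr -!big_split mulr_sumr /=; apply: eq_bigr => i _.
  rewrite mulr_sumr -!big_split mulr_sumr /=; apply: eq_bigr => j _.
  by rewrite /s ab; field.
rewrite E lerD2r; apply: le_trans (sum_sqr_le _ n0) _.
apply: ler_sum => i _; rewrite (bigD1 i) //= (_ : s i i = a i i); last by rewrite /s; field.
by rewrite lerDl; apply: sumr_ge0 => j _; exact: sqr_ge0.
Qed.

(** The hypothesis is |U - e W|^2 >= 0 for vectors with |U|^2 = u, <U, W> = q and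
    |W|^2 = w. *)
Lemma square_arith (u q w e : R) : 0 < e -> 0 <= u + - e * q + - e * (q + - e * w) ->
  2 * q <= e^-1 * u + e * w.
Proof.
move=> e0 H; have e1 : e != 0 by rewrite gt_eqF.
have E : e * (e^-1 * u + e * w - 2 * q) = u + - e * q + - e * (q + - e * w) by field.
by rewrite -subr_ge0 -(pmulr_rge0 _ e0) E.
Qed.

Lemma final_arith (ric a2 q b2 l2 k t ga gv r1 r2 e kap : R) :
  0 < e -> r1 * ga <= ric -> l2 + k <= a2 -> r2 * gv <= k -> t <= kap * ga ->
  2 * q <= e^-1 * t + e * b2 ->
  l2 + (r1 - kap / e) * ga + r2 * gv <= ric + a2 - 2 * q + e * b2.
Proof.
move=> e0 h1 h2 h3 h4 h5; have ei : 0 <= e^-1 by rewrite invr_ge0 ltW.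
have h6 := ler_wpM2l ei h4.
rewrite mulrBl (_ : kap / e * ga = e^-1 * (kap * ga)); last by ring.
move: (e^-1 * t) (e^-1 * (kap * ga)) (r1 * ga) (r2 * gv) (e * b2) h1 h3 h5 h6 => *.
lra.
Qed.

End MatrixInequality.

Local Opaque bracket.

(** * The Bott connection *)

Section Bott.
Context {R : realType} {n m : nat} {M : manifold R (n + m)}.
Implicit Types (f h : M -> R) (x y : M) (X Y Z W : vfield M) (u v w : (M -> R) -> R).
Variable g : M -> ((M -> R) -> R) -> ((M -> R) -> R) -> R.
Hypothesis g_metric : is_metric g.
Variable V : M -> set ((M -> R) -> R).
Hypothesis V_foliation : is_riemannian_foliation g V.
Variable D : vfield M -> vfield M -> vfield M.
Hypothesis D_levi_civita : is_levi_civita g D.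
Hypothesis leaves_geodesic : totally_geodesic_leaves V D.

Local Notation hor := (horizontal g V).
Local Notation HP := (hproj g V).
Local Notation VP := (vproj g V).
Local Notation nab := (bott g V D).
Local Notation tor := (torsion g V D).
Local Notation hg f := (hgrad g V f).
Local Notation vg f := (vgrad g V f).
Local Notation curv := (curvature g V D).
Local Notation ntor := (nabla_torsion g V D).
Local Notation JJ := (J g V D).
Local Notation "0%F" := (fun (_ : M) (_ : M -> R) => 0).

Lemma vfield_D X Y : VField X -> VField Y -> VField (D X Y).
Proof. by move=> [vX] [vY]; have [H _ _ _ _] := D_levi_civita; constructor; exact: H. Qed.

Lemma D_combl h X X' Y : Smooth h -> VField X -> VField X' -> VField Y ->
  D (vadd (vscale h X) X') Y = vadd (vscale h (D X Y)) (D X' Y).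
Proof. by move=> [sh] [vX] [vX'] [vY]; have [_ H _ _ _] := D_levi_civita; exact: H. Qed.

Lemma D_combr h X Y Y' : Smooth h -> VField X -> VField Y -> VField Y' ->
  D X (vadd (vscale h Y) Y') =
  vadd (vadd (vscale (fun x => X x h) Y) (vscale h (D X Y))) (D X Y').
Proof. by move=> [sh] [vX] [vY] [vY']; have [_ _ H _ _] := D_levi_civita; exact: H. Qed.

Lemma D_bracket X Y : VField X -> VField Y -> vsub (D X Y) (D Y X) = bracket X Y.
Proof. by move=> [vX] [vY]; have [_ _ _ H _] := D_levi_civita; exact: H. Qed.

Lemma D_metric X Y Z x : VField X -> VField Y -> VField Z ->
  Z x (ip g X Y) = ip g (D Z X) Y x + ip g X (D Z Y) x.
Proof. by move=> [vX] [vY] [vZ]; have [_ _ _ _ H] := D_levi_civita; exact: H. Qed.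

Lemma D0l Y : VField Y -> D 0%F Y = 0%F.
Proof.
move=> vY; have := D_combl (Smooth_cst (-1)) (vfield_zero (M := M)) (vfield_zero (M := M)) vY.
have -> : vadd (vscale (fun=> -1) 0%F) 0%F = 0%F :> vfield M.
  by apply/funext => x; apply/funext => f; rewrite /vadd /vscale mulr0 addr0.
by move=> ->; apply/funext => x; apply/funext => f; rewrite /vadd /vscale mulN1r addNr.
Qed.

Lemma D0r X : VField X -> D X 0%F = 0%F.
Proof.
move=> vX; have := D_combr (Smooth_cst (-1)) vX (vfield_zero (M := M)) (vfield_zero (M := M)).
have -> : vadd (vscale (fun=> -1) 0%F) 0%F = 0%F :> vfield M.
  by apply/funext => x; apply/funext => f; rewrite /vadd /vscale mulr0 addr0.
by move=> ->; apply/funext => x; apply/funext => f; rewrite /vadd /vscale mulN1r mulr0 add0r addNr.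
Qed.

Lemma hprojD X Y : VField X -> VField Y -> HP (vadd X Y) = vadd (HP X) (HP Y).
Proof. by move=> vX vY; rewrite -[in LHS]vadd_scale1 (hproj_comb g_metric V_foliation) // vadd_scale1. Qed.

Lemma hproj0 : HP 0%F = 0%F.
Proof. by apply: (hproj_vfield g_metric V_foliation) => x; exact: vert0 V_foliation x. Qed.

Lemma vproj0 : VP 0%F = 0%F.
Proof. by apply: (vproj_hfield g_metric V_foliation) => x; apply: hor0. Qed.

Lemma vadd0 X : vadd X 0%F = X.
Proof. by apply/funext => x; apply/funext => f; rewrite /vadd addr0. Qed.

Lemma add0v X : vadd 0%F X = X.
Proof. by apply/funext => x; apply/funext => f; rewrite /vadd add0r. Qed.

Lemma vaddA X Y Z : vadd X (vadd Y Z) = vadd (vadd X Y) Z.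
Proof. by apply/funext => x; apply/funext => f; rewrite /vadd addrA. Qed.

Lemma hprojZ h X : Smooth h -> VField X -> HP (vscale h X) = vscale h (HP X).
Proof.
move=> sh vX; rewrite -[vscale h X]vadd0 (hproj_comb g_metric V_foliation) //; last exact: vfield_zero.
by rewrite hproj0 vadd0.
Qed.

Lemma vopp_scale X : vopp X = vscale (fun=> -1) X.
Proof. by apply/funext => x; apply/funext => f; rewrite /vopp /vscale mulN1r. Qed.

Lemma hprojN X : VField X -> HP (vopp X) = vopp (HP X).
Proof. by move=> vX; rewrite vopp_scale hprojZ -?vopp_scale //; exact: Smooth_cst. Qed.

Lemma is_horizontal_hproj X : VField X -> is_horizontal g V (HP X).
Proof. by move=> vX x; exact: hproj_horizontal. Qed.

Lemma is_vertical_vproj X : VField X -> is_vertical V (VP X).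
Proof. by move=> vX x; exact: vproj_vertical. Qed.

Lemma vfield_HP X : VField X -> VField (HP X).
Proof. exact: vfield_hproj. Qed.

Lemma vfield_VP X : VField X -> VField (VP X).
Proof. exact: vfield_vproj. Qed.

#[local] Hint Resolve vfield_D vfield_HP vfield_VP vfield_bracket vfieldD vfieldZ
  vfieldN vfieldB vfield_zero Smooth_cst SmoothN SmoothM SmoothD vfield_smooth Smooth_ip
  is_horizontal_hproj is_vertical_vproj : vf.
Local Ltac vf := auto 8 with vf.

Lemma D_vertical X Y : VField X -> VField Y -> is_vertical V X -> is_vertical V Y ->
  is_vertical V (D X Y).
Proof. by move=> [vX] [vY] VX VY; exact: leaves_geodesic vX vY VX VY. Qed.

Lemma vfield_nab X Y : VField X -> VField Y -> VField (nab X Y).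
Proof. by move=> vX vY; rewrite /bott; vf. Qed.
#[local] Hint Resolve vfield_nab : vf.

Lemma vfield_tor X Y : VField X -> VField Y -> VField (tor X Y).
Proof. by move=> vX vY; rewrite /torsion; vf. Qed.
#[local] Hint Resolve vfield_tor : vf.

Lemma hproj_VP X : VField X -> HP (VP X) = 0%F.
Proof. by move=> vX; apply: (hproj_vfield g_metric V_foliation); vf. Qed.

Lemma vproj_HP X : VField X -> VP (HP X) = 0%F.
Proof. by move=> vX; apply: (vproj_hfield g_metric V_foliation); vf. Qed.

Lemma hproj_HP X : VField X -> HP (HP X) = HP X.
Proof. by move=> vX; apply: (hproj_field g_metric V_foliation); vf. Qed.

Lemma vproj_VP X : VField X -> VP (VP X) = VP X.
Proof. by move=> vX; apply: (vproj_field g_metric V_foliation); vf. Qed.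

Lemma hproj_comb3 a h X Y Z : Smooth h -> VField X -> VField Y -> VField Z ->
  HP (vadd (vadd (vscale a X) (vscale h Y)) Z) =
  vadd (vadd (vscale a (HP X)) (vscale h (HP Y))) (HP Z).
Proof.
move=> sh vX vY vZ; rewrite -!vaddA (hproj_comb g_metric V_foliation a vX).
  by rewrite (hproj_comb g_metric V_foliation h vY vZ).
by apply: vfieldD => //; exact: vfieldZ.
Qed.

Lemma vproj_comb3 a h X Y Z : Smooth h -> VField X -> VField Y -> VField Z ->
  VP (vadd (vadd (vscale a X) (vscale h Y)) Z) =
  vadd (vadd (vscale a (VP X)) (vscale h (VP Y))) (VP Z).
Proof.
move=> sh vX vY vZ; rewrite -!vaddA (vproj_comb g_metric V_foliation a vX).
  by rewrite (vproj_comb g_metric V_foliation h vY vZ).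
by apply: vfieldD => //; exact: vfieldZ.
Qed.

Lemma nab_combl h X X' Y : Smooth h -> VField X -> VField X' -> VField Y ->
  nab (vadd (vscale h X) X') Y = vadd (vscale h (nab X Y)) (nab X' Y).
Proof.
move=> sh vX vX' vY.
have [hX hX' hY] := And3 (vfield_HP vX) (vfield_HP vX') (vfield_HP vY).
have [wX wX' wY] := And3 (vfield_VP vX) (vfield_VP vX') (vfield_VP vY).
rewrite /bott (hproj_comb g_metric V_foliation h vX vX') (vproj_comb g_metric V_foliation h vX vX').
rewrite (D_combl sh hX hX' hY) (D_combl sh wX wX' wY).
rewrite (bracket_combl sh wX wX' hY) (bracket_combl sh hX hX' wY).
rewrite (hproj_comb g_metric V_foliation h (vfield_D hX hY) (vfield_D hX' hY)).
rewrite (vproj_comb g_metric V_foliation h (vfield_D wX wY) (vfield_D wX' wY)).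
rewrite (hproj_comb3 _ sh wX (vfield_bracket wX hY) (vfield_bracket wX' hY)).
rewrite (vproj_comb3 _ sh hX (vfield_bracket hX wY) (vfield_bracket hX' wY)).
rewrite (hproj_VP vX) (vproj_HP vX).
apply/funext => x; apply/funext => f; rewrite /vadd /vscale !mulr0 !add0r.
move: (HP _ x f) (HP _ x f) (HP _ x f) (HP _ x f) (VP _ x f) (VP _ x f) (VP _ x f) (VP _ x f).
by move=> *; ring.
Qed.

Lemma nab_combr h X Y Y' : Smooth h -> VField X -> VField Y -> VField Y' ->
  nab X (vadd (vscale h Y) Y') =
  vadd (vadd (vscale (fun x => X x h) Y) (vscale h (nab X Y))) (nab X Y').
Proof.
move=> sh vX vY vY'.
have [hX hY hY'] := And3 (vfield_HP vX) (vfield_HP vY) (vfield_HP vY').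
have [wX wY wY'] := And3 (vfield_VP vX) (vfield_VP vY) (vfield_VP vY').
rewrite /bott (hproj_comb g_metric V_foliation h vY vY') (vproj_comb g_metric V_foliation h vY vY').
rewrite (D_combr sh hX hY hY') (D_combr sh wX wY wY').
rewrite (bracket_combr sh wX hY hY') (bracket_combr sh hX wY wY').
rewrite (hproj_comb3 _ sh hY (vfield_D hX hY) (vfield_D hX hY')).
rewrite (vproj_comb3 _ sh wY (vfield_D wX wY) (vfield_D wX wY')).
rewrite (hproj_comb3 _ sh hY (vfield_bracket wX hY) (vfield_bracket wX hY')).
rewrite (vproj_comb3 _ sh wY (vfield_bracket hX wY) (vfield_bracket hX wY')).
rewrite (hproj_HP vY) (vproj_VP vY).
have E x f : Y x f = HP Y x f + VP Y x f by rewrite {1}(proj_decomp g V Y).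
have Eh x : X x h = HP X x h + VP X x h by rewrite {1}(proj_decomp g V X).
apply/funext => x; apply/funext => f; rewrite /vadd /vscale Eh E.
move: (HP X x h) (VP X x h) (HP Y x f) (VP Y x f) => a b c e.
move: (HP _ x f) (HP _ x f) (HP _ x f) (HP _ x f) (VP _ x f) (VP _ x f) (VP _ x f) (VP _ x f).
by move=> *; ring.
Qed.

Lemma nabDl X X' Y : VField X -> VField X' -> VField Y ->
  nab (vadd X X') Y = vadd (nab X Y) (nab X' Y).
Proof. by move=> vX vX' vY; rewrite -vadd_scale1 nab_combl ?vadd_scale1 //; vf. Qed.

Lemma nabDr X Y Y' : VField X -> VField Y -> VField Y' ->
  nab X (vadd Y Y') = vadd (nab X Y) (nab X Y').
Proof.
move=> vX vY vY'; rewrite -[in LHS]vadd_scale1 nab_combr //; last by vf.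
apply/funext => x; apply/funext => f; rewrite /vadd /vscale.
by rewrite (tangent_cst _ (vfield_tangent x vX)) mul0r add0r mul1r.
Qed.

Lemma nab0l Y : VField Y -> nab 0%F Y = 0%F.
Proof.
move=> vY; have := nab_combl (Smooth_cst (-1)) (vfield_zero (M := M)) (vfield_zero (M := M)) vY.
have -> : vadd (vscale (fun=> -1) 0%F) 0%F = 0%F :> vfield M.
  by apply/funext => x; apply/funext => f; rewrite /vadd /vscale mulr0 addr0.
by move=> ->; apply/funext => x; apply/funext => f; rewrite /vadd /vscale mulN1r addNr.
Qed.

Lemma nab0r X : VField X -> nab X 0%F = 0%F.
Proof.
move=> vX; have := nab_combr (Smooth_cst (-1)) vX (vfield_zero (M := M)) (vfield_zero (M := M)).
have -> : vadd (vscale (fun=> -1) 0%F) 0%F = 0%F :> vfield M.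
  by apply/funext => x; apply/funext => f; rewrite /vadd /vscale mulr0 addr0.
by move=> ->; apply/funext => x; apply/funext => f; rewrite /vadd /vscale mulN1r mulr0 add0r addNr.
Qed.

Lemma nabZl h X Y : Smooth h -> VField X -> VField Y ->
  nab (vscale h X) Y = vscale h (nab X Y).
Proof.
move=> sh vX vY; rewrite -[vscale h X]vadd0 nab_combl //; last by vf.
by rewrite nab0l // vadd0.
Qed.

Lemma nabNl X Y : VField X -> VField Y -> nab (vopp X) Y = vopp (nab X Y).
Proof. by move=> vX vY; rewrite !vopp_scale nabZl //; vf. Qed.

Lemma nabBl X X' Y : VField X -> VField X' -> VField Y ->
  nab (vsub X X') Y = vsub (nab X Y) (nab X' Y).
Proof. by move=> vX vX' vY; rewrite /vsub nabDl ?nabNl //; vf. Qed.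

(** * The connection preserves both distributions *)

Lemma nab_horE X Y : VField X -> VField Y -> is_horizontal g V Y ->
  nab X Y = vadd (HP (D (HP X) Y)) (HP (bracket (VP X) Y)).
Proof.
move=> vX vY hY; rewrite /bott (hproj_field g_metric V_foliation hY).
rewrite (vproj_hfield g_metric V_foliation hY) bracket0r ?D0r ?vproj0; try by vf.
by rewrite !vadd0.
Qed.

Lemma nab_vertE X Y : VField X -> VField Y -> is_vertical V Y ->
  nab X Y = vadd (VP (bracket (HP X) Y)) (VP (D (VP X) Y)).
Proof.
move=> vX vY VY; rewrite /bott (vproj_field g_metric V_foliation VY).
rewrite (hproj_vfield g_metric V_foliation VY) bracket0r ?D0r ?hproj0; try by vf.
by rewrite !add0v.
Qed.

Lemma nab_hor X Y : VField X -> VField Y -> is_horizontal g V Y -> is_horizontal g V (nab X Y).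
Proof.
move=> vX vY hY x; rewrite nab_horE //; apply: (hor_add g_metric V_foliation).
  by apply: is_horizontal_hproj; vf.
by apply: is_horizontal_hproj; vf.
Qed.

Lemma nab_vert X Y : VField X -> VField Y -> is_vertical V Y -> is_vertical V (nab X Y).
Proof.
move=> vX vY VY x; rewrite nab_vertE //; apply: (vert_add V_foliation).
  by apply: is_vertical_vproj; vf.
by apply: is_vertical_vproj; vf.
Qed.

Lemma nab_hh X Y : VField X -> VField Y -> is_horizontal g V X -> is_horizontal g V Y ->
  nab X Y = HP (D X Y).
Proof.
move=> vX vY hX hY; rewrite nab_horE // (hproj_field g_metric V_foliation hX).
by rewrite (vproj_hfield g_metric V_foliation hX) bracket0l ?hproj0 ?vadd0.
Qed.

Lemma nab_vh X Y : VField X -> VField Y -> is_vertical V X -> is_horizontal g V Y ->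
  nab X Y = HP (bracket X Y).
Proof.
move=> vX vY VX hY; rewrite nab_horE // (vproj_field g_metric V_foliation VX).
by rewrite (hproj_vfield g_metric V_foliation VX) D0l ?hproj0 ?add0v.
Qed.

Lemma nab_hv X Y : VField X -> VField Y -> is_horizontal g V X -> is_vertical V Y ->
  nab X Y = VP (bracket X Y).
Proof.
move=> vX vY hX VY; rewrite nab_vertE // (hproj_field g_metric V_foliation hX).
by rewrite (vproj_hfield g_metric V_foliation hX) D0l ?vproj0 ?vadd0.
Qed.

Lemma nab_vv X Y : VField X -> VField Y -> is_vertical V X -> is_vertical V Y ->
  nab X Y = VP (D X Y).
Proof.
move=> vX vY VX VY; rewrite nab_vertE // (vproj_field g_metric V_foliation VX).
by rewrite (hproj_vfield g_metric V_foliation VX) bracket0l ?vproj0 ?add0v.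
Qed.

(** * The connection is metric *)

(** Near x the product of horizontal fields is computed from their images under
    the submersion, with coefficients that depend on the base point only. The
    vertical field Z kills the components of the submersion, hence these
    coefficients, and differentiates the images into those of the brackets. *)
Lemma bundle_like Z Y W x : VField Z -> VField Y -> VField W ->
  is_vertical V Z -> is_horizontal g V Y -> is_horizontal g V W ->
  Z x (ip g Y W) = ip g (bracket Z Y) W x + ip g Y (bracket Z W) x.
Proof.
move=> vZ vY vW VZ hY hW.
have [U [p [B [h [[oU Ux sp oB pB] [sh _ _] surj VE gE]]]]] := V_foliation x.
have Sp i : Smooth (p i) by constructor.
have Bx : B (\row_i p i x) by apply: pB; exists x.
have kill y v : U y -> V y v -> forall i, v (p i) = 0.
  move=> Uy; rewrite VE // => -[_ dv] i.
  by have := congr1 (fun r : 'rV[R]_n => r 0 i) dv; rewrite !mxE.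
have /choice [q Hq] : forall ab : 'I_n * 'I_n, exists q : M -> R,
    Smooth q /\ \forall y \near x, h (\row_i p i y) ab.1 ab.2 = q y.
  move=> [a b]; have [q sq qE] := Smooth_at_comp oB (sh a b) Sp Bx.
  by exists q.
have nU : \forall y \near x, U y by exact: open_nbhs_nbhs.
have nq : \forall y \near x, forall ab, h (\row_i p i y) ab.1 ab.2 = q ab y.
  by apply: filter_forall => ab; exact: (Hq ab).2.
have Zq ab : Z x (q ab) = 0.
  have [sq qE] := Hq ab.
  rewrite (tangent_chain oB (sh ab.1 ab.2) Sp Bx sq _ (vfield_tangent x vZ)).
    by rewrite big1 // => j _; rewrite (kill x) ?mul0r //.
  by apply: filterS qE => y ->.
have formula X1 X2 y : U y -> (forall ab, h (\row_i p i y) ab.1 ab.2 = q ab y) ->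
    hor y (X1 y) -> hor y (X2 y) ->
    ip g X1 X2 y = \sum_a \sum_b (X1 y (p a) * q (a, b) y) * X2 y (p b).
  move=> Uy qy h1 h2; rewrite /ip (gE y Uy _ _ h1 h2) mxE exchange_big /=.
  apply: eq_bigr => b _; rewrite mxE mulr_suml; apply: eq_bigr => a _.
  by rewrite !mxE -(qy (a, b)).
have Zx := vfield_tangent x vZ.
have sY a := vfield_smooth vY (Sp a); have sW a := vfield_smooth vW (Sp a).
have sq ab : Smooth (q ab) by exact: (Hq ab).1.
have sF a b : Smooth (fun y => (Y y (p a) * q (a, b) y) * W y (p b)).
  by apply: SmoothM => //; exact: SmoothM.
have sFF : Smooth (fun y => \sum_a \sum_b (Y y (p a) * q (a, b) y) * W y (p b)).
  by apply: Smooth_sum => a; exact: Smooth_sum.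
rewrite (tangent_local Zx (Smooth_ip g_metric vY vW) sFF); last first.
  by apply: filterS2 nU nq => y Uy qy; exact: formula Uy qy (hY y) (hW y).
rewrite (tangent_sum Zx); last by move=> a; exact: Smooth_sum.
have Zbr X1 a : VField X1 -> Z x (fun y => X1 y (p a)) = HP (bracket Z X1) x (p a).
  move=> v1; have vb : VField (bracket Z X1) by vf.
  transitivity (bracket Z X1 x (p a)).
    rewrite bracketE [X in _ - X](_ : _ = 0) ?subr0//.
    rewrite (tangent_local (vfield_tangent x v1) (vfield_smooth vZ (Sp a)) (Smooth_cst 0)).
      exact: tangent_cst (vfield_tangent x v1).
    by apply: filterS nU => y Uy; exact: kill Uy (VZ y) a.
  have := kill x _ Ux (vproj_vertical g_metric V_foliation x vb) a.
  by rewrite /vproj /vsub /vadd /vopp => /eqP; rewrite subr_eq0 => /eqP.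
have vbY : VField (bracket Z Y) by vf.
have vbW : VField (bracket Z W) by vf.
rewrite -(ip_hproj g_metric V_foliation vbY (hW x)).
rewrite [X in _ + X](ipC g_metric) // -(ip_hproj g_metric V_foliation vbW (hY x)).
rewrite -[X in _ + X](ipC g_metric) //; last by vf.
have qx := nbhs_singleton nq.
rewrite !(formula _ _ x Ux qx); try by first [exact: hY | exact: hW | exact: hproj_horizontal].
rewrite -big_split; apply: eq_bigr => a _ /=.
rewrite (tangent_sum Zx) // -big_split; apply: eq_bigr => b _ /=.
rewrite (tangentM Zx (SmoothM (sY a) (sq (a, b))) (sW b)) (tangentM Zx (sY a) (sq (a, b))).
by rewrite Zq Zbr // Zbr //; ring.
Qed.

Lemma ipDr X Y Z x : VField X -> VField Y -> VField Z ->
  ip g Z (vadd X Y) x = ip g Z X x + ip g Z Y x.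
Proof.
move=> vX vY vZ; rewrite (ipC g_metric x vZ (vfieldD vX vY)) (ipDl g_metric x vX vY vZ).
by rewrite (ipC g_metric x vX vZ) (ipC g_metric x vY vZ).
Qed.

Lemma ip_hprojr X Y x : VField X -> VField Y -> hor x (Y x) -> ip g Y (HP X) x = ip g Y X x.
Proof.
move=> vX vY hY; rewrite (ipC g_metric x vY (vfield_HP vX)) (ip_hproj g_metric V_foliation vX hY).
exact: ipC.
Qed.

Lemma ip_vprojr X Y x : VField X -> VField Y -> V x (Y x) -> ip g Y (VP X) x = ip g Y X x.
Proof.
move=> vX vY hY; rewrite (ipC g_metric x vY (vfield_VP vX)) (ip_vproj g_metric V_foliation vX hY).
exact: ipC.
Qed.

(** The Levi-Civita connection deals with the horizontal part of X and the
    bundle-like metric with its vertical part. *)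
Lemma nab_metric_hh X Y W x : VField X -> VField Y -> VField W ->
  is_horizontal g V Y -> is_horizontal g V W ->
  X x (ip g Y W) = ip g (nab X Y) W x + ip g Y (nab X W) x.
Proof.
move=> vX vY vW hY hW; have hX := vfield_HP vX; have wX := vfield_VP vX.
have [dY dW] := (vfield_D hX vY, vfield_D hX vW).
have [bY bW] := (vfield_bracket wX vY, vfield_bracket wX vW).
have H : HP X x (ip g Y W) = ip g (HP (D (HP X) Y)) W x + ip g Y (HP (D (HP X) W)) x.
  rewrite (ip_hproj g_metric V_foliation dY (hW x)) (ip_hprojr dW vY (hY x)).
  exact: D_metric.
have H' : VP X x (ip g Y W) = ip g (HP (bracket (VP X) Y)) W x + ip g Y (HP (bracket (VP X) W)) x.
  rewrite (ip_hproj g_metric V_foliation bY (hW x)) (ip_hprojr bW vY (hY x)).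
  exact: bundle_like wX vY vW (is_vertical_vproj vX) hY hW.
rewrite {1}(proj_decomp g V X) /vadd H H' (nab_horE vX vY hY) (nab_horE vX vW hW).
rewrite (ipDl g_metric x (vfield_HP dY) (vfield_HP bY) vW).
by rewrite (ipDr x (vfield_HP dW) (vfield_HP bW) vY) addrACA.
Qed.

(** For the horizontal part of X the bracket may be replaced by the Levi-Civita
    derivative because the leaves are totally geodesic. *)
Lemma nab_metric_vv X Y W x : VField X -> VField Y -> VField W ->
  is_vertical V Y -> is_vertical V W ->
  X x (ip g Y W) = ip g (nab X Y) W x + ip g Y (nab X W) x.
Proof.
move=> vX vY vW VY VW; have hX := vfield_HP vX; have wX := vfield_VP vX.
have [dY dW] := (vfield_D wX vY, vfield_D wX vW).
have [bY bW] := (vfield_bracket hX vY, vfield_bracket hX vW).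
have H : VP X x (ip g Y W) = ip g (VP (D (VP X) Y)) W x + ip g Y (VP (D (VP X) W)) x.
  rewrite (ip_vproj g_metric V_foliation dY (VW x)) (ip_vprojr dW vY (VY x)).
  exact: D_metric.
have key Y1 Y2 : VField Y1 -> VField Y2 -> is_vertical V Y1 -> is_vertical V Y2 ->
    ip g (bracket (HP X) Y1) Y2 x = ip g (D (HP X) Y1) Y2 x.
  move=> v1 v2 V1 V2; rewrite -(D_bracket hX v1).
  rewrite (ipBl g_metric x (vfield_D hX v1) (vfield_D v1 hX) v2).
  have : Y1 x (ip g (HP X) Y2) = ip g (D Y1 (HP X)) Y2 x + ip g (HP X) (D Y1 Y2) x.
    exact: D_metric.
  have -> : ip g (HP X) Y2 = fun=> 0.
    by apply/funext => y; apply: (ip_hv (V := V)); [exact: is_horizontal_hproj vX y | exact: V2].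
  rewrite (tangent_cst _ (vfield_tangent x v1)).
  rewrite (ip_hv (V := V) (is_horizontal_hproj vX x) (D_vertical v1 v2 V1 V2 x)) addr0 => <-.
  by rewrite subr0.
have H' : HP X x (ip g Y W) = ip g (VP (bracket (HP X) Y)) W x + ip g Y (VP (bracket (HP X) W)) x.
  rewrite (ip_vproj g_metric V_foliation bY (VW x)) (ip_vprojr bW vY (VY x)).
  rewrite (key Y W vY vW VY VW) (ipC g_metric x vY bW) (key W Y vW vY VW VY).
  by rewrite (D_metric x vY vW hX) (ipC g_metric x vY (vfield_D hX vW)).
rewrite {1}(proj_decomp g V X) /vadd H H' (nab_vertE vX vY VY) (nab_vertE vX vW VW).
rewrite (ipDl g_metric x (vfield_VP bY) (vfield_VP dY) vW).
by rewrite (ipDr x (vfield_VP bW) (vfield_VP dW) vY) addrACA.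
Qed.

(** * Torsion *)

Lemma torC X Y : tor Y X = vopp (tor X Y).
Proof.
apply/funext => x; apply/funext => f; rewrite /torsion [bracket Y X]bracketC.
by rewrite /vsub /vadd /vopp; ring.
Qed.

Lemma tor_combl h X X' Y : Smooth h -> VField X -> VField X' -> VField Y ->
  tor (vadd (vscale h X) X') Y = vadd (vscale h (tor X Y)) (tor X' Y).
Proof.
move=> sh vX vX' vY; rewrite /torsion nab_combl // nab_combr // bracket_combl //.
by apply/funext => x; apply/funext => f; rewrite /vsub /vadd /vscale /vopp; ring.
Qed.

Lemma tor_combr h X Y Y' : Smooth h -> VField X -> VField Y -> VField Y' ->
  tor X (vadd (vscale h Y) Y') = vadd (vscale h (tor X Y)) (tor X Y').
Proof.
move=> sh vX vY vY'; rewrite torC tor_combl // [tor Y X]torC [tor Y' X]torC.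
by apply/funext => x; apply/funext => f; rewrite /vadd /vscale /vopp; ring.
Qed.

Lemma tor_hv X Z : VField X -> VField Z -> is_horizontal g V X -> is_vertical V Z ->
  tor X Z = 0%F.
Proof.
move=> vX vZ hX VZ; rewrite /torsion (nab_hv vX vZ hX VZ) (nab_vh vZ vX VZ hX).
rewrite [bracket Z X]bracketC (hprojN (vfield_bracket vX vZ)).
apply/funext => x; apply/funext => f.
by rewrite /vproj /vsub /vadd /vopp opprK subrK subrr.
Qed.

Lemma tor_vh X Z : VField X -> VField Z -> is_horizontal g V X -> is_vertical V Z ->
  tor Z X = 0%F.
Proof.
move=> vX vZ hX VZ; rewrite torC (tor_hv vX vZ hX VZ).
by apply/funext => x; apply/funext => f; rewrite /vopp oppr0.
Qed.

Lemma tor_hh X Y : VField X -> VField Y -> is_horizontal g V X -> is_horizontal g V Y ->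
  tor X Y = vopp (VP (bracket X Y)).
Proof.
move=> vX vY hX hY; rewrite /torsion (nab_hh vX vY hX hY) (nab_hh vY vX hY hX) /vproj.
rewrite -[bracket X Y](D_bracket vX vY) /vsub (hprojD (vfield_D vX vY) (vfieldN (vfield_D vY vX))).
rewrite (hprojN (vfield_D vY vX)).
by apply/funext => x; apply/funext => f; rewrite /vadd /vopp !opprD !opprK addrC.
Qed.

Lemma tor_vv X Y : VField X -> VField Y -> is_vertical V X -> is_vertical V Y ->
  tor X Y = 0%F.
Proof.
move=> vX vY VX VY; rewrite /torsion (nab_vv vX vY VX VY) (nab_vv vY vX VY VX).
rewrite (vproj_field g_metric V_foliation (D_vertical vX vY VX VY)).
rewrite (vproj_field g_metric V_foliation (D_vertical vY vX VY VX)) (D_bracket vX vY).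
by apply/funext => x; apply/funext => f; rewrite /vsub /vadd /vopp subrr.
Qed.

Lemma torDl X X' Y : VField X -> VField X' -> VField Y ->
  tor (vadd X X') Y = vadd (tor X Y) (tor X' Y).
Proof.
move=> vX vX' vY; rewrite -[vadd X X']vadd_scale1 (tor_combl (Smooth_cst 1) vX vX' vY).
exact: vadd_scale1.
Qed.

Lemma torDr X Y Y' : VField X -> VField Y -> VField Y' ->
  tor X (vadd Y Y') = vadd (tor X Y) (tor X Y').
Proof.
move=> vX vY vY'; rewrite -[vadd Y Y']vadd_scale1 (tor_combr (Smooth_cst 1) vX vY vY').
exact: vadd_scale1.
Qed.

Lemma torE X Y : VField X -> VField Y -> tor X Y = tor (HP X) (HP Y).
Proof.
move=> vX vY; have [hX wX] := (vfield_HP vX, vfield_VP vX).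
have [hY wY] := (vfield_HP vY, vfield_VP vY).
rewrite {1}(proj_decomp g V X) (torDl hX wX vY) {1 2}(proj_decomp g V Y).
rewrite (torDr hX hY wY) (torDr wX hY wY).
rewrite (tor_hv hX wY (is_horizontal_hproj vX) (is_vertical_vproj vY)).
rewrite (tor_vh hY wX (is_horizontal_hproj vY) (is_vertical_vproj vX)).
rewrite (tor_vv wX wY (is_vertical_vproj vX) (is_vertical_vproj vY)).
by rewrite !vadd0.
Qed.

Lemma tor_vertical X Y : VField X -> VField Y -> is_vertical V (tor X Y).
Proof.
move=> vX vY; have [hX hY] := (vfield_HP vX, vfield_HP vY).
rewrite (torE vX vY) (tor_hh hX hY (is_horizontal_hproj vX) (is_horizontal_hproj vY)) => x.
have := vert_scale V_foliation (-1) (is_vertical_vproj (vfield_bracket hX hY) x).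
by congr (V x _); apply/funext => f; rewrite mulN1r.
Qed.

(** * Horizontal and vertical gradients *)

Lemma vfield_hgrad f : Smooth f -> VField (hg f).
Proof. by move=> sf; exact: vfield_HP (vfield_gradient g_metric sf). Qed.

Lemma vfield_vgrad f : Smooth f -> VField (vg f).
Proof. by move=> sf; exact: vfield_VP (vfield_gradient g_metric sf). Qed.

Lemma hgrad_hor f : Smooth f -> is_horizontal g V (hg f).
Proof. by move=> sf; exact: is_horizontal_hproj (vfield_gradient g_metric sf). Qed.

Lemma vgrad_vert f : Smooth f -> is_vertical V (vg f).
Proof. by move=> sf; exact: is_vertical_vproj (vfield_gradient g_metric sf). Qed.

Lemma ip_hgrad f X x : Smooth f -> VField X -> is_horizontal g V X -> ip g (hg f) X x = X x f.
Proof.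
move=> sf vX hX; rewrite /hgrad (ip_hproj g_metric V_foliation (vfield_gradient g_metric sf) (hX x)).
exact: ip_gradient.
Qed.

Lemma ip_vgrad f X x : Smooth f -> VField X -> is_vertical V X -> ip g (vg f) X x = X x f.
Proof.
move=> sf vX hX; rewrite /vgrad (ip_vproj g_metric V_foliation (vfield_gradient g_metric sf) (hX x)).
exact: ip_gradient.
Qed.

Lemma hessian_hor f X Y x : Smooth f -> VField X -> VField Y -> is_horizontal g V Y ->
  ip g (nab X (hg f)) Y x = X x (fun y => Y y f) - nab X Y x f.
Proof.
move=> sf vX vY hY; have vA := vfield_hgrad sf; have hA := hgrad_hor sf.
have E : ip g (hg f) Y = fun y => Y y f by apply/funext => y; exact: ip_hgrad.
have H : X x (ip g (hg f) Y) = ip g (nab X (hg f)) Y x + ip g (hg f) (nab X Y) x.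
  exact: nab_metric_hh.
by move: H; rewrite E (ip_hgrad x sf (vfield_nab vX vY) (nab_hor vX vY hY)) => ->; rewrite addrK.
Qed.

Lemma hessian_vert f X Z x : Smooth f -> VField X -> VField Z -> is_vertical V Z ->
  ip g (nab X (vg f)) Z x = X x (fun y => Z y f) - nab X Z x f.
Proof.
move=> sf vX vZ wZ; have vB := vfield_vgrad sf; have wB := vgrad_vert sf.
have E : ip g (vg f) Z = fun y => Z y f by apply/funext => y; exact: ip_vgrad.
have H : X x (ip g (vg f) Z) = ip g (nab X (vg f)) Z x + ip g (vg f) (nab X Z) x.
  exact: nab_metric_vv.
by move: H; rewrite E (ip_vgrad x sf (vfield_nab vX vZ) (nab_vert vX vZ wZ)) => ->; rewrite addrK.
Qed.

Lemma torE_apply X Y x f :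
  tor X Y x f = nab X Y x f - nab Y X x f - (X x (fun y => Y y f) - Y x (fun y => X y f)).
Proof. by rewrite /torsion /vsub /vadd /vopp bracketE. Qed.

(** The defect of symmetry is the derivative of f along T(X, Y), which is
    vertical. *)
Lemma hessian_sym f X Y x : Smooth f -> VField X -> VField Y ->
  is_horizontal g V X -> is_horizontal g V Y ->
  ip g (nab X (hg f)) Y x = ip g (nab Y (hg f)) X x - ip g (tor X Y) (vg f) x.
Proof.
move=> sf vX vY hX hY; have vB := vfield_vgrad sf; have vT := vfield_tor vX vY.
rewrite (hessian_hor x sf vX vY hY) (hessian_hor x sf vY vX hX).
rewrite (ipC g_metric x vT vB) (ip_vgrad x sf vT (tor_vertical vX vY)) torE_apply.
move: (X x _) (Y x _) (nab X Y x f) (nab Y X x f) => a b c d; lra.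
Qed.

(** The torsion vanishes on a horizontal and a vertical vector. *)
Lemma hessian_mixed f Z X x : Smooth f -> VField Z -> VField X ->
  is_vertical V Z -> is_horizontal g V X ->
  ip g (nab Z (hg f)) X x = ip g (nab X (vg f)) Z x.
Proof.
move=> sf vZ vX wZ hX; rewrite (hessian_hor x sf vZ vX hX) (hessian_vert x sf vX vZ wZ).
have := torE_apply X Z x f; rewrite (tor_hv vX vZ hX wZ).
move: (X x _) (Z x _) (nab X Z x f) (nab Z X x f) => a b c d; lra.
Qed.

(** Both sides are twice the mixed second derivative of the function along the
    two gradients. *)
Lemma Gamma_GammaV_commute f x : Smooth f ->
  Gamma g V f (GammaV g V f f) x = GammaV g V f (Gamma g V f f) x.
Proof.
move=> sf; have [vA hA] := (vfield_hgrad sf, hgrad_hor sf).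
have [vB wB] := (vfield_vgrad sf, vgrad_vert sf).
have sA : Smooth (Gamma g V f f) := Smooth_ip g_metric vA vA.
have sB : Smooth (GammaV g V f f) := Smooth_ip g_metric vB vB.
rewrite {1}/Gamma {2}/GammaV (ipC g_metric x vA (vfield_hgrad sB)).
rewrite (ipC g_metric x vB (vfield_vgrad sA)) (ip_hgrad x sB vA hA) (ip_vgrad x sA vB wB).
rewrite (nab_metric_vv x vA vB vB wB wB) (nab_metric_hh x vB vA vA hA hA).
rewrite (ipC g_metric x vB (vfield_nab vA vB)) (ipC g_metric x vA (vfield_nab vB vA)).
by rewrite (hessian_mixed x sf vB vA wB hA).
Qed.

(** * Frames *)

Definition join_frames (E : 'I_n -> vfield M) (Z : 'I_m -> vfield M) (i : 'I_(n + m)) : vfield M :=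
  match fintype.split i with inl j => E j | inr j => Z j end.

Lemma join_framesl (E : 'I_n -> vfield M) (Z : 'I_m -> vfield M) i : join_frames E Z (lshift m i) = E i.
Proof. by rewrite /join_frames (unsplitK (inl i)). Qed.

Lemma join_framesr (E : 'I_n -> vfield M) (Z : 'I_m -> vfield M) i : join_frames E Z (rshift n i) = Z i.
Proof. by rewrite /join_frames (unsplitK (inr i)). Qed.

Lemma join_frames_orthonormal x (E : 'I_n -> vfield M) (Z : 'I_m -> vfield M) :
  (forall i, is_horizontal g V (E i)) -> (forall i, is_vertical V (Z i)) ->
  (forall i j, ip g (E i) (E j) x = (i == j)%:R) ->
  (forall i j, ip g (Z i) (Z j) x = (i == j)%:R) ->
  forall i j, ip g (join_frames E Z i) (join_frames E Z j) x = (i == j)%:R.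
Proof.
move=> hE wZ oE oZ i j; case: (split_ordP i) => i' ->; case: (split_ordP j) => j' ->.
- by rewrite !join_framesl oE (inj_eq (@lshift_inj _ _)).
- by rewrite join_framesl join_framesr eq_lrshift (ip_hv (hE i' x) (wZ j' x)).
- by rewrite join_framesl join_framesr eq_rlshift (ip_vh g_metric V_foliation (wZ i' x) (hE j' x)).
- by rewrite !join_framesr oZ (inj_eq (@rshift_inj _ _)).
Qed.

Lemma vfield_join_frames (E : 'I_n -> vfield M) (Z : 'I_m -> vfield M) :
  (forall i, VField (E i)) -> (forall i, VField (Z i)) ->
  forall i, VField (join_frames E Z i).
Proof. by move=> vE vZ i; rewrite /join_frames; case: (fintype.split i). Qed.

Lemma hor_span x (E : 'I_n -> vfield M) v : (forall i, VField (E i)) ->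
  (forall i, is_horizontal g V (E i)) -> (forall i j, ip g (E i) (E j) x = (i == j)%:R) ->
  hor x v -> v = fun f => \sum_i g x v (E i x) * E i x f.
Proof.
move=> vE hE oE hv.
have [_ [Z [_ vZ _ /nbhs_singleton oZ]]] := adapted_frame g_metric V_foliation x.
have vF := vfield_join_frames vE (fun i => (vZ i).1).
have oF := orthonormal_at_fields vF (join_frames_orthonormal hE (fun i => (vZ i).2) oE oZ).
rewrite {1}(orthonormal_span g_metric oF (hor_tangent hv)).
apply/funext => f; rewrite big_split_ord /= [X in _ + X]big1 ?addr0 => [|j _].
  by apply: eq_bigr => i _; rewrite join_framesl.
by rewrite join_framesr (hor_vert hv ((vZ j).2 x)) mul0r.
Qed.

Lemma vert_span x (Z : 'I_m -> vfield M) v : (forall i, VField (Z i)) ->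
  (forall i, is_vertical V (Z i)) -> (forall i j, ip g (Z i) (Z j) x = (i == j)%:R) ->
  V x v -> v = fun f => \sum_i g x v (Z i x) * Z i x f.
Proof.
move=> vZ wZ oZ wv.
have [E [_ [vE _ /nbhs_singleton oE _]]] := adapted_frame g_metric V_foliation x.
have vF := vfield_join_frames (fun i => (vE i).1) vZ.
have oF := orthonormal_at_fields vF (join_frames_orthonormal (fun i => (vE i).2) wZ oE oZ).
have tv := vert_tangent V_foliation wv.
rewrite {1}(orthonormal_span g_metric oF tv).
apply/funext => f; rewrite big_split_ord /= [X in X + _]big1 ?add0r => [|j _].
  by apply: eq_bigr => i _; rewrite join_framesr.
rewrite join_framesl (g_sym g_metric tv (vfield_tangent x (vE j).1)).
by rewrite (hor_vert ((vE j).2 x) wv) mul0r.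
Qed.

Lemma tensorial_sum x k (F : vfield M -> R) (c : 'I_k -> R) (E : 'I_k -> vfield M) U :
  (forall X Y, VField X -> VField Y -> F (vadd X Y) = F X + F Y) ->
  (forall h X, Smooth h -> VField X -> F (vscale h X) = h x * F X) ->
  (forall i, VField (E i)) -> VField U -> (U x = fun f => \sum_i c i * E i x f) ->
  F U = \sum_i c i * F (E i).
Proof.
move=> FD FZ vE vU UE.
pose S (s : seq 'I_k) : vfield M := fun y f => \sum_(i <- s) c i * E i y f.
have H s : VField (S s) /\ F (S s) = \sum_(i <- s) c i * F (E i).
  elim: s => [|i s [vS IH]].
    have -> : S [::] = vscale (fun=> 0) (0%F : vfield M).
      by apply/funext => y; apply/funext => f; rewrite /S big_nil /vscale mul0r.
    have v0 := vfield_zero (M := M).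
    by split; [exact: vfieldZ (Smooth_cst 0) v0 | rewrite (FZ _ _ (Smooth_cst 0) v0) mul0r big_nil].
  have v1 := vfieldZ (Smooth_cst (c i)) (vE i).
  have -> : S (i :: s) = vadd (vscale (fun=> c i) (E i)) (S s).
    by apply/funext => y; apply/funext => f; rewrite /S big_cons.
  by split; [exact: vfieldD v1 vS | rewrite (FD _ _ v1 vS) (FZ _ _ (Smooth_cst _) (vE i)) IH big_cons].
have [vS <-] := H (index_enum 'I_k).
have UE' : U x = S (index_enum 'I_k) x by rewrite UE.
exact: (tensoriality g_metric FD FZ vU vS UE').
Qed.

Lemma antisym_sum k (w b : 'I_k -> 'I_k -> R) :
  (forall i j, w i j = - w j i) -> (forall i j, b i j = b j i) ->
  \sum_i \sum_j w i j * b i j = 0.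
Proof.
move=> wN bC; set S := (LHS).
suff : S = - S by lra.
rewrite {1}/S exchange_big /= /S -sumrN; apply: eq_bigr => i _.
by rewrite -sumrN; apply: eq_bigr => j _; rewrite wN bC mulNr.
Qed.

Section Frame.
Variables (x : M) (E : 'I_n -> vfield M).
Hypothesis vE : forall i, VField (E i).
Hypothesis hE : forall i, is_horizontal g V (E i).
Hypothesis oE : \forall y \near x, forall i j, ip g (E i) (E j) y = (i == j)%:R.

Lemma frame_at i j : ip g (E i) (E j) x = (i == j)%:R.
Proof. exact: (nbhs_singleton oE). Qed.

(** The products of the fields of the frame are constant near x. *)
Lemma connection_skew X i j : VField X ->
  ip g (nab X (E i)) (E j) x = - ip g (nab X (E j)) (E i) x.
Proof.
move=> vX.
have H : X x (ip g (E i) (E j)) = ip g (nab X (E i)) (E j) x + ip g (E i) (nab X (E j)) x.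
  exact: nab_metric_hh.
have Z : X x (ip g (E i) (E j)) = 0.
  rewrite (tangent_local (vfield_tangent x vX) (Smooth_ip g_metric (vE i) (vE j))
    (Smooth_cst (i == j)%:R)); first exact: tangent_cst (vfield_tangent x vX).
  by apply: filterS oE => y.
move: H; rewrite Z (ipC g_metric x (vE i) (vfield_nab vX (vE j))).
move: (ip g _ _ x) (ip g _ _ x) => a b; lra.
Qed.

(** Along X the frame rotates by a skew matrix, and such a rotation does not
    change the trace of the bilinear form (U, U') |-> g (nab U W, U'). *)
Lemma frame_rotation X W : VField X -> VField W -> is_horizontal g V W ->
  \sum_i (ip g (nab (nab X (E i)) W) (E i) x + ip g (nab (E i) W) (nab X (E i)) x) = 0.
Proof.
move=> vX vW hW.
pose w i j := ip g (nab X (E i)) (E j) x.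
pose a i j := ip g (nab (E i) W) (E j) x.
transitivity (\sum_i \sum_j w i j * (a i j + a j i)); last first.
  apply: antisym_sum => i j; last by rewrite addrC.
  exact: connection_skew.
apply: eq_bigr => i _.
have vXi := vfield_nab vX (vE i).
have XE := hor_span vE hE frame_at (nab_hor vX (vE i) (@hE i) x).
under eq_bigr do rewrite mulrDr; rewrite big_split addrC /=; congr (_ + _).
  rewrite (ipC g_metric x (vfield_nab (vE i) vW) vXi) /ip XE.
  rewrite (g_sum g_metric (w i) (fun j => vfield_tangent x (vE j)) (vfield_tangent x (vfield_nab (vE i) vW))).
  by apply: eq_bigr => j _; rewrite /a (ipC g_metric x (vfield_nab (vE i) vW) (vE j)).
apply: (tensorial_sum (F := fun U => ip g (nab U W) (E i) x) (c := w i)) XE => //.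
  move=> U U' vU vU'; rewrite (nabDl vU vU' vW).
  exact: (ipDl g_metric x (vfield_nab vU vW) (vfield_nab vU' vW) (vE i)).
move=> h U sh vU; rewrite (nabZl sh vU vW).
exact: (ipZl g_metric h x (vfield_nab vU vW) (vE i)).
Qed.

End Frame.

(** * Curvature *)

Lemma curv_hor X Y W : VField X -> VField Y -> VField W -> is_horizontal g V W ->
  is_horizontal g V (curv X Y W).
Proof.
move=> vX vY vW hW x; have [vXW vYW] := (vfield_nab vX vW, vfield_nab vY vW).
have [hXW hYW] := (nab_hor vX vW hW, nab_hor vY vW hW).
apply: (hor_sub g_metric V_foliation); last exact: nab_hor (vfield_bracket vX vY) vW hW x.
by apply: (hor_sub g_metric V_foliation); [exact: nab_hor vX vYW hYW x|exact: nab_hor vY vXW hXW x].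
Qed.

Lemma ip_curv X Y W U x : VField X -> VField Y -> VField W -> VField U ->
  ip g (curv X Y W) U x = ip g (nab X (nab Y W)) U x - ip g (nab Y (nab X W)) U x -
    ip g (nab (bracket X Y) W) U x.
Proof.
move=> vX vY vW vU; have [vXW vYW] := (vfield_nab vX vW, vfield_nab vY vW).
have [v1 v2 v3] := And3 (vfield_nab vX vYW) (vfield_nab vY vXW) (vfield_nab (vfield_bracket vX vY) vW).
by rewrite /curvature (ipBl g_metric x (vfieldB v1 v2) v3 vU) (ipBl g_metric x v1 v2 vU).
Qed.

(** The connection is metric, so its curvature operators are skew. *)
Lemma curv_skew X Y U W x : VField X -> VField Y -> VField U -> VField W ->
  is_horizontal g V U -> is_horizontal g V W ->
  ip g (curv X Y U) W x = - ip g (curv X Y W) U x.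
Proof.
move=> vX vY vU vW hU hW; have vb := vfield_bracket vX vY.
have [vXU vYU] := (vfield_nab vX vU, vfield_nab vY vU); have [vXW vYW] := (vfield_nab vX vW, vfield_nab vY vW).
have [hXU hYU] := (nab_hor vX vU hU, nab_hor vY vU hU).
have [hXW hYW] := (nab_hor vX vW hW, nab_hor vY vW hW).
have second X1 Y1 : VField X1 -> VField Y1 -> VField (nab X1 U) -> VField (nab Y1 U) ->
    VField (nab X1 W) -> VField (nab Y1 W) -> is_horizontal g V (nab Y1 U) ->
    is_horizontal g V (nab Y1 W) ->
    X1 x (fun y => Y1 y (ip g U W)) =
    ip g (nab X1 (nab Y1 U)) W x + ip g (nab Y1 U) (nab X1 W) x +
    (ip g (nab X1 U) (nab Y1 W) x + ip g (nab X1 (nab Y1 W)) U x).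
  move=> vX1 vY1 vXU1 vYU1 vXW1 vYW1 hYU1 hYW1.
  have -> : (fun y => Y1 y (ip g U W)) = fun y => ip g (nab Y1 U) W y + ip g U (nab Y1 W) y.
    by apply/funext => y; exact: nab_metric_hh.
  rewrite (tangentD (vfield_tangent x vX1) (Smooth_ip g_metric vYU1 vW) (Smooth_ip g_metric vU vYW1)).
  rewrite (nab_metric_hh x vX1 vYU1 vW hYU1 hW) (nab_metric_hh x vX1 vU vYW1 hU hYW1).
  by rewrite (ipC g_metric x vU (vfield_nab vX1 vYW1)).
have Ebr : bracket X Y x (ip g U W) =
    ip g (nab (bracket X Y) U) W x + ip g (nab (bracket X Y) W) U x.
  by rewrite (nab_metric_hh x vb vU vW hU hW) (ipC g_metric x vU (vfield_nab vb vW)).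
rewrite (ip_curv x vX vY vU vW) (ip_curv x vX vY vW vU).
move: Ebr; rewrite bracketE (second X Y vX vY vXU vYU vXW vYW hYU hYW).
rewrite (second Y X vY vX vYU vXU vYW vXW hXU hXW).
exact: skew_arith.
Qed.

Lemma nab_tor X Y : nab X Y = vadd (vadd (nab Y X) (bracket X Y)) (tor X Y).
Proof.
apply/funext => x; apply/funext => f; rewrite /torsion /vadd /vsub /vopp /vadd.
by move: (nab X Y x f) (nab Y X x f) (bracket X Y x f) => a b c; ring.
Qed.

(** The torsion is vertical. *)
Lemma nab_swap X Y U x : VField X -> VField Y -> VField U -> is_horizontal g V U ->
  ip g (nab X Y) U x = ip g (nab Y X) U x + ip g (bracket X Y) U x.
Proof.
move=> vX vY vU hU; have [v1 v2 v3] := And3 (vfield_nab vY vX) (vfield_bracket vX vY) (vfield_tor vX vY).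
rewrite nab_tor (ipDl g_metric x (vfieldD v1 v2) v3 vU) (ipDl g_metric x v1 v2 vU).
by rewrite (ip_vh g_metric V_foliation (tor_vertical vX vY x) (hU x)) addr0.
Qed.

(** First Bianchi identity. Its torsion terms are vertical, so that the Jacobi
    identity is all that remains after pairing with W. *)
Lemma bianchi X Z Y W x : VField X -> VField Z -> VField Y -> VField W ->
  is_horizontal g V X -> is_vertical V Z -> is_horizontal g V Y -> is_horizontal g V W ->
  ip g (curv X Z Y) W x = ip g (curv Y Z X) W x.
Proof.
move=> vX vZ vY vW hX wZ hY hW.
have vbXY := vfield_bracket vX vY; have vbZX := vfield_bracket vZ vX.
have vbZY := vfield_bracket vZ vY.
have nvert U1 U2 : VField U1 -> VField U2 -> is_vertical V U2 -> ip g (nab U1 U2) W x = 0.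
  by move=> v1 v2 w2; exact: (ip_vh g_metric V_foliation (nab_vert v1 v2 w2 x) (hW x)).
have mixed U1 U2 : VField U1 -> VField U2 -> is_horizontal g V U1 -> is_horizontal g V U2 ->
    ip g (nab U1 (nab Z U2)) W x =
    ip g (nab (bracket Z U2) U1) W x + ip g (bracket U1 (bracket Z U2)) W x.
  move=> v1 v2 h1 h2; have vb := vfield_bracket vZ v2.
  rewrite [nab Z U2]nab_tor (tor_vh v2 vZ h2 wZ) vadd0 (nabDr v1 (vfield_nab v2 vZ) vb).
  rewrite (ipDl g_metric x (vfield_nab v1 (vfield_nab v2 vZ)) (vfield_nab v1 vb) vW).
  rewrite (nvert _ _ v1 (vfield_nab v2 vZ) (nab_vert v2 vZ wZ)) add0r.
  exact: nab_swap.
have comm : ip g (nab Z (nab X Y)) W x =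
    ip g (nab Z (nab Y X)) W x + ip g (nab (bracket X Y) Z) W x + ip g (bracket Z (bracket X Y)) W x.
  have [v1 v3] := (vfield_nab vY vX, vfield_tor vX vY).
  rewrite [nab X Y]nab_tor (nabDr vZ (vfieldD v1 vbXY) v3) (nabDr vZ v1 vbXY).
  rewrite (ipDl g_metric x (vfieldD (vfield_nab vZ v1) (vfield_nab vZ vbXY)) (vfield_nab vZ v3) vW).
  rewrite (ipDl g_metric x (vfield_nab vZ v1) (vfield_nab vZ vbXY) vW).
  rewrite (nvert _ _ vZ v3 (tor_vertical vX vY)) addr0 -addrA; congr (_ + _).
  exact: nab_swap.
have jac : bracket X (bracket Y Z) = vadd (vopp (bracket Y (bracket Z X))) (vopp (bracket Z (bracket X Y))).
  have v1 := vfield_bracket vX (vfield_bracket vY vZ).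
  have v2 := vfield_bracket vY vbZX; have v3 := vfield_bracket vZ vbXY.
  apply: (field_eq v1 (vfieldD (vfieldN v2) (vfieldN v3))) => y f sf.
  rewrite /vadd /vopp; have := jacobi y vX vY vZ sf.
  exact: jacobi_arith.
have jac' : ip g (bracket X (bracket Z Y)) W x =
    ip g (bracket Y (bracket Z X)) W x + ip g (bracket Z (bracket X Y)) W x.
  have v2 := vfield_bracket vY vbZX; have v3 := vfield_bracket vZ vbXY.
  rewrite -(ipDl g_metric x v2 v3 vW); congr (g x _ _).
  have -> : bracket X (bracket Z Y) = vopp (bracket X (bracket Y Z)).
    by rewrite [bracket Z Y]bracketC (bracketNr vX (vfield_bracket vY vZ)).
  by rewrite jac; apply/funext => f; rewrite /vadd /vopp opprD !opprK.
have swapN U1 U2 : VField U1 -> VField U2 ->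
    ip g (nab (bracket U1 Z) U2) W x = - ip g (nab (bracket Z U1) U2) W x.
  move=> v1 v2; have vb := vfield_bracket vZ v1.
  by rewrite [bracket U1 Z]bracketC (nabNl vb v2) (ipNl g_metric x (vfield_nab vb v2) vW).
rewrite (ip_curv x vX vZ vY vW) (ip_curv x vY vZ vX vW).
exact: bianchi_arith (mixed X Y vX vY hX hY) (mixed Y X vY vX hY hX) (swapN X Y vX vY)
  (swapN Y X vY vX) comm (nvert _ _ vbXY vZ wZ) jac'.
Qed.

(** The mixed part of the Ricci curvature: by the Bianchi identity this is
    g (R(A, B) X, X) for the two gradients A and B, which vanishes by skewness. *)
Lemma curv_vertical_trace f X x : Smooth f -> VField X -> is_horizontal g V X ->
  ip g (curv X (vg f) (hg f)) X x = 0.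
Proof.
move=> sf vX hX; have [vA hA] := (vfield_hgrad sf, hgrad_hor sf).
have [vB wB] := (vfield_vgrad sf, vgrad_vert sf).
rewrite (bianchi x vX vB vA vX hX wB hA hX).
have := curv_skew x vA vB vX vX hX hX.
exact: self_opp.
Qed.

(** * Bochner formulas *)

Lemma vfield_ntor X Y W : VField X -> VField Y -> VField W -> VField (ntor X Y W).
Proof.
move=> vX vY vW; have [v1 v2] := (vfield_nab vX (vfield_tor vY vW), vfield_tor (vfield_nab vX vY) vW).
exact: vfieldB (vfieldB v1 v2) (vfield_tor vY (vfield_nab vX vW)).
Qed.

Lemma ip_ntor X Y W U x : VField X -> VField Y -> VField W -> VField U ->
  ip g (ntor X Y W) U x =
  ip g (nab X (tor Y W)) U x - ip g (tor (nab X Y) W) U x - ip g (tor Y (nab X W)) U x.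
Proof.
move=> vX vY vW vU; have [v1 v2] := (vfield_nab vX (vfield_tor vY vW), vfield_tor (vfield_nab vX vY) vW).
have v3 := vfield_tor vY (vfield_nab vX vW).
by rewrite /nabla_torsion (ipBl g_metric x (vfieldB v1 v2) v3 vU) (ipBl g_metric x v1 v2 vU).
Qed.

Lemma ip_nab_bracket X Y W U x : VField X -> VField Y -> VField W -> VField U ->
  ip g (nab (bracket X Y) W) U x = ip g (nab (nab X Y) W) U x - ip g (nab (nab Y X) W) U x -
    ip g (nab (tor X Y) W) U x.
Proof.
move=> vX vY vW vU; have [v1 v2 v3] := And3 (vfield_nab vX vY) (vfield_nab vY vX) (vfield_tor vX vY).
have -> : bracket X Y = vsub (vsub (nab X Y) (nab Y X)) (tor X Y).
  apply/funext => y; apply/funext => f; rewrite /torsion /vsub /vadd /vopp.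
  exact: sub_sub_arith.
rewrite (nabBl (vfieldB v1 v2) v3 vW) (nabBl v1 v2 vW).
by rewrite (ipBl g_metric x (vfieldB (vfield_nab v1 vW) (vfield_nab v2 vW)) (vfield_nab v3 vW) vU)
  (ipBl g_metric x (vfield_nab v1 vW) (vfield_nab v2 vW) vU).
Qed.

Section Function.
Variable f : M -> R.
Hypothesis sf : Smooth f.
Let A := hg f.
Let B := vg f.
Let vA : VField A := vfield_hgrad sf.
Let hA : is_horizontal g V A := hgrad_hor sf.
Let vB : VField B := vfield_vgrad sf.
Let wB : is_vertical V B := vgrad_vert sf.

(** One term of the Bochner formula. The symmetry of the Hessian turns
    nab U A into nab A A in the first term, and exchanging U and A afterwards
    brings in the curvature. Summed over a frame, the parenthesis at the end
    vanishes because the frame rotates, and the covariant derivative of the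
    torsion by the Yang-Mills condition. *)
Lemma horizontal_term U x : VField U -> is_horizontal g V U ->
  U x (ip g (nab U A) A) - ip g (nab (nab U U) A) A x - ip g (nab A (nab U A)) U x
    - ip g (nab U A) (nab A U) x =
  ip g (curv U A A) U x + ip g (nab U A) (nab U A) x - 2 * ip g (tor U A) (nab U B) x
    - ip g (ntor U U A) B x
    - (ip g (nab (nab A U) A) U x + ip g (nab U A) (nab A U) x).
Proof.
move=> vU hU; have [vUA vAA vUU] := And3 (vfield_nab vU vA) (vfield_nab vA vA) (vfield_nab vU vU).
have [hUA hAA hUU] := And3 (nab_hor vU vA hA) (nab_hor vA vA hA) (nab_hor vU vU hU).
have [vT wT] := (vfield_tor vU vA, tor_vertical vU vA); have vUB := vfield_nab vU vB.
have e1 : U x (ip g (nab U A) A) = ip g (nab U (nab A A)) U x + ip g (nab A A) (nab U U) x -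
    (ip g (nab U (tor U A)) B x + ip g (tor U A) (nab U B) x).
  have -> : ip g (nab U A) A = fun y => ip g (nab A A) U y - ip g (tor U A) B y.
    by apply/funext => y; exact: hessian_sym.
  rewrite (tangentB (vfield_tangent x vU) (Smooth_ip g_metric vAA vU) (Smooth_ip g_metric vT vB)).
  by rewrite (nab_metric_hh x vU vAA vU hAA hU) (nab_metric_vv x vU vT vB wT wB).
have e7 : ip g (tor (nab U A) U) B x = - ip g (tor U (nab U A)) B x.
  by rewrite torC (ipNl g_metric x (vfield_tor vU vUA) vB).
exact: horizontal_arith e1 (hessian_sym x sf vUU vA hUU hA) (ip_ntor x vU vU vA vB)
  (ip_curv x vU vA vA vU) (ip_nab_bracket x vU vA vA vU) (hessian_sym x sf vUA vU hUA hU) e7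
  (hessian_mixed x sf vT vU wT hU) (ipC g_metric x vUB vT).
Qed.

(** The same computation with the mixed Hessian; there is no curvature left by
    curv_vertical_trace. *)
Lemma vertical_term U x : VField U -> is_horizontal g V U ->
  U x (ip g (nab U B) B) - ip g (nab (nab U U) B) B x - ip g (nab B (nab U A)) U x
    - ip g (nab U A) (nab B U) x =
  ip g (nab U B) (nab U B) x - (ip g (nab (nab B U) A) U x + ip g (nab U A) (nab B U) x).
Proof.
move=> vU hU; have [vUB vBA vUU] := And3 (vfield_nab vU vB) (vfield_nab vB vA) (vfield_nab vU vU).
have [wUB hBA hUU] := And3 (nab_vert vU vB wB) (nab_hor vB vA hA) (nab_hor vU vU hU).
have e1 : U x (ip g (nab U B) B) = ip g (nab U (nab B A)) U x + ip g (nab B A) (nab U U) x.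
  have -> : ip g (nab U B) B = ip g (nab B A) U.
    by apply/funext => y; rewrite -(hessian_mixed y sf vB vU wB hU).
  exact: nab_metric_hh.
have e0 : ip g (nab (tor U B) A) U x = 0.
  rewrite (tor_hv vU vB hU wB) (nab0l vA).
  exact: (g0l g_metric (vfield_tangent x vU)).
exact: vertical_arith e1 (esym (hessian_mixed x sf vB vUU wB hUU)) (ip_curv x vU vB vA vU)
  (ip_nab_bracket x vU vB vA vU) e0 (hessian_mixed x sf vUB vU wUB hU)
  (curv_vertical_trace x sf vU hU).
Qed.

Variable L : (M -> R) -> M -> R.
Hypothesis Smooth_L : forall h, Smooth h -> Smooth (L h).
Hypothesis L_frame : forall h x (E : 'I_n -> vfield M), Smooth h -> (forall i, VField (E i)) ->
  (forall i, is_horizontal g V (E i)) -> (forall i j, ip g (E i) (E j) x = (i == j)%:R) ->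
  L h x = \sum_i ip g (nab (E i) (hg h)) (E i) x.

Section AtPoint.
Variables (x : M) (E : 'I_n -> vfield M).
Hypothesis vE : forall i, VField (E i).
Hypothesis hE : forall i, is_horizontal g V (E i).
Hypothesis oE : \forall y \near x, forall i j, ip g (E i) (E j) y = (i == j)%:R.

Lemma laplacian_square W : VField W ->
  (forall X y, VField X -> X y (ip g W W) = ip g (nab X W) W y + ip g W (nab X W) y) ->
  L (ip g W W) x = 2 * \sum_i (E i x (ip g (nab (E i) W) W) - ip g (nab (nab (E i) (E i)) W) W x).
Proof.
move=> vW mW; have sW := Smooth_ip g_metric vW vW.
rewrite (L_frame sW vE hE (frame_at oE)) mulr_sumr; apply: eq_bigr => i _.
have vEW := vfield_nab (vE i) vW; have vEE := vfield_nab (vE i) (vE i).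
have sq X y : VField X -> X y (ip g W W) = 2 * ip g (nab X W) W y.
  move=> vX; rewrite (mW X y vX) (ipC g_metric y vW (vfield_nab vX vW)).
  exact: double_arith.
rewrite (hessian_hor x sW (vE i) (vE i) (hE i)) (sq _ x vEE).
have -> : (fun y => E i y (ip g W W)) = fun y => 2 * ip g (nab (E i) W) W y.
  by apply/funext => y; exact: sq.
rewrite (tangentZ 2 (vfield_tangent x (vE i)) (Smooth_ip g_metric vEW vW)).
by rewrite mulrBr.
Qed.

Lemma laplacian_derivative X : VField X ->
  X x (L f) = \sum_i (ip g (nab X (nab (E i) A)) (E i) x + ip g (nab (E i) A) (nab X (E i)) x).
Proof.
move=> vX; have vEA i := vfield_nab (vE i) vA; have hEA i := nab_hor (vE i) vA hA.
have sEA i := Smooth_ip g_metric (vEA i) (vE i).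
rewrite (tangent_local (vfield_tangent x vX) (Smooth_L sf) (Smooth_sum sEA)); last first.
  by apply: filterS oE => y oy; exact: L_frame sf vE hE oy.
rewrite (tangent_sum (vfield_tangent x vX) sEA); apply: eq_bigr => i _.
exact: (nab_metric_hh x vX (vEA i) (vE i) (hEA i) (hE i)).
Qed.

Lemma bochner_horizontal : yang_mills g V D ->
  Gamma2 g V L f f x = \sum_i (ip g (curv (E i) A A) (E i) x +
    ip g (nab (E i) A) (nab (E i) A) x - 2 * ip g (tor (E i) A) (nab (E i) B) x).
Proof.
move=> ym.
have YM : \sum_i ip g (ntor (E i) (E i) A) B x = 0.
  have vN i := vfield_ntor (vE i) (vE i) vA.
  rewrite -(ip_suml g_metric x vN vB).
  have hf : horizontal_frame g V x E.
    split; [split|] => [i|i j|j]; [by case: (vE i)| |].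
      by apply: filterS oE => y.
    by apply: near_all => y; exact: hE.
  have [vA'] := vA.
  have N0 : vsum (fun i => ntor (E i) (E i) A) x = fun=> 0.
    apply/funext => h; have := congr1 (fun k => k h) (ym x E hf A vA').
    by rewrite /delta_torsion /vopp => /eqP; rewrite oppr_eq0 => /eqP.
  by rewrite /ip N0; exact: (g0l g_metric (vfield_tangent x vB)).
have vL := vfield_hgrad (Smooth_L sf).
have GL : Gamma g V f (L f) x = A x (L f).
  by rewrite /Gamma (ipC g_metric x vA vL) (ip_hgrad x (Smooth_L sf) vA hA).
have mA X y : VField X -> X y (ip g A A) = ip g (nab X A) A y + ip g A (nab X A) y.
  by move=> vX; exact: (nab_metric_hh y vX vA vA hA hA).
have rot : \sum_i (ip g (nab (nab A (E i)) A) (E i) x + ip g (nab (E i) A) (nab A (E i)) x) = 0.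
  exact: frame_rotation.
rewrite /Gamma2 GL [Gamma g V f f]/(ip g A A) (laplacian_square vA mA) (laplacian_derivative vA).
rewrite half_arith -sumrB; apply: (etrans _ (sum_eq0r (fun i => erefl _) YM)).
apply: (sum_eq0r _ rot) => i.
rewrite opprD addrA; exact: (horizontal_term x (vE i) (hE i)).
Qed.

Lemma bochner_vertical :
  GammaV2 g V L f f x = \sum_i ip g (nab (E i) B) (nab (E i) B) x.
Proof.
have vL := vfield_vgrad (Smooth_L sf).
have GL : GammaV g V f (L f) x = B x (L f).
  by rewrite /GammaV (ipC g_metric x vB vL) (ip_vgrad x (Smooth_L sf) vB wB).
have mB X y : VField X -> X y (ip g B B) = ip g (nab X B) B y + ip g B (nab X B) y.
  by move=> vX; exact: (nab_metric_vv y vX vB vB wB wB).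
have rot : \sum_i (ip g (nab (nab B (E i)) A) (E i) x + ip g (nab (E i) A) (nab B (E i)) x) = 0.
  exact: frame_rotation.
rewrite /GammaV2 GL [GammaV g V f f]/(ip g B B) (laplacian_square vB mB) (laplacian_derivative vB).
rewrite half_arith -sumrB; apply: (sum_eq0r _ rot) => i.
rewrite opprD addrA; exact: (vertical_term x (vE i) (hE i)).
Qed.

End AtPoint.
End Function.

(** * Divergence in coordinates *)

Section Coordinates.
Variables (c : chart R (n + m) M) (xi : 'I_(n + m) -> M -> R) (K : 'I_(n + m) -> vfield M).
Variables (N : set M) (x : M).
Hypotheses (ac : atlas c) (oN : open N) (Nx : N x) (Nc : N `<=` chart_dom c).
Hypothesis sxi : forall i, Smooth (xi i).
Hypothesis vK : forall i, VField (K i).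
Hypothesis xiE : forall y, N y -> forall i, xi i y = chart_map c y 0 i.
Hypothesis KE : forall y, N y -> forall i, K i y = coordinate_vector c i y.

Lemma near_coordinates y : N y -> \forall z \near y, forall i, xi i z = chart_map c z 0 i.
Proof.
move=> Ny; have : nbhs y N by exact: open_nbhs_nbhs.
by apply: filterS => z; exact: xiE.
Qed.

Lemma coordinate_expansion y v f : N y -> Tangent y v -> Smooth f ->
  v f = \sum_i v (xi i) * K i y f.
Proof.
move=> Ny tv sf; rewrite (tangent_coordinates ac (Nc Ny) sxi (near_coordinates Ny) tv sf).
by apply: eq_bigr => i _; rewrite KE.
Qed.

Variable F : 'I_(n + m) -> vfield M.
Hypothesis vF : forall i, VField (F i).
Hypothesis oF : forall i j, ip g (F i) (F j) x = (i == j)%:R.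

Definition transition : 'M[R]_(n + m) := \matrix_(i, j) ip g (K i) (F j) x.

Definition coordinate_gram y : 'M[R]_(n + m) := \matrix_(i, j) ip g (K i) (K j) y.

Lemma transition_expansion i : K i x = fun f => \sum_j transition i j * F j x f.
Proof.
rewrite {1}(orthonormal_span g_metric (orthonormal_at_fields vF oF) (vfield_tangent x (vK i))).
by apply/funext => f; apply: eq_bigr => j _; rewrite mxE.
Qed.

Lemma gram_transition : coordinate_gram x = transition *m transition^T.
Proof.
apply/matrixP => i j; rewrite !mxE {1}/ip transition_expansion.
rewrite (g_sum g_metric _ (fun k => vfield_tangent x (vF k)) (vfield_tangent x (vK j))).
apply: eq_bigr => k _; rewrite ![_^T _ _]mxE; congr (_ * _); rewrite [RHS]mxE.
exact: (ipC g_metric x (vF k) (vK j)).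
Qed.

Lemma transition_unit : transition \in unitmx.
Proof.
rewrite -row_free_unit; apply/inj_row_free => b bP.
pose v f := \sum_i b 0 i * K i x f.
have tK i := vfield_tangent x (vK i).
have tv : Tangent x v by exact: tangent_lcomb.
have v0 : v = fun=> 0.
  rewrite (orthonormal_span g_metric (orthonormal_at_fields vF oF) tv).
  apply/funext => f; rewrite big1 // => j _.
  have -> : g x v (F j x) = 0.
    rewrite /v (g_sum g_metric _ tK (vfield_tangent x (vF j))).
    transitivity ((b *m transition) 0 j); last by rewrite bP mxE.
    by rewrite mxE; apply: eq_bigr => i _; rewrite mxE.
  by rewrite mul0r.
apply/rowP => j; rewrite [RHS]mxE; have := congr1 (fun k => k (xi j)) v0; rewrite /v => <-.
rewrite (bigD1 j) //= big1 => [|i ij].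
  by rewrite KE // (coordinate_vector_inj _ _ ac (Nc Nx) sxi (near_coordinates Nx)) eqxx mulr1 addr0.
rewrite KE // (coordinate_vector_inj _ _ ac (Nc Nx) sxi (near_coordinates Nx)).
by rewrite (negbTE ij) mulr0.
Qed.

(** The Gram matrix is P P^T for the invertible transition matrix P. *)
Lemma det_gram_gt0 : 0 < \det (coordinate_gram x).
Proof.
rewrite gram_transition det_mulmx det_tr -expr2 lt_neqAle sqr_ge0 andbT eq_sym sqrf_eq0.
by have := transition_unit; rewrite unitmxE unitfE.
Qed.

Variable W : vfield M.
Hypothesis vW : VField W.

(** The coordinate fields commute, so that only the derivatives of the
    coefficients of W contribute. *)
Lemma bracket_coordinate_field i :
  bracket W (K i) x = fun f => \sum_l - K i x (fun y => W y (xi l)) * K l x f.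
Proof.
have sW l := vfield_smooth vW (sxi l).
have tK l := vfield_tangent x (vK l).
apply: (tangent_eq (vfield_tangent x (vfield_bracket vW (vK i)))).
  exact: (@tangent_lcomb _ _ _ x _ (fun l => K l x)).
move=> f sf; have sK l := vfield_smooth (vK l) sf.
rewrite bracketE (coordinate_expansion Nx (vfield_tangent x vW) (sK i)).
have sWK l : Smooth (fun y => W y (xi l) * K l y f) := SmoothM (sW l) (sK l).
rewrite (tangent_local (tK i) (vfield_smooth vW sf) (Smooth_sum sWK)); last first.
  have : nbhs x N by exact: open_nbhs_nbhs.
  by apply: filterS => y Ny; exact: coordinate_expansion Ny (vfield_tangent y vW) sf.
rewrite (tangent_sum (tK i) sWK) -sumrB; apply: eq_bigr => l _.
rewrite (tangentM (tK i) (sW l) (sK l)) opprD addrA -mulrBr.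
have := bracket_coordinates l i ac oN Nc vK KE Nx sf; rewrite bracketE => ->.
by rewrite mulr0 add0r mulNr mulrC.
Qed.

Variable S : M -> R.
Hypothesis sS : Smooth S.
Hypothesis S_gt0 : 0 < S x.
Hypothesis SE : \forall y \near x, S y ^+ 2 = \det (coordinate_gram y).

(** Jacobi's formula for W (S ^ 2) = W (det gram). Since D is metric and torsion
    free, W (gram i j) is made of D (K i) W and of brackets, whose trace is the
    last sum. *)
Lemma density_derivative :
  S x * W x S = \sum_i \sum_j ip g (D (K i) W) (K j) x * cofactor (coordinate_gram x) i j
    - S x ^+ 2 * \sum_i K i x (fun y => W y (xi i)).
Proof.
have tW := vfield_tangent x vW; have Sx := nbhs_singleton SE.
have sG i j : Smooth (ip g (K i) (K j)) := Smooth_ip g_metric (vK i) (vK j).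
have sD : Smooth (fun y => \det (coordinate_gram y)).
  apply: Smooth_det => i j; apply: Smooth_ext (sG i j) => y; by rewrite mxE.
have E2 : 2 * (S x * W x S) = W x (fun y => \det (coordinate_gram y)).
  rewrite -(tangent_local tW (SmoothM sS sS) sD); last by apply: filterS SE => y <-; rewrite expr2.
  by rewrite (tangentM tW sS sS); exact: esym (double_arith _).
pose q i j := ip g (D W (K i)) (K j) x.
have vDK i : VField (D W (K i)) := vfield_D vW (vK i).
have cofC i j : cofactor (coordinate_gram x) i j = cofactor (coordinate_gram x) j i.
  have tG : (coordinate_gram x)^T = coordinate_gram x.
    by apply/matrixP => k l; rewrite !mxE; exact: (ipC g_metric x (vK l) (vK k)).
  by rewrite -{1}tG cofactor_tr.
have E3 : W x (fun y => \det (coordinate_gram y)) =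
    2 * \sum_i \sum_j q i j * cofactor (coordinate_gram x) i j.
  rewrite (tangent_det tW sG) -double_arith -[X in _ + X]exchange_big /= -big_split.
  apply: eq_bigr => i _; rewrite -big_split; apply: eq_bigr => j _ /=.
  rewrite (cofC j i) -mulrDl; congr (_ * _).
  by rewrite (D_metric x (vK i) (vK j) vW) /q (ipC g_metric x (vK i) (vDK j)).
have qE i j : q i j = ip g (D (K i) W) (K j) x -
    \sum_l K i x (fun y => W y (xi l)) * coordinate_gram x l j.
  have vb := vfield_bracket vW (vK i); have vDW : VField (D (K i) W) := vfield_D (vK i) vW.
  have -> : q i j = ip g (D (K i) W) (K j) x + ip g (bracket W (K i)) (K j) x.
    rewrite -(D_bracket vW (vK i)) (ipBl g_metric x (vDK i) vDW (vK j)) /q.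
    by rewrite addrC subrK.
  congr (_ + _); rewrite {1}/ip bracket_coordinate_field.
  rewrite (g_sum g_metric _ (fun l => vfield_tangent x (vK l)) (vfield_tangent x (vK j))).
  by rewrite -sumrN; apply: eq_bigr => l _; rewrite mulNr mxE.
have E4 : \sum_i \sum_j (\sum_l K i x (fun y => W y (xi l)) * coordinate_gram x l j)
      * cofactor (coordinate_gram x) i j = S x ^+ 2 * \sum_i K i x (fun y => W y (xi i)).
  rewrite Sx.
  transitivity (\tr ((\matrix_(i, l) K i x (fun y => W y (xi l))) *m coordinate_gram x *m
      \adj (coordinate_gram x))).
    rewrite -sum_cofactor; apply: eq_bigr => i _; apply: eq_bigr => j _; congr (_ * _).
    by rewrite [RHS]mxE; apply: eq_bigr => l _; rewrite [X in _ = X * _]mxE.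
  rewrite -mulmxA mul_mx_adj mul_mx_scalar mxtraceZ; congr (_ * _).
  by apply: eq_bigr => i _; rewrite mxE.
have two : (2 : R) != 0 by rewrite pnatr_eq0.
move: E2; rewrite E3 => /(mulfI two) ->; rewrite -E4 -sumrB; apply: eq_bigr => i _.
by rewrite -sumrB; apply: eq_bigr => j _; rewrite qE mulrBl.
Qed.

(** The hypothesis is the coordinate formula of the divergence of W. By
    density_derivative it is the trace of D W against the inverse of the Gram
    matrix, that is, the trace in any orthonormal basis. *)
Lemma divergence_trace (l : R) :
  l * S x = \sum_i K i x (fun y => W y (xi i) * S y) ->
  l = \sum_a ip g (D (F a) W) (F a) x.
Proof.
move=> lE; have tK i := vfield_tangent x (vK i); have Sx := nbhs_singleton SE.
have sW i := vfield_smooth vW (sxi i).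
have E1 : l * S x = S x * \sum_i K i x (fun y => W y (xi i)) + W x S.
  rewrite lE (coordinate_expansion Nx (vfield_tangent x vW) sS) mulr_sumr -big_split.
  apply: eq_bigr => i _; rewrite (tangentM (tK i) (sW i) sS) addrC; congr (_ + _).
have E2 : l * S x ^+ 2 = \sum_i \sum_j ip g (D (K i) W) (K j) x * cofactor (coordinate_gram x) i j.
  rewrite expr2 mulrA E1 mulrDl [W x S * _]mulrC density_derivative.
  by rewrite mulrAC -expr2 addrC subrK.
pose t : 'M[R]_(n + m) := \matrix_(a, b) ip g (D (F a) W) (F b) x.
have E3 i j : ip g (D (K i) W) (K j) x = (transition *m t *m transition^T) i j.
  have vDW := vfield_D (vK i) vW.
  have H U : VField U -> ip g (D (K i) W) U x = \sum_a transition i a * ip g (D (F a) W) U x.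
    move=> vU; apply: (tensorial_sum (F := fun X => ip g (D X W) U x)) (transition_expansion i) => //.
      move=> X Y vX vY.
      have : D (vadd (vscale (fun=> 1) X) Y) W = vadd (vscale (fun=> 1) (D X W)) (D Y W).
        exact: (D_combl (Smooth_cst (M := M) 1) vX vY vW).
      rewrite !vadd_scale1 => ->; exact: (ipDl g_metric x (vfield_D vX vW) (vfield_D vY vW) vU).
    move=> h X sh vX; have v0 := vfield_zero (M := M).
    have : D (vadd (vscale h X) 0%F) W = vadd (vscale h (D X W)) (D 0%F W).
      exact: (D_combl sh vX v0 vW).
    rewrite vadd0 (D0l vW) vadd0 => ->.
    exact: (ipZl g_metric h x (vfield_D vX vW) vU).
  rewrite [RHS]mxE (ipC g_metric x vDW (vK j)) {1}/ip transition_expansion.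
  rewrite (g_sum g_metric _ (fun k => vfield_tangent x (vF k)) (vfield_tangent x vDW)).
  apply: eq_bigr => b _; rewrite [transition^T b j]mxE mulrC; congr (_ * _).
  rewrite -/(ip g (F b) (D (K i) W) x) (ipC g_metric x (vF b) vDW) (H _ (vF b)).
  by rewrite mxE; apply: eq_bigr => a _; rewrite [t a b]mxE.
have S2 : S x ^+ 2 != 0 by rewrite gt_eqF // exprn_gt0.
apply: (mulIf S2); rewrite E2.
under eq_bigr => i _ do under eq_bigr => j _ do rewrite E3 gram_transition.
rewrite (trace_gram _ transition_unit) -gram_transition -Sx mulrC; congr (_ * _).
by apply: eq_bigr => a _; rewrite mxE.
Qed.

End Coordinates.

(** * The horizontal Laplacian is a horizontal divergence *)

Section Laplacian.
Variable mu : {measure set (g_sigma_algebraType (@open M)) -> \bar R}.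
Hypothesis mu_volume : is_riemannian_volume g mu.
Variable L : (M -> R) -> (M -> R).
Hypothesis L_laplacian : is_horizontal_laplacian g V mu L.

Lemma Smooth_laplacian f : Smooth f -> Smooth (L f).
Proof. by have [sL _ _] := L_laplacian; case=> sf; constructor; exact: sL. Qed.

Lemma nbhs_chart_ball (c : chart R (n + m) M) x (r : R) : chart_dom c x -> 0 < r ->
  nbhs x (chart_ball c (chart_map c x) r).
Proof.
move=> cx r0.
have n1 : \forall u \near chart_map c x, `|u - chart_map c x| <= r.
  apply/(@nbhs_ballP R 'rV[R]_(n + m)); exists r => //= u.
  by rewrite -ball_normE /ball_ /= distrC => /ltW.
have n2 := near_chart_map cx n1; have n3 := near_chart_dom cx.
by apply: filterS2 n3 n2 => y cy ry; split.
Qed.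

Section IntegrationByParts.
Variables (c : chart R (n + m) M) (xi : 'I_(n + m) -> M -> R) (K : 'I_(n + m) -> vfield M).
Variables (N : set M) (x : M).
Hypotheses (ac : atlas c) (oN : open N) (Nx : N x) (Nc : N `<=` chart_dom c).
Hypothesis sxi : forall i, Smooth (xi i).
Hypothesis vK : forall i, VField (K i).
Hypothesis xiE : forall y, N y -> forall i, xi i y = chart_map c y 0 i.
Hypothesis KE : forall y, N y -> forall i, K i y = coordinate_vector c i y.
Variable S : M -> R.
Hypothesis sS : Smooth S.
Hypothesis SE : forall y, N y -> S y = Num.sqrt (\det (gram g c y)).

(** Let psi be the difference of the two sides and chi a cutoff around x.
    Integration by parts against the test function chi * psi shows that the
    integral of chi * psi ^ 2 vanishes. *)
Lemma density_form h : Smooth h -> compact_support h ->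
  L h x * S x = \sum_i K i x (fun y => hg h y (xi i) * S y).
Proof.
move=> sh ch; pose W := hg h; have vW : VField W := vfield_hgrad sh; have hW : is_horizontal g V W := hgrad_hor sh.
have sL := Smooth_laplacian sh.
pose b i y := W y (xi i) * S y.
have sb i : Smooth (b i) := SmoothM (vfield_smooth vW (sxi i)) sS.
have sKb i : Smooth (fun y => K i y (b i)) := vfield_smooth (vK i) (sb i).
pose psi y := L h y * S y - \sum_i K i y (b i).
have sLS : Smooth (fun y => L h y * S y) := SmoothM sL sS.
have spsi : Smooth psi := SmoothB sLS (Smooth_sum sKb).
suff psi0 : psi x = 0 by apply/eqP; rewrite -subr_eq0; apply/eqP.
apply: contrapT => /eqP psi_neq0.
have cx := Nc Nx; pose a := chart_map c x.
have nN : nbhs x N by exact: open_nbhs_nbhs.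
have [e e0 ballN] := chart_ball_exists cx nN.
pose r := e / 2; have r0 : 0 < r by rewrite divr_gt0.
have re : r < e by rewrite /r ltr_pdivrMr // ltr_pMr // ltr1n.
have [chi [schi chi0 chi1 chiN]] := Cutoff (nbhs_chart_ball cx r0).
pose phi y := chi y * psi y.
have sphi : supported c a r phi.
  by split; [exact: SmoothM|move=> y /chiN; rewrite /phi => ->; rewrite mul0r].
have rball y : chart_ball c a r y -> N y.
  move=> [cy ry]; have := (ballN _ (le_trans ry (ltW re))).2.
  by rewrite chart_mapK.
pose P y := phi y * L h y; have sP : supported c a r P by exact: supportedM.
pose Q y := W y phi; have sQ : supported c a r Q by exact: (supported_vfield re ballN).
have PS := supportedM sP sS; have QS := supportedM sQ sS.
have parts : chart_integral c a e (fun y => P y * S y) = - chart_integral c a e (fun y => Q y * S y).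
  have [cphi _] := supported_compact re ballN sphi.
  have [sphi'] := supported_smooth sphi; have [sh'] := sh.
  have [_ _ /(_ phi h sphi' sh' cphi ch)] := L_laplacian.
  have -> : (fun y => (phi y * L h y)%:E) = fun y => (P y)%:E by [].
  have -> : (fun y => (Gamma g V phi h y)%:E) = fun y => (Q y)%:E.
    apply/funext => y; congr (_%:E); rewrite /Gamma.
    exact: (ip_hgrad y (supported_smooth sphi) vW hW).
  rewrite (volume_integral ac re ballN mu_volume SE sS sP).
  rewrite (volume_integral ac re ballN mu_volume SE sS sQ).
  by rewrite -EFinN => -[].
have sphib i : supported c a r (fun y => phi y * b i y) := supportedM sphi (sb i).
have sT i : supported c a r (fun y => K i y (fun z => phi z * b i z)).
  exact: (supported_vfield re ballN).
have [sTT intT] := chart_integral_sum ac re ballN sT.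
have intT0 : chart_integral c a e (fun y => \sum_i K i y (fun z => phi z * b i z)) = 0.
  rewrite intT big1 // => i _; exact: (chart_integral_coordinate ac re ballN i vK KE (sphib i)).
have QE y : Q y * S y = \sum_i K i y (fun z => phi z * b i z) - phi y * \sum_i K i y (b i).
  rewrite mulr_sumr -sumrB.
  have [yB|yB] := pselect (chart_ball c a r y).
    rewrite /Q (coordinate_expansion ac oN Nc sxi xiE KE (rball y yB) (vfield_tangent y vW) (supported_smooth sphi)).
    rewrite mulr_suml; apply: eq_bigr => i _.
    rewrite (tangentM (vfield_tangent y (vK i)) (supported_smooth sphi) (sb i)) addrAC subrr add0r.
    by rewrite /b mulrAC.
  rewrite (sQ.2 y yB) mul0r big1 // => i _; rewrite (sphi.2 y yB) mul0r subr0.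
  exact: (sT i).2.
have zero : chart_integral c a e (fun y => phi y * psi y) = 0.
  have -> : (fun y => phi y * psi y) = fun y => 1 * (P y * S y) +
      (-1 * (\sum_i K i y (fun z => phi z * b i z)) + Q y * S y).
    apply/funext => y; rewrite QE /P /psi; move: (\sum_i _) (\sum_i _) => s t.
    by move: (phi y) (L h y) (S y) => p q w; ring.
  rewrite (chart_integral_lin ac re ballN 1 PS (supported_lin _ sTT QS)).
  rewrite (chart_integral_lin ac re ballN _ sTT QS) intT0 parts.
  by rewrite mulr0 add0r mul1r addNr.
have sF := supportedM sphi spsi.
have pos y : 0 <= phi y * psi y.
  by rewrite /phi -mulrA -expr2; exact: mulr_ge0 (chi0 y) (sqr_ge0 _).
have ex : `|chart_map c x - a| < e by rewrite subrr normr0.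
have posx : 0 < phi x * psi x.
  by rewrite /phi -mulrA -expr2 (nbhs_singleton chi1) mul1r lt_neqAle sqr_ge0 eq_sym sqrf_eq0 psi_neq0.
by have := chart_integral_gt0 ac re ballN sF pos cx ex posx; rewrite zero ltxx.
Qed.

End IntegrationByParts.

Lemma laplacian_full_trace h x (F : 'I_(n + m) -> vfield M) : Smooth h -> compact_support h ->
  (forall i, VField (F i)) -> (forall i j, ip g (F i) (F j) x = (i == j)%:R) ->
  L h x = \sum_a ip g (D (F a) (hg h)) (F a) x.
Proof.
move=> sh ch vF oF.
have [c [xi [K [N [[ac oN Nx Nc] sxi vK xiE KE]]]]] := coordinates_exist x.
have dpos : 0 < \det (coordinate_gram K x).
  exact: (det_gram_gt0 ac oN Nx Nc sxi vK xiE KE vF oF).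
have sD : Smooth (fun y => \det (coordinate_gram K y)).
  apply: Smooth_det => i j; apply: Smooth_ext (Smooth_ip g_metric (vK i) (vK j)) => y.
  by rewrite mxE.
have [S sS SE] := Smooth_at_sqrt sD dpos.
have nN : nbhs x N by exact: open_nbhs_nbhs.
have nNS : \forall y \near x, N y /\ Num.sqrt (\det (coordinate_gram K y)) = S y.
  by apply: filterS2 nN SE => y.
have [N' [oN' N'x] N'E] := nbhs_open_sub nNS.
have N'N y : N' y -> N y by move=> /N'E [].
have gramE y : N y -> gram g c y = coordinate_gram K y.
  by move=> Ny; apply/matrixP => i j; rewrite !mxE /ip !KE.
have S_gt0 : 0 < S x by rewrite -(nbhs_singleton SE) sqrtr_gt0.
have SE' y : N' y -> S y = Num.sqrt (\det (gram g c y)).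
  by move=> /N'E [Ny <-]; rewrite gramE.
have N'c : N' `<=` chart_dom c by move=> y /N'N /Nc.
have sq : \forall y \near x, S y ^+ 2 = \det (coordinate_gram K y).
  have nD : \forall y \near x, 0 < \det (coordinate_gram K y).
    case: sD => /smooth_continuous /(_ x) ctD.
    have op : nbhs (\det (coordinate_gram K x)) [set t : R | 0 < t].
      by apply: open_nbhs_nbhs; split => //; exact: open_gt.
    exact: (ctD _ op).
  by apply: filterS2 SE nD => y <- /ltW /sqr_sqrtr.
have K1 y : N' y -> forall i, xi i y = chart_map c y 0 i by move=> /N'N; exact: xiE.
have K2 y : N' y -> forall i, K i y = coordinate_vector c i y by move=> /N'N; exact: KE.
have dens := density_form ac oN' N'x N'c sxi vK K1 K2 sS SE' sh ch.
exact: (divergence_trace ac oN Nx Nc sxi vK xiE KE vF oF (vfield_hgrad sh) sS S_gt0 sq dens).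
Qed.

(** The leaves being totally geodesic, the vertical fields of an adapted frame do
    not contribute to the trace. *)
Lemma laplacian_compact h x (E : 'I_n -> vfield M) : Smooth h -> compact_support h ->
  (forall i, VField (E i)) -> (forall i, is_horizontal g V (E i)) ->
  (forall i j, ip g (E i) (E j) x = (i == j)%:R) ->
  L h x = \sum_i ip g (nab (E i) (hg h)) (E i) x.
Proof.
move=> sh ch vE hE oE.
have [_ [Z [_ vZ _ /nbhs_singleton oZ]]] := adapted_frame g_metric V_foliation x.
have vZ' i := (vZ i).1; have wZ i := (vZ i).2.
have vF := vfield_join_frames vE vZ'.
have oF : forall i j, ip g (join_frames E Z i) (join_frames E Z j) x = (i == j)%:R.
  exact: join_frames_orthonormal hE wZ oE oZ.
rewrite (laplacian_full_trace sh ch vF oF) big_split_ord /=.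
have [vW hW] := (vfield_hgrad sh, hgrad_hor sh).
rewrite [X in _ + X]big1 ?addr0 => [|l _].
  apply: eq_bigr => i _; rewrite join_framesl (nab_hh (vE i) vW (hE i) hW).
  by rewrite (ip_hproj g_metric V_foliation (vfield_D (vE i) vW) (hE i x)).
rewrite join_framesr.
have H : Z l x (ip g (hg h) (Z l)) = ip g (D (Z l) (hg h)) (Z l) x + ip g (hg h) (D (Z l) (Z l)) x.
  exact: D_metric.
have E0 : ip g (hg h) (Z l) = fun=> 0 by apply/funext => y; exact: ip_hv (hW y) (wZ l y).
have E1 : ip g (hg h) (D (Z l) (Z l)) x = 0.
  exact: ip_hv (hW x) (D_vertical (vZ' l) (vZ' l) (wZ l) (wZ l) x).
by move: H; rewrite E0 E1 (tangent_cst _ (vfield_tangent x (vZ' l))) addr0 => <-.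
Qed.

(** By locality h may be multiplied by a cutoff, which makes its support compact. *)
Lemma laplacian_frame h x (E : 'I_n -> vfield M) : Smooth h ->
  (forall i, VField (E i)) -> (forall i, is_horizontal g V (E i)) ->
  (forall i j, ip g (E i) (E j) x = (i == j)%:R) ->
  L h x = \sum_i ip g (nab (E i) (hg h)) (E i) x.
Proof.
move=> sh vE hE oE.
have [c [xi [K [N [[ac oN Nx Nc] _ _ _ _]]]]] := coordinates_exist x.
have cx := Nc _ Nx; have nN : nbhs x N by exact: open_nbhs_nbhs.
have [e e0 ballN] := chart_ball_exists cx nN.
pose r := e / 2; have r0 : 0 < r by rewrite divr_gt0.
have re : r < e by rewrite /r ltr_pdivrMr // ltr_pMr // ltr1n.
have [chi [schi chi0 chi1 chiN]] := Cutoff (nbhs_chart_ball cx r0).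
pose k y := chi y * h y.
have sk : supported c (chart_map c x) r k.
  by split; [exact: SmoothM|move=> y /chiN; rewrite /k => ->; rewrite mul0r].
have ck := (supported_compact re ballN sk).1.
have nk : \forall y \near x, k y = h y by apply: filterS chi1 => y; rewrite /k => ->; rewrite mul1r.
have [U [oU Ux] UE] := nbhs_open_sub nk.
have Sk := supported_smooth sk.
have -> : L h x = L k x.
  have [_ loc _] := L_laplacian; case: sh Sk => sh [Sk].
  by apply/esym; exact: (loc k h U Sk sh oU UE x Ux).
have same X y : VField X -> U y -> X y k = X y h.
  move=> vX Uy; apply: (tangent_local (vfield_tangent y vX) Sk sh).
  have : nbhs y U by exact: open_nbhs_nbhs.
  by apply: filterS => z; exact: UE.
rewrite (laplacian_compact Sk ck vE hE oE); apply: eq_bigr => i _.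
rewrite (hessian_hor x Sk (vE i) (vE i) (hE i)) (hessian_hor x sh (vE i) (vE i) (hE i)).
rewrite (same _ x (vfield_nab (vE i) (vE i)) Ux); congr (_ - _).
apply: (tangent_local (vfield_tangent x (vE i)) (vfield_smooth (vE i) Sk) (vfield_smooth (vE i) sh)).
have : nbhs x U by exact: open_nbhs_nbhs.
by apply: filterS => y Uy; exact: same (vE i) Uy.
Qed.

End Laplacian.

Lemma ipZr h X Z x : VField X -> VField Z -> Smooth h -> ip g Z (vscale h X) x = h x * ip g Z X x.
Proof.
move=> vX vZ sh; rewrite (ipC g_metric x vZ (vfieldZ sh vX)) (ipZl g_metric h x vX vZ).
by rewrite (ipC g_metric x vX vZ).
Qed.

Lemma ip_sqr_hor x (E : 'I_n -> vfield M) W : (forall i, VField (E i)) ->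
  (forall i, is_horizontal g V (E i)) -> (forall i j, ip g (E i) (E j) x = (i == j)%:R) ->
  VField W -> is_horizontal g V W -> ip g W W x = \sum_i ip g W (E i) x ^+ 2.
Proof.
move=> vE hE oE vW hW; rewrite {1}/ip {1}(hor_span vE hE oE (hW x)).
rewrite (g_sum g_metric _ (fun i => vfield_tangent x (vE i)) (vfield_tangent x vW)).
by apply: eq_bigr => i _; rewrite (g_sym g_metric (vfield_tangent x (vE i)) (vfield_tangent x vW)) -expr2.
Qed.

Lemma ip_sqr_vert x (Z : 'I_m -> vfield M) W : (forall i, VField (Z i)) ->
  (forall i, is_vertical V (Z i)) -> (forall i j, ip g (Z i) (Z j) x = (i == j)%:R) ->
  VField W -> is_vertical V W -> ip g W W x = \sum_i ip g W (Z i) x ^+ 2.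
Proof.
move=> vZ wZ oZ vW wW; rewrite {1}/ip {1}(vert_span vZ wZ oZ (wW x)).
rewrite (g_sum g_metric _ (fun i => vfield_tangent x (vZ i)) (vfield_tangent x vW)).
by apply: eq_bigr => i _; rewrite (g_sym g_metric (vfield_tangent x (vZ i)) (vfield_tangent x vW)) -expr2.
Qed.

(** * The maps J *)

Lemma tor0r X : VField X -> tor X 0%F = 0%F.
Proof.
move=> vX; rewrite /torsion (nab0r vX) (nab0l vX) (bracket0r vX).
by apply/funext => x; apply/funext => f; rewrite /vsub /vadd /vopp oppr0 !addr0.
Qed.

Lemma torZr h X Y : Smooth h -> VField X -> VField Y -> tor X (vscale h Y) = vscale h (tor X Y).
Proof.
move=> sh vX vY; have v0 := vfield_zero (M := M).
by rewrite -[vscale h Y]vadd0 (tor_combr sh vX vY v0) (tor0r vX) vadd0.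
Qed.

Lemma hor_inj x u v : hor x u -> hor x v ->
  (forall Y, VField Y -> is_horizontal g V Y -> g x u (Y x) = g x v (Y x)) -> u = v.
Proof.
move=> hu hv uv; apply: (g_inj g_metric (hor_tangent hu) (hor_tangent hv)) => w tw.
have [Y vY <-] := tangent_extend tw; have vH := vfield_HP vY.
have H z : hor x z -> g x z (Y x) = g x z (HP Y x).
  move=> hz; have [U vU Uz] := tangent_extend (hor_tangent hz).
  have hU : hor x (U x) by rewrite Uz.
  have := ip_hprojr vY vU hU; by rewrite /ip Uz => ->.
rewrite (H u hu) (H v hv); exact: uv vH (is_horizontal_hproj vY).
Qed.

(** Near x the field sum_i g (T(HP X, E_i), Z) E_i of an orthonormal frame has the
    defining property of J Z X, by tensoriality, and this property determines a
    horizontal vector. *)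
Lemma JP Z X x : VField Z -> VField X ->
  [/\ hor x (JJ Z X x),
      forall Y, VField Y -> is_horizontal g V Y -> g x (JJ Z X x) (Y x) = ip g Z (tor (HP X) Y) x
    & exists2 W, VField W & \forall y \near x, JJ Z X y = W y].
Proof.
move=> vZ vX; have vH := vfield_HP vX.
have [E [_ [vE _ oE _]]] := adapted_frame g_metric V_foliation x.
have vEi i := (vE i).1; have hEi i := (vE i).2; have vT i := vfield_tor vH (vEi i).
pose c i : M -> R := ip g (tor (HP X) (E i)) Z.
have sc i : Smooth (c i) := Smooth_ip g_metric (vT i) vZ.
pose W := vsum (fun i => vscale (c i) (E i)).
have vW : VField W by apply: vfield_sum => i; exact: vfieldZ (sc i) (vEi i).
have key y : (forall i j, ip g (E i) (E j) y = (i == j)%:R) ->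
    hor y (W y) /\ forall Y, VField Y -> is_horizontal g V Y ->
      g y (W y) (Y y) = ip g Z (tor (HP X) Y) y.
  move=> oy; split; first by apply: (hor_sum g_metric V_foliation) => i; exact: hEi.
  move=> Y vY hY.
  rewrite (g_sum g_metric (c^~ y) (fun i => vfield_tangent y (vEi i)) (vfield_tangent y vY)).
  rewrite (ipC g_metric y vZ (vfield_tor vH vY)).
  have YE : Y y = fun f => \sum_i ip g Y (E i) y * E i y f by exact: hor_span vEi hEi oy (hY y).
  rewrite (tensorial_sum (F := fun U => ip g (tor (HP X) U) Z y) (c := fun i => ip g Y (E i) y) _ _ vEi vY YE).
  - apply: eq_bigr => i _; rewrite /c mulrC; congr (_ * _); exact: (ipC g_metric y (vEi i) vY).
  - move=> U U' vU vU'; rewrite (torDr vH vU vU'); exact: (ipDl g_metric y (vfield_tor vH vU) (vfield_tor vH vU') vZ).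
  - move=> h U sh vU; rewrite (torZr sh vH vU); exact: (ipZl g_metric h y (vfield_tor vH vU) vZ).
have JE y : (forall i j, ip g (E i) (E j) y = (i == j)%:R) -> JJ Z X y = W y.
  move=> oy; have [hWy WP] := key y oy; rewrite /J.
  case: xgetP => [u _ [hu uP]|/(_ (W y)) []]; last first.
    by split=> // Y /VFieldI vY; exact: WP.
  apply: (hor_inj hu hWy) => Y vY hY; rewrite (WP Y vY hY).
  by case: vY => vY; exact: uP.
have o0 := nbhs_singleton oE; have [hW0 WP0] := key x o0.
rewrite (JE x o0); split => //; exists W => //; by apply: filterS oE => y /JE.
Qed.

Lemma vfield_J Z X : VField Z -> VField X -> VField (JJ Z X).
Proof.
move=> vZ vX; apply: vfield_local => x; have [_ _ [W vW WE]] := JP x vZ vX.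
by exists W.
Qed.

Lemma J_hor Z X : VField Z -> VField X -> is_horizontal g V (JJ Z X).
Proof. by move=> vZ vX x; have [] := JP x vZ vX. Qed.

Lemma ip_J Z X Y x : VField Z -> VField X -> VField Y -> is_horizontal g V X ->
  is_horizontal g V Y -> ip g (JJ Z X) Y x = ip g (tor X Y) Z x.
Proof.
move=> vZ vX vY hX hY; have [_ H _] := JP x vZ vX; rewrite /ip (H Y vY hY).
rewrite (hproj_field g_metric V_foliation hX); exact: (ipC g_metric x vZ (vfield_tor vX vY)).
Qed.

Lemma ip_JJ Z X x : VField Z -> VField X -> is_horizontal g V X ->
  ip g (JJ Z (JJ Z X)) X x = - ip g (JJ Z X) (JJ Z X) x.
Proof.
move=> vZ vX hX; have [vJ hJ] := (vfield_J vZ vX, J_hor vZ vX).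
rewrite (ip_J x vZ vJ vX hJ hX) torC (ipNl g_metric x (vfield_tor vX vJ) vZ).
by rewrite -(ip_J x vZ vX vJ hX hJ).
Qed.

Lemma flat_one_form X : VField X -> is_one_form (flat g X).
Proof.
move=> vX; split => [Y /VFieldI vY|h Y Y' /SmoothI sh /VFieldI vY /VFieldI vY' x].
  by case: (Smooth_ip g_metric vX vY).
by rewrite /flat (ipDr x (vfieldZ sh vY) vY' vX) (ipZr x vY vX sh).
Qed.

Lemma flat_horizontal X : VField X -> is_horizontal g V X -> horizontal_form V (flat g X).
Proof.
move=> vX hX; split; first exact: flat_one_form.
by move=> Y _ wY x; exact: ip_hv (hX x) (wY x).
Qed.

Lemma flat_vertical X : VField X -> is_vertical V X -> vertical_form g V (flat g X).
Proof.
move=> vX wX; split; first exact: flat_one_form.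
by move=> Y _ hY x; exact: (ip_vh g_metric V_foliation (wX x) (hY x)).
Qed.

(** * The curvature dimension inequality *)

Section Inequality.
Variable L : (M -> R) -> M -> R.
Hypothesis n_gt0 : (0 < n)%N.
Hypothesis Smooth_L : forall h, Smooth h -> Smooth (L h).
Hypothesis L_frame : forall h x (E : 'I_n -> vfield M), Smooth h -> (forall i, VField (E i)) ->
  (forall i, is_horizontal g V (E i)) -> (forall i j, ip g (E i) (E j) x = (i == j)%:R) ->
  L h x = \sum_i ip g (nab (E i) (hg h)) (E i) x.
Hypothesis ym : yang_mills g V D.
Variables (rho1 kappa rho2 : R).
Hypothesis Ric_ge : forall eta1 : one_form M, horizontal_form V eta1 ->
  forall (x : M) (E : 'I_(n + m) -> vfield M), orthonormal_near g x E ->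
    rho1 * cometric g eta1 eta1 x <= cometric g (Ric_H g V D E eta1) eta1 x.
Hypothesis J2_le : forall eta1 : one_form M, horizontal_form V eta1 ->
  forall (x : M) (Z : 'I_m -> vfield M), vertical_frame g V x Z ->
    - cometric g (dual_action g (J2 g V D Z) eta1) eta1 x <= kappa * cometric g eta1 eta1 x.
Hypothesis trJ2_ge : forall eta2 : one_form M, vertical_form g V eta2 ->
  forall (x : M) (E : 'I_n -> vfield M), horizontal_frame g V x E ->
    rho2 * cometric g eta2 eta2 x
      <= - 4^-1 * trace_H g E (J_form g V D eta2 \o J_form g V D eta2) x.

(** The three curvature bounds are applied to the horizontal part A and the
    vertical part B of the gradient. The antisymmetric part of the
    horizontal Hessian is - 1/2 of the torsion paired with B, so that the trace
    of J_B ^ 2 bounds its norm. *)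
Lemma curvature_dimension f (eps : R) x : Smooth f -> 0 < eps ->
  n%:R^-1 * (L f x) ^+ 2 + (rho1 - kappa / eps) * Gamma g V f f x + rho2 * GammaV g V f f x
  <= Gamma2 g V L f f x + eps * GammaV2 g V L f f x.
Proof.
move=> sf e0; have [E [Z [vE' vZ' oE oZ]]] := adapted_frame g_metric V_foliation x.
have vE i := (vE' i).1; have hE i := (vE' i).2.
have vZ i := (vZ' i).1; have wZ i := (vZ' i).2.
have oEx := nbhs_singleton oE; have oZx := nbhs_singleton oZ.
rewrite (bochner_horizontal sf Smooth_L L_frame vE hE oE ym).
rewrite (bochner_vertical sf Smooth_L L_frame vE hE oE).
rewrite (L_frame sf vE hE oEx) /Gamma /GammaV.
have [vA hA] := (vfield_hgrad sf, hgrad_hor sf); have [vB wB] := (vfield_vgrad sf, vgrad_vert sf).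
have hsym X Y : VField X -> VField Y -> is_horizontal g V X -> is_horizontal g V Y ->
  ip g (nab X (hg f)) Y x = ip g (nab Y (hg f)) X x - ip g (tor X Y) (vg f) x.
  exact: hessian_sym.
move: vA hA vB wB hsym.
set A := hg f; set B := vg f => vA hA vB wB hsym.
pose a i j := ip g (nab (E i) A) (E j) x.
pose b i j := ip g (tor (E i) (E j)) B x.
have vEA i := vfield_nab (vE i) vA; have hEA i := nab_hor (vE i) vA hA.
have vEB i := vfield_nab (vE i) vB; have vT i := vfield_tor (vE i) vA; have wT i := tor_vertical (vE i) vA.
have hf : horizontal_frame g V x E.
  split; [split|] => [i|i j|j]; [by case: (vE i)|by apply: filterS oE => y|].
  by apply: near_all => y; exact: hE.
have vf : vertical_frame g V x Z.
  split; [split|] => [i|i j|j]; [by case: (vZ i)|by apply: filterS oZ => y|].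
  by apply: near_all => y; exact: wZ.
have jf : orthonormal_near g x (join_frames E Z).
  split => [i|i j]; first by case: (vfield_join_frames vE vZ i).
  by apply: filterS2 oE oZ => y oy oy'; exact: join_frames_orthonormal hE wZ oy oy' i j.
have h1 : rho1 * ip g A A x <= \sum_i ip g (curv (E i) A A) (E i) x.
  have := Ric_ge (flat_horizontal vA hA) jf.
  rewrite /cometric /Ric_H (sharp_flat g_metric vA) /flat (hproj_field g_metric V_foliation hA).
  rewrite /ricci big_split_ord /= [X in _ + X]big1 ?addr0 => [|i _].
    by under eq_bigr do rewrite join_framesl.
  rewrite join_framesr; exact: ip_hv (curv_hor (vZ i) vA vA hA x) (wZ i x).
have h2 : n%:R^-1 * (\sum_i a i i) ^+ 2 + 4^-1 * \sum_i \sum_j b i j ^+ 2 <=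
    \sum_i ip g (nab (E i) A) (nab (E i) A) x.
  under [X in _ <= X]eq_bigr => i _ do rewrite (ip_sqr_hor vE hE oEx (vEA i) (hEA i)).
  by apply: matrix_sqr_ge n_gt0 _ => i j; exact: hsym (vE i) (vE j) (hE i) (hE j).
have h3 : rho2 * ip g B B x <= 4^-1 * \sum_i \sum_j b i j ^+ 2.
  have := trJ2_ge (flat_vertical vB wB) hf.
  rewrite /cometric /trace_H /J_form (sharp_flat g_metric vB) /flat mulNr -mulrN -sumrN.
  congr (_ <= 4^-1 * _); apply: eq_bigr => i _ /=.
  have vJ := vfield_J vB (vE i); have hJ := J_hor vB (vE i).
  rewrite (ip_JJ x vB (vE i) (hE i)) opprK (ip_sqr_hor vE hE oEx vJ hJ).
  by apply: eq_bigr => j _; rewrite (ip_J x vB (vE i) (vE j) (hE i) (hE j)).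
have h4 : \sum_i ip g (tor (E i) A) (tor (E i) A) x <= kappa * ip g A A x.
  have := J2_le (flat_horizontal vA hA) vf.
  rewrite /cometric /dual_action (sharp_flat g_metric vA) /flat /J2.
  have vJ l := vfield_J (vZ l) vA; have hJ l := J_hor (vZ l) vA.
  rewrite (ip_suml g_metric x (fun l => vfield_J (vZ l) (vJ l)) vA) -sumrN.
  congr (_ <= _).
  under [RHS]eq_bigr => i _ do rewrite (ip_sqr_vert vZ wZ oZx (vT i) (wT i)).
  rewrite exchange_big /=; apply: eq_bigr => l _.
  rewrite (ip_JJ x (vZ l) vA hA) opprK (ip_sqr_hor vE hE oEx (vJ l) (hJ l)).
  apply: eq_bigr => i _; rewrite (ip_J x (vZ l) vA (vE i) hA (hE i)).
  by rewrite torC (ipNl g_metric x (vT i) (vZ l)) sqrrN.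
(* |T(E_i, A) - eps * nab_(E_i) B| ^ 2 >= 0 *)
have h5 i : 2 * ip g (tor (E i) A) (nab (E i) B) x <=
    eps^-1 * ip g (tor (E i) A) (tor (E i) A) x + eps * ip g (nab (E i) B) (nab (E i) B) x.
  have sc := Smooth_cst (M := M) (- eps).
  have vS := vfieldD (vT i) (vfieldZ sc (vEB i)).
  have := g_ge0 g_metric (vfield_tangent x vS).
  rewrite -/(ip g _ _ x) (ipDl g_metric x (vT i) (vfieldZ sc (vEB i)) vS).
  rewrite (ipZl g_metric _ x (vEB i) vS) (ipDr x (vT i) (vfieldZ sc (vEB i)) (vT i)).
  rewrite (ipDr x (vT i) (vfieldZ sc (vEB i)) (vEB i)) (ipZr x (vEB i) (vT i) sc).
  rewrite (ipZr x (vEB i) (vEB i) sc) (ipC g_metric x (vEB i) (vT i)).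
  exact: square_arith e0.
have h5' : 2 * \sum_i ip g (tor (E i) A) (nab (E i) B) x <=
    eps^-1 * \sum_i ip g (tor (E i) A) (tor (E i) A) x +
    eps * \sum_i ip g (nab (E i) B) (nab (E i) B) x.
  by rewrite !mulr_sumr -big_split; apply: ler_sum => i _; exact: h5.
rewrite sumrB big_split -[X in _ - X + _]mulr_sumr /=.
exact: final_arith e0 h1 h2 h3 h4 h5'.
Qed.

End Inequality.

End Bott.

Theorem theorem4p8 (R : realType) (n m : nat) (n_gt0 : (0 < n)%N)
    (M : manifold R (n + m)) (M_connected : connected [set: M])
    (g : M -> ((M -> R) -> R) -> ((M -> R) -> R) -> R)
    (g_metric : is_metric g) (g_complete : complete_metric g)
    (V : M -> set ((M -> R) -> R)) (V_foliation : is_riemannian_foliation g V)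
    (D : vfield M -> vfield M -> vfield M) (D_levi_civita : is_levi_civita g D)
    (leaves_geodesic : totally_geodesic_leaves V D)
    (H_yang_mills : yang_mills g V D)
    (mu : {measure set (g_sigma_algebraType (@open M)) -> \bar R})
    (mu_volume : is_riemannian_volume g mu)
    (L : (M -> R) -> (M -> R)) (L_laplacian : is_horizontal_laplacian g V mu L)
    (rho1 kappa rho2 : R) (kappa_gt0 : 0 < kappa) (rho2_gt0 : 0 < rho2)
    (Ric_ge : forall eta1 : one_form M, horizontal_form V eta1 ->
      forall (x : M) (E : 'I_(n + m) -> vfield M), orthonormal_near g x E ->
        rho1 * cometric g eta1 eta1 x
          <= cometric g (Ric_H g V D E eta1) eta1 x)
    (J2_le : forall eta1 : one_form M, horizontal_form V eta1 ->
      forall (x : M) (Z : 'I_m -> vfield M), vertical_frame g V x Z ->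
        - cometric g (dual_action g (J2 g V D Z) eta1) eta1 x
          <= kappa * cometric g eta1 eta1 x)
    (trJ2_ge : forall eta2 : one_form M, vertical_form g V eta2 ->
      forall (x : M) (E : 'I_n -> vfield M), horizontal_frame g V x E ->
        rho2 * cometric g eta2 eta2 x
          <= - 4^-1 * trace_H g E (J_form g V D eta2 \o J_form g V D eta2) x) :
  (forall (f : M -> R) (eps : R), smooth f -> 0 < eps -> forall x : M,
     n%:R^-1 * (L f x) ^+ 2 + (rho1 - kappa / eps) * Gamma g V f f x
       + rho2 * GammaV g V f f x
     <= Gamma2 g V L f f x + eps * GammaV2 g V L f f x) /\
  (forall f : M -> R, smooth f -> forall x : M,
     Gamma g V f (GammaV g V f f) x = GammaV g V f (Gamma g V f f) x).
Proof.
have sL f : Smooth f -> Smooth (L f) by move=> sf; exact: (Smooth_laplacian L_laplacian sf).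
split=> [f eps /SmoothI sf e0 x|f /SmoothI sf x].
  apply: (curvature_dimension g_metric V_foliation D_levi_civita leaves_geodesic n_gt0 sL _
    H_yang_mills Ric_ge J2_le trJ2_ge x sf e0).
  move=> h y E; exact: (laplacian_frame g_metric V_foliation D_levi_civita leaves_geodesic
    mu_volume L_laplacian).
exact: (Gamma_GammaV_commute g_metric V_foliation D_levi_civita leaves_geodesic x sf).
Qed.
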